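(* Suppose single sample splitting is performed, with $\hat\psi^{\mathrm{INT}}_{k_1,k_2}$, $\hat\psi^{\mathrm{MC}}_{k_1,k_2}$, $\hat\psi^{\mathrm{IF}}_{k_1,k_2}$ the single sample split estimators of $\psi(\mathbb P)=\mathbb E_{\mathbb P}[\mathrm{Cov}_{\mathbb P}(A,Y\mid X)]$ defined in the context. Write $k_{\min}=k_1\wedge k_2$ and $k_{\max}=k_1\vee k_2$. Then: 1) $\displaystyle\sup_{\mathbb P\in\mathcal P_{(\alpha,\beta)}}\left|\mathbb E_{\mathbb P}\left(\hat\psi^{\mathrm{INT}}_{k_1,k_2}-\psi(\mathbb P)\right)\right|\asymp k_{\min}^{-(\alpha+\beta)/d}\vee\frac{k_{\min}}n$ and $\displaystyle\sup_{\mathbb P\in\mathcal P_{(\alpha,\beta)}}\mathrm{Var}_{\mathbb P}(\hat\psi^{\mathrm{INT}}_{k_1,k_2})\lesssim\frac1n+\frac{k_{\min}}{n^2}+\frac{k_{\min}^2}{n^3}$. 2) $\displaystyle\sup_{\mathbb P\in\mathcal P_{(\alpha,\beta)}}\left|\mathbb E_{\mathbb P}\left(\hat\psi^{\mathrm{MC}}_{k_1,k_2}-\psi(\mathbb P)\right)\right|\asymp k_{\min}^{-(\alpha+\beta)/d}\vee\frac{k_{\min}}n$ and $\displaystyle\sup_{\mathbb P\in\mathcal P_{(\alpha,\beta)}}\mathrm{Var}_{\mathbb P}(\hat\psi^{\mathrm{MC}}_{k_1,k_2})\lesssim\frac1n+\frac{k_{\max}}{n^2}+\frac{k_{\min}k_{\max}}{n^3}+\frac{k_{\min}^2k_{\max}}{n^4}$.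 3) $\displaystyle\sup_{\mathbb P\in\mathcal P_{(\alpha,\beta)}}\left|\mathbb E_{\mathbb P}\left(\hat\psi^{\mathrm{IF}}_{k_1,k_2}-\psi(\mathbb P)\right)\right|\asymp k_{\max}^{-(\alpha+\beta)/d}\vee\frac{k_{\min}}n$ and $\displaystyle\sup_{\mathbb P\in\mathcal P_{(\alpha,\beta)}}\mathrm{Var}_{\mathbb P}(\hat\psi^{\mathrm{IF}}_{k_1,k_2})\lesssim\frac1n+\frac{k_{\max}}{n^2}+\frac{k_{\min}k_{\max}}{n^3}+\frac{k_{\min}^2k_{\max}}{n^4}$.
   Context: Notation. $a\vee b=\max(a,b)$, $a\wedge b=\min(a,b)$; integrals are over $[0,1]^d$. For nonnegative sequences, $a_n\lesssim b_n$ means there is a constant $C>0$ with $a_n\le Cb_n$ for all $n\ge n_0$; $a_n\gtrsim b_n$ means $b_n\lesssim a_n$; $a_n\asymp b_n$ means both. Resolutions $k_1,k_2$ may depend on $n$; implicit constants do not depend on $n$ or the resolutions. Wavelets. Fix a compactly supported Cohen–Daubechies–Vial type orthonormal wavelet basis $\{\Phi_{J_0m},\Psi^{\iota}_{lm'}: m\in\mathcal Z_{J_0},\,m'\in\mathcal Z_l,\,\iota\in\{0,1\}^d\setminus\{0\},\,l\ge J_0\}$ of $L^2([0,1]^d)$ of regularity $S\ge1$, $S>\alpha\vee\beta$, with $2^{J_0}\ge S$, $|\mathcal Z_l|\asymp 2^{ld}$. For $j\ge J_0$ let $V_j=\mathrm{span}\{\Phi_{jm}:m\in\mathcal Z_j\}$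 ($\{\Phi_{jm}\}_m$ the orthonormal scaling functions at level $j$; the $V_j$ are nested). A resolution is a number $k=2^{jd}$, $j\ge J_0$; write $V_k,\Phi_{km},\mathcal Z_k$ for $V_j,\Phi_{jm},\mathcal Z_j$. Standard properties: $|\Phi_{km}|\lesssim\sqrt k$ uniformly with support in a set of Lebesgue measure $O(1/k)$; $V_k$ contains all polynomials of degree at most $S-1$. The projection kernel is $K_{V_k}(x,y)=\sum_{m\in\mathcal Z_k}\Phi_{km}(x)\Phi_{km}(y)$. Hölder ball. $H(\alpha,M)$ is the set of uniformly continuous $h:[0,1]^d\to\mathbb R$ with $2^{J_0(\alpha+d/2)}\max_m|\langle h,\Phi_{J_0m}\rangle|+\sup_{l\ge J_0,m\in\mathcal Z_l,\iota}2^{l(\alpha+d/2)}|\langle h,\Psi^\iota_{lm}\rangle|\le M$. Model. $\mathcal P_{(\alpha,\beta)}$ is the set of distributions $\mathbb P$ of $(X,A,Y)\in[0,1]^d\times\mathbb R\times\mathbb R$ with $X\sim\mathrm{Uniform}([0,1]^d)$, $A,Y\in[C_1,C_2]$ a.s., $p(x):=\mathbb E_{\mathbb P}[A\mid X=x]\in H(\alpha,M)$ and $b(x):=\mathbb E_{\mathbb P}[Y\mid X=x]\in H(\beta,M)$, where $C_1,C_2\in\mathbb R$, $\alpha,\beta,M>0$ are fixed known constants. The functional is $\psi(\mathbb P)=\mathbb E_{\mathbb P}[\mathrm{Cov}_{\mathbb P}(A,Y\mid X)]$. Estimators. I.i.d. observations from $\mathbb P$ are split into disjoint subsamples $\mathcal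 D_1,\mathcal D_2,\dots$, each of size $n$. Put $\hat p^{(j)}_k(x)=\frac1n\sum_{i\in\mathcal D_j}A_iK_{V_k}(X_i,x)$ and $\hat b^{(j)}_k(x)=\frac1n\sum_{i\in\mathcal D_j}Y_iK_{V_k}(X_i,x)$. With single sample splitting (both nuisance functions estimated from $\mathcal D_1$): $\hat\psi^{\mathrm{INT}}_{k_1,k_2}=\frac1n\sum_{i\in\mathcal D_2}A_iY_i-\int\hat p^{(1)}_{k_1}(x)\hat b^{(1)}_{k_2}(x)\,dx$; $\hat\psi^{\mathrm{MC}}_{k_1,k_2}=\frac1n\sum_{i\in\mathcal D_2}A_iY_i-\frac1n\sum_{i\in\mathcal D_3}\hat p^{(1)}_{k_1}(X_i)\hat b^{(1)}_{k_2}(X_i)$; $\hat\psi^{\mathrm{IF}}_{k_1,k_2}=\frac1n\sum_{i\in\mathcal D_2}(A_i-\hat p^{(1)}_{k_1}(X_i))(Y_i-\hat b^{(1)}_{k_2}(X_i))$.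
   Formalization: Added assumption: for some e>0 there are p in H(α,M−e) and b in H(β,M−e) with values in [C1+e,C2−e]. Without it the bias lower bounds fail, e.g. if C1=C2 (no truncation bias) or if M is too small for C1>0 (empty model). *)

(* Defs.v *)
From HB Require Import structures.
From mathcomp Require Import all_boot all_order all_algebra.
From mathcomp Require Import all_classical all_reals all_analysis.

Set Implicit Arguments.
Unset Strict Implicit.
Unset Printing Implicit Defensive.
Import Order.TTheory GRing.Theory Num.Theory.
Import numFieldNormedType.Exports.

Local Open Scope classical_set_scope.
Local Open Scope ring_scope.

Section product_probability.
Context d1 d2 (T1 : measurableType d1) (T2 : measurableType d2) (R : realType).
Variables (P : probability T1 R) (Q : probability T2 R).

Definition prod_prob : set (T1 * T2) -> \bar R := (P \x Q)%E.

HB.instance Definition _ := Measure.on prod_prob.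

Let prod_prob_setT : prod_prob setT = 1%E.
Proof.
rewrite /prod_prob -setXTT [LHS]product_measure1E//.
by rewrite -[RHS]mule1; congr (_ * _)%E; exact: probability_setT.
Qed.

HB.instance Definition _ :=
  Measure_isProbability.Build _ _ _ prod_prob prod_prob_setT.

End product_probability.

Section iid.
Context d (T : measurableType d) (R : realType).

Definition tuple_cons n (x : T * n.-tuple T) : n.+1.-tuple T :=
  [tuple of x.1 :: x.2].

Lemma measurable_tuple_cons n : measurable_fun [set: T * n.-tuple T] (@tuple_cons n).
Proof. by apply: measurable_cons. Qed.

HB.instance Definition _ n := isMeasurableFun.Build _ _ _ _ (@tuple_cons n)
  (@measurable_tuple_cons n).

(* The n-fold product P x ... x P, i.e. the law of n i.i.d. draws from P. *)
Fixpoint iid (P : probability T R) n : probability (n.-tuple T) R :=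
  match n with
  | 0 => dirac ([tuple] : 0.-tuple T)
  | m.+1 => distribution (prod_prob P (iid P m)) (@tuple_cons m)
  end.

End iid.

Section unif01.
Context (R : realType).

(* The library's uniform law lives on measurableTypeR R; unif01 is the same law
   on R with its canonical (Borel) sigma-algebra. *)
Definition unif01 (A : set R) : \bar R := uniform_prob (@ltr01 R) A.

HB.instance Definition _ := isMeasure.Build _ _ _ unif01
  (measure0 (uniform_prob (@ltr01 R)))
  (measure_ge0 (uniform_prob (@ltr01 R)))
  (@measure_semi_sigma_additive _ _ _ (uniform_prob (@ltr01 R))).

HB.instance Definition _ := Measure_isProbability.Build _ _ _ unif01
  (probability_setT (uniform_prob (@ltr01 R))).

End unif01.

Section cube.
Context (R : realType) (d : nat).

Definition cube : set (d.-tuple R) := [set x | forall i, 0 <= tnth x i <= 1].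

(* Uniform([0,1]^d); the cube has volume 1, so integrating over the cube
   against this law is integrating with respect to Lebesgue measure. *)
Definition unif_cube : probability (d.-tuple R) R :=
  iid (@unif01 R) d.

Definition inner (f g : d.-tuple R -> R) : R :=
  \int[unif_cube]_(x in cube) (f x * g x).

Definition unif_continuous_cube (h : d.-tuple R -> R) : Prop :=
  forall e : R, 0 < e -> exists2 r : R, 0 < r &
    forall x y, cube x -> cube y ->
      (forall i, `|tnth x i - tnth y i| < r) -> `|h x - h y| < e.

End cube.

(* One-dimensional Cohen-Daubechies-Vial type wavelets.  The boolean selects
   scaling functions (false) or wavelets (true).  The i-th function at level j
   is 2^(j/2) g(2^j x - t), where t is an integer and g is one of finitely many
   generators: the interior function and the left and right edge functions
   (t = 0 at the left edge, t = 2^j at the right edge). *)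
Record wavelets (R : realType) := Wavelets {
  gen_index : finType ;
  wgen : bool -> gen_index -> R -> R ;
  wnum : nat -> nat ;
  wtype : bool -> forall j, 'I_(wnum j) -> gen_index ;
  wshift : bool -> forall j, 'I_(wnum j) -> int }.

Section wavelet_basis.
Context (R : realType) (d : nat) (w : wavelets R).

Definition wave1 (b : bool) (j : nat) (i : 'I_(wnum w j)) (x : R) : R :=
  Num.sqrt (2 ^+ j) * wgen b (wtype b i) (2 ^+ j * x - (wshift b i)%:~R).

(* The location set Z_j and the orientations iota in {0,1}^d. *)
Definition loc (j : nat) : finType := {ffun 'I_d -> 'I_(wnum w j)}.
Definition orient : finType := {ffun 'I_d -> bool}.
Definition orient0 : orient := [ffun=> false].

Definition wave (o : orient) (j : nat) (m : loc j) (x : d.-tuple R) : R :=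
  \prod_(i < d) wave1 (o i) (m i) (tnth x i).

Definition Phi (j : nat) (m : loc j) : d.-tuple R -> R := wave orient0 m.
Definition Psi (o : orient) (j : nat) (m : loc j) : d.-tuple R -> R := wave o m.

Definition Vspace (j : nat) : set (d.-tuple R -> R) :=
  [set f | exists c : loc j -> R,
    forall x, cube x -> f x = \sum_m c m * Phi m x].

(* Span of the basis functions Phi_(J0,m) and Psi^iota_(l,m), J0 <= l < J. *)
Definition wavelet_span (J0 J : nat) : set (d.-tuple R -> R) :=
  [set f | exists (c : loc J0 -> R) (e : forall l, orient -> loc l -> R),
    forall x, cube x -> f x = \sum_m c m * Phi m x
      + \sum_(J0 <= l < J) \sum_(o | o != orient0) \sum_m
          e l o m * Psi o m x].

Definition monomial (a : 'I_d -> nat) (x : d.-tuple R) : R :=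
  \prod_(i < d) tnth x i ^+ a i.

(* Regularity S is measured by polynomial reproduction; of the smoothness of
   the generators only continuity is required. *)
Record is_CDV_basis (S J0 : nat) : Prop := {
  CDV_compact_support : exists L : R, forall b e x, L < `|x| ->
    wgen (w := w) b e x = 0 ;
  CDV_continuous : forall b e, continuous (wgen (w := w) b e : R -> R) ;
  CDV_card : exists2 c : R, 0 < c & exists2 C : R, 0 < C &
    forall l, (J0 <= l)%N ->
      c * 2 ^+ (l * d) <= #|loc l|%:R <= C * 2 ^+ (l * d) ;
  CDV_Phi_orthonormal : forall j, (J0 <= j)%N ->
    forall m m' : loc j, inner (Phi m) (Phi m') = (m == m')%:R ;
  CDV_Phi_Psi_orthogonal : forall l, (J0 <= l)%N ->
    forall o, o != orient0 -> forall (m : loc J0) (m' : loc l),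
      inner (Phi m) (Psi o m') = 0 ;
  CDV_Psi_orthonormal : forall l, (J0 <= l)%N ->
    forall o o', o != orient0 -> o' != orient0 -> forall m m' : loc l,
      inner (Psi o m) (Psi o' m') = ((o == o') && (m == m'))%:R ;
  CDV_Psi_orthogonal_levels : forall l l', (J0 <= l)%N -> (J0 <= l')%N ->
    l != l' -> forall o o', o != orient0 -> o' != orient0 ->
    forall (m : loc l) (m' : loc l'), inner (Psi o m) (Psi o' m') = 0 ;
  CDV_complete : forall f : d.-tuple R -> R, measurable_fun setT f ->
    (\int[unif_cube R d]_(x in cube (d:=d)) (f x ^+ 2)%:E < +oo)%E ->
    forall e : R, 0 < e -> exists J g, wavelet_span J0 J g /\
      (\int[unif_cube R d]_(x in cube (d:=d)) ((f x - g x) ^+ 2)%:E < e%:E)%E ;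
  CDV_multiresolution : forall j, (J0 <= j)%N ->
    Vspace j = wavelet_span J0 j ;
  CDV_polynomials : forall j, (J0 <= j)%N -> forall a : 'I_d -> nat,
    (\sum_(i < d) a i <= S.-1)%N -> Vspace j (monomial a) }.

Definition proj_kernel (j : nat) (x y : d.-tuple R) : R :=
  \sum_(m : loc j) Phi m x * Phi m y.

Definition holder_norm (J0 : nat) (gamma : R) (h : d.-tuple R -> R) : \bar R :=
  ((2 `^ (J0%:R * (gamma + d%:R / 2))
      * \big[Num.max/0]_(m : loc J0) `|inner h (Phi m)|)%:E
   + ereal_sup [set u | exists l (o : orient) (m : loc l),
       [/\ (J0 <= l)%N, o != orient0 &
         u = (2 `^ (l%:R * (gamma + d%:R / 2)) * `|inner h (Psi o m)|)%:E]])%E.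

Definition holder_ball (J0 : nat) (gamma M : R) : set (d.-tuple R -> R) :=
  [set h | unif_continuous_cube h /\ (holder_norm J0 gamma h <= M%:E)%E].

End wavelet_basis.

Notation datum R d := (d.-tuple R * R * R)%type.

Section model.
Context (R : realType) (d : nat).

Definition obsX (o : datum R d) : d.-tuple R := o.1.1.
Definition obsA (o : datum R d) : R := o.1.2.
Definition obsY (o : datum R d) : R := o.2.

(* g is a version of the regression function x |-> E_P[f | X = x]. *)
Definition is_cond_exp (P : probability (datum R d) R) (f : datum R d -> R)
    (g : d.-tuple R -> R) : Prop :=
  [/\ measurable_fun setT g, P.-integrable setT (EFin \o (g \o obsX)) &
    forall B, measurable B ->
      (\int[P]_(o in obsX @^-1` B) (g (obsX o))%:E
       = \int[P]_(o in obsX @^-1` B) (f o)%:E)%E].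

(* The everywhere defined representative is chosen arbitrarily among the
   versions, which agree almost everywhere. *)
Definition cond_exp (P : probability (datum R d) R) (f : datum R d -> R) :
    d.-tuple R -> R :=
  xget (fun=> 0) [set g | is_cond_exp P f g].

Definition cond_cov (P : probability (datum R d) R) (f g : datum R d -> R) :
    d.-tuple R -> R :=
  cond_exp P (fun o => (f o - cond_exp P f (obsX o))
                       * (g o - cond_exp P g (obsX o))).

Definition psi (P : probability (datum R d) R) : R :=
  fine ('E_P[cond_cov P obsA obsY \o obsX])%E.

Definition model (w : wavelets R) (J0 : nat) (alpha beta M C1 C2 : R) :
    set (probability (datum R d) R) :=
  [set P : probability (datum R d) R |
    [/\ forall B, measurable B -> P (obsX @^-1` B) = unif_cube R d B,
      {ae P, forall o, C1 <= obsA o <= C2 /\ C1 <= obsY o <= C2},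
      exists2 p, holder_ball w J0 alpha M p & is_cond_exp P obsA p &
      exists2 b, holder_ball w J0 beta M b & is_cond_exp P obsY b]].

(* Non-degeneracy of C1, C2 and M: some pair (p, b) satisfies the constraints of
   the model strictly.  It implies C1 < C2; it holds for every M > 0 if
   C1 < 0 < C2, and for every large M if C1 < C2.  Without it the model can be
   empty or contain a single pair (p, b), and the lower bounds on the bias
   fail. *)
Definition strictly_feasible (w : wavelets R) (J0 : nat) (alpha beta M C1 C2 : R) :
    Prop :=
  exists2 e : R, 0 < e & exists p b : d.-tuple R -> R,
    [/\ holder_ball w J0 alpha (M - e) p, holder_ball w J0 beta (M - e) b &
      forall x, cube x -> C1 + e <= p x <= C2 - e /\ C1 + e <= b x <= C2 - e].

End model.

(* The three disjoint subsamples D_1, D_2, D_3. *)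
Notation samples R d n :=
  (n.-tuple (datum R d) * n.-tuple (datum R d) * n.-tuple (datum R d))%type.

Section estimators.
Context (R : realType) (d : nat) (w : wavelets R).

(* Resolutions are given by their levels: k1 = 2^(j1 d) and k2 = 2^(j2 d). *)
Definition resolution (j : nat) : R := 2 ^+ (j * d).
Definition kmin (j1 j2 : nat) : R := Num.min (resolution j1) (resolution j2).
Definition kmax (j1 j2 : nat) : R := Num.max (resolution j1) (resolution j2).

Definition sample_mean n (f : datum R d -> R) (D : n.-tuple (datum R d)) : R :=
  n%:R^-1 * \sum_(i < n) f (tnth D i).

Definition p_hat n (j : nat) (D : n.-tuple (datum R d)) (x : d.-tuple R) : R :=
  sample_mean (fun o => obsA o * proj_kernel w j (obsX o) x) D.
Definition b_hat n (j : nat) (D : n.-tuple (datum R d)) (x : d.-tuple R) : R :=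
  sample_mean (fun o => obsY o * proj_kernel w j (obsX o) x) D.

Definition samples_law (P : probability (datum R d) R) (n : nat) :
    probability (samples R d n) R :=
  prod_prob (prod_prob (iid P n) (iid P n)) (iid P n).

Definition estimator := forall n : nat, nat -> nat -> samples R d n -> R.

Definition psi_INT : estimator := fun n j1 j2 s =>
  let: (D1, D2, _) := s in
  sample_mean (fun o => obsA o * obsY o) D2
  - \int[unif_cube R d]_(x in cube (d:=d)) (p_hat j1 D1 x * b_hat j2 D1 x).

Definition psi_MC : estimator := fun n j1 j2 s =>
  let: (D1, D2, D3) := s in
  sample_mean (fun o => obsA o * obsY o) D2
  - sample_mean (fun o => p_hat j1 D1 (obsX o) * b_hat j2 D1 (obsX o)) D3.

Definition psi_IF : estimator := fun n j1 j2 s =>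
  let: (D1, D2, _) := s in
  sample_mean (fun o => (obsA o - p_hat j1 D1 (obsX o))
                        * (obsY o - b_hat j2 D1 (obsX o))) D2.

Definition sup_bias (Ps : set (probability (datum R d) R)) (est : estimator)
    (n j1 j2 : nat) : \bar R :=
  ereal_sup [set (`| 'E_(samples_law P n)[(fun s => est n j1 j2 s - psi P)%R] |)%E
            | P in Ps].

Definition sup_var (Ps : set (probability (datum R d) R)) (est : estimator)
    (n j1 j2 : nat) : \bar R :=
  ereal_sup [set ('V_(samples_law P n)[est n j1 j2])%E | P in Ps].

End estimators.

Section asymptotics.
Context (R : realType) (J0 : nat).

(* Sequences indexed by n and the levels j1, j2 >= J0 of the resolutions.  The
   constants are uniform in the levels, so that j1 and j2 may depend on n. *)
Definition lesssim (a b : nat -> nat -> nat -> \bar R) : Prop :=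
  exists2 C : R, 0 < C & exists n0 : nat, forall n j1 j2 : nat,
    (n0 <= n)%N -> (J0 <= j1)%N -> (J0 <= j2)%N ->
    (a n j1 j2 <= C%:E * b n j1 j2)%E.

Definition asymp (a b : nat -> nat -> nat -> \bar R) : Prop :=
  lesssim a b /\ lesssim b a.

End asymptotics.

(* Main.v *)
Require Import Defs.
From HB Require Import structures.
From mathcomp Require Import all_boot all_order all_algebra.
From mathcomp Require Import all_classical all_reals all_analysis.
From mathcomp Require Import measurable_realfun ring lra.

Set Implicit Arguments.
Unset Strict Implicit.
Unset Printing Implicit Defensive.
Import Order.TTheory GRing.Theory Num.Theory.
Import numFieldNormedType.Exports.

Local Open Scope classical_set_scope.
Local Open Scope ring_scope.

(** The bias is computed exactly. The projection kernels of nested spaces satisfy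
    <K_j1(u,.), K_j2(v,.)> = K_j(u,v) with j = min(j1, j2), so the integral of
    p_hat b_hat only sees the coarser resolution: it is the bilinear statistic
    n^-2 sum_m (sum_i A_i Phi_m(X_i)) (sum_i Y_i Phi_m(X_i)) over the m in Z_j
    (pluginE). Let D_j be the inner product of the projections of p and b on V_j
    and kappa the expectation of A Y K_j(X, X). Off-diagonal pairs of observations
    have mean D_j and each of the n diagonal pairs has mean kappa, so the statistic
    has mean D_j - (D_j - kappa) / n. As psi(P) = E[A Y] - <p, b> (psiE), the bias
    of the first two estimators is <p, b> - D_j + (D_j - kappa) / n. In the third
    one, the cross terms contribute D_j1 + D_j2; one of these two cancels and the
    bias becomes <p, b> - D_J - (D_j - kappa) / n with J = max(j1, j2).

    Upper bounds. The wavelet coefficients of level l contribute at most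
    |Z_l| 2^(-l (alpha + beta + d)), of order 2^(-l (alpha + beta)), to <p, b>, and
    completeness of the basis allows one to sum them up (approximation_error).
    Moreover |kappa| is at most of order k_min, like the kernel.

    Lower bounds. For a fair sign eps independent of X, the law of
    (X, p(X) + del eps, b(X) + c(X) eps) has regression functions p and b and
    E[A Y | X] = p b + del c (model_law). Replacing c by - c only moves kappa, by an
    amount of order k_min, so one of the two laws has a bias of order k_min / n at
    least (gap_lower_diag). For the truncation error, p and b are perturbed by
    multiples +s, -s and +t, -t of the sum of all wavelets of one orientation at
    the level of truncation, which is orthogonal to the approximation space, while
    c is adjusted so that E[A Y | X], hence kappa, stays the same. The alternating
    sum of the four biases is 4 s t |Z_J|, of order 2^(-J (alpha + beta)), so one of
    the four laws has a bias of that order (gap_lower_trunc).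

    Variances. Almost surely an observation is not changed by projecting X on the
    cube and A, Y on [C1, C2]; after that all statistics are bounded. The bilinear
    statistic is built by adding observations one at a time, with martingale
    increments whose second moments add up (Var_dot). Given the first subsample,
    the other two estimators are averages over fresh observations, and the law of
    total variance (Var_cmean) reduces them to the bilinear statistic, to linear
    statistics and to the expectation of p_hat(x)^2 b_hat(x)^2. Since the kernel is
    localised at scale 2^-j, the latter is bounded by a fourth moment of the
    numbers of observations in two nested neighbourhoods of x (Ex_count4). *)

(** * Expectation of bounded measurable functions *)

Section bounded_measurable.
Context d (T : measurableType d) (R : realType).
Implicit Types (f g : T -> R).

(** On this class, stable under ring operations and products of spaces,
   expectations are finite and linear without further integrability conditions.
   *)
Definition bmeas f := measurable_fun setT f /\ exists B, forall x, `|f x| <= B.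

Lemma bmeas_meas f : bmeas f -> measurable_fun setT f. Proof. by case. Qed.

Lemma bmeas_ub f : bmeas f -> exists2 B, 0 <= B & forall x, `|f x| <= B.
Proof.
case=> _ [B hB]; exists (Num.max B 0); first by rewrite le_max lexx orbT.
by move=> x; rewrite (le_trans (hB x))// le_max lexx.
Qed.

Lemma bmeas_cst (c : R) : bmeas (fun=> c).
Proof. by split; [exact: measurable_cst|exists `|c|]. Qed.

Lemma bmeasD f g : bmeas f -> bmeas g -> bmeas (fun x => f x + g x).
Proof.
move=> [mf [B hB]] [mg [B' hB']]; split; first exact: measurable_funD.
exists (B + B') => x; exact: le_trans (ler_normD _ _) (lerD (hB x) (hB' x)).
Qed.

Lemma bmeasN f : bmeas f -> bmeas (fun x => - f x).
Proof.
move=> [mf [B hB]]; split; first exact: measurableT_comp.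
by exists B => x; rewrite normrN.
Qed.

Lemma bmeasB f g : bmeas f -> bmeas g -> bmeas (fun x => f x - g x).
Proof. by move=> bf bg; apply: bmeasD => //; exact: bmeasN. Qed.

Lemma bmeasM f g : bmeas f -> bmeas g -> bmeas (fun x => f x * g x).
Proof.
move=> [mf [B hB]] [mg [B' hB']]; split; first exact: measurable_funM.
by exists (B * B') => x; rewrite normrM ler_pM.
Qed.

Lemma bmeasX f n : bmeas f -> bmeas (fun x => f x ^+ n).
Proof.
move=> bf; elim: n => [|n IH]; first exact: bmeas_cst.
by under [X in bmeas X]eq_fun do rewrite exprS; exact: bmeasM.
Qed.

Lemma bmeas_norm f : bmeas f -> bmeas (fun x => `|f x|).
Proof.
move=> [mf [B hB]]; split; first exact: measurableT_comp.
by exists B => x; rewrite normr_id.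
Qed.

Lemma bmeas_sum (I : Type) (r : seq I) (P : pred I) (F : I -> T -> R) :
  (forall i, bmeas (F i)) -> bmeas (fun x => \sum_(i <- r | P i) F i x).
Proof.
move=> bF; elim: r => [|i r IH].
  by under [X in bmeas X]eq_fun do rewrite big_nil; exact: bmeas_cst.
under [X in bmeas X]eq_fun do rewrite big_cons.
by case: (P i) => //; apply: bmeasD.
Qed.

Lemma bmeas_prod (I : Type) (r : seq I) (P : pred I) (F : I -> T -> R) :
  (forall i, bmeas (F i)) -> bmeas (fun x => \prod_(i <- r | P i) F i x).
Proof.
move=> bF; elim: r => [|i r IH].
  by under [X in bmeas X]eq_fun do rewrite big_nil; exact: bmeas_cst.
under [X in bmeas X]eq_fun do rewrite big_cons.
by case: (P i) => //; apply: bmeasM.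
Qed.

Lemma bmeas_indic (A : set T) : measurable A -> bmeas (\1_A).
Proof.
move=> mA; split; first exact: measurable_indic.
by exists 1 => x; rewrite ger0_norm indicE ?ler0n// lern1 leq_b1.
Qed.

End bounded_measurable.

Lemma bmeas_comp d (T : measurableType d) d' (T' : measurableType d')
    (R : realType) (h : T -> T') (f : T' -> R) :
  measurable_fun setT h -> bmeas f -> bmeas (fun x => f (h x)).
Proof.
move=> mh [mf [B hB]]; split; first exact: measurableT_comp mf mh.
by exists B.
Qed.

(** Closure rule of further constructions; redefined for sums over a sample.
   *)
Ltac bm_leaf := fail.

Ltac bm := repeat first
  [ solve [auto 2 with nocore]
  | exact: bmeas_cst
  | bm_leaf
  | apply: bmeasD | apply: bmeasB | apply: bmeasN | apply: bmeasM
  | apply: bmeasX | apply: bmeas_norm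
  | apply: bmeas_sum; intros | apply: bmeas_prod; intros ].

Section expectation.
Context d (T : measurableType d) (R : realType) (mu : probability T R).
Implicit Types (f g : T -> R).

Definition Ex f : R := \int[mu]_x f x.

Lemma bmeas_integrable f : bmeas f -> mu.-integrable setT (EFin \o f).
Proof.
move=> [mf [B hB]]; apply: measurable_bounded_integrable => //.
  by rewrite (le_lt_trans (probability_le1 _ _))// ltry.
exists B; split; first exact: num_real.
by move=> x Bx y _; exact: le_trans (hB y) (ltW Bx).
Qed.

Lemma ExE f : bmeas f -> (Ex f)%:E = (\int[mu]_x (f x)%:E)%E.
Proof.
move=> bf; rewrite /Ex /Rintegral fineK//.
exact: integrable_fin_num (bmeas_integrable bf).
Qed.

Lemma eq_Ex f g : f =1 g -> Ex f = Ex g.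
Proof. by move=> fg; congr (Ex _); apply/funext. Qed.

Lemma Ex_cst c : Ex (fun=> c) = c.
Proof.
rewrite /Ex Rintegral_cst// -[RHS]mulr1; congr (_ * _).
by have /= -> := @probability_setT _ _ _ mu.
Qed.

Lemma ExD f g : bmeas f -> bmeas g -> Ex (fun x => f x + g x) = Ex f + Ex g.
Proof. by move=> bf bg; apply: RintegralD => //; exact: bmeas_integrable. Qed.

Lemma ExB f g : bmeas f -> bmeas g -> Ex (fun x => f x - g x) = Ex f - Ex g.
Proof. by move=> bf bg; apply: RintegralB => //; exact: bmeas_integrable. Qed.

Lemma ExZl c f : bmeas f -> Ex (fun x => c * f x) = c * Ex f.
Proof. by move=> bf; apply: RintegralZl => //; exact: bmeas_integrable. Qed.

Lemma ExZr c f : bmeas f -> Ex (fun x => f x * c) = Ex f * c.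
Proof. by move=> bf; apply: RintegralZr => //; exact: bmeas_integrable. Qed.

Lemma Ex_sum (I : Type) (r : seq I) (P : pred I) (F : I -> T -> R) :
  (forall i, bmeas (F i)) ->
  Ex (fun x => \sum_(i <- r | P i) F i x) = \sum_(i <- r | P i) Ex (F i).
Proof.
move=> bF; elim: r => [|i r IH].
  by rewrite big_nil -[RHS]Ex_cst; apply: eq_Ex => x; rewrite big_nil.
rewrite big_cons; under eq_Ex do rewrite big_cons.
by case: (P i) => //; rewrite ExD ?IH//; apply: bmeas_sum.
Qed.

Lemma Ex_ge0 f : (forall x, 0 <= f x) -> 0 <= Ex f.
Proof. by move=> f0; apply: Rintegral_ge0. Qed.

Lemma le_Ex f g : bmeas f -> bmeas g -> (forall x, f x <= g x) -> Ex f <= Ex g.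
Proof.
by move=> bf bg fg; apply: le_Rintegral => //; exact: bmeas_integrable.
Qed.

Lemma Ex_le_cst f c : bmeas f -> (forall x, f x <= c) -> Ex f <= c.
Proof. by move=> bf fc; rewrite -(Ex_cst c) le_Ex//; exact: bmeas_cst. Qed.

Lemma normr_Ex f : bmeas f -> `|Ex f| <= Ex (fun x => `|f x|).
Proof.
by move=> bf; apply: le_normr_Rintegral => //; exact: bmeas_integrable.
Qed.

Lemma Ex_sqrB f c : bmeas f ->
  Ex (fun x => (f x - c) ^+ 2) = Ex (fun x => f x ^+ 2) - Ex f * c *+ 2 + c ^+ 2.
Proof.
move=> bf; have -> : Ex (fun x => (f x - c) ^+ 2) =
    Ex (fun x => f x ^+ 2 - (c *+ 2) * f x + c ^+ 2).
  by apply: eq_Ex => x; ring.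
by rewrite ExD ?ExB ?ExZl ?Ex_cst//; [ring|bm..].
Qed.

Lemma Ex_sqr_center f : bmeas f ->
  Ex (fun x => (f x - Ex f) ^+ 2) = Ex (fun x => f x ^+ 2) - Ex f ^+ 2.
Proof. by move=> bf; rewrite Ex_sqrB// expr2; ring. Qed.

Lemma Ex_sqr_ge f : bmeas f -> Ex f ^+ 2 <= Ex (fun x => f x ^+ 2).
Proof.
move=> bf; rewrite -subr_ge0 -Ex_sqr_center//; apply: Ex_ge0 => x.
exact: sqr_ge0.
Qed.

Lemma Ex_sqr_center_le f c : bmeas f ->
  Ex (fun x => (f x - Ex f) ^+ 2) <= Ex (fun x => (f x - c) ^+ 2).
Proof.
move=> bf; rewrite Ex_sqr_center// Ex_sqrB//.
rewrite -subr_ge0; have := sqr_ge0 (Ex f - c); nra.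
Qed.

(** Optimising (f - t g)^2 over t: the discriminant gives Cauchy-Schwarz. *)
Lemma Ex_cauchy_schwarz f g : bmeas f -> bmeas g ->
  Ex (fun x => f x * g x) ^+ 2 <= Ex (fun x => f x ^+ 2) * Ex (fun x => g x ^+ 2).
Proof.
move=> bf bg; set a := Ex _; set F := Ex _; set G := Ex _.
have q t : 0 <= F - t * a *+ 2 + t ^+ 2 * G.
  have -> : F - t * a *+ 2 + t ^+ 2 * G = Ex (fun x => (f x - t * g x) ^+ 2).
    rewrite (_ : (fun x => _) = fun x =>
      f x ^+ 2 - (t *+ 2) * (f x * g x) + t ^+ 2 * g x ^+ 2); last first.
      by apply/funext => x; ring.
    by rewrite ExD ?ExB ?ExZl//; [rewrite mulrnAl|bm..].
  by apply: Ex_ge0 => x; exact: sqr_ge0.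
have F0 : 0 <= F by apply: Ex_ge0 => x; exact: sqr_ge0.
have G0 : 0 <= G by apply: Ex_ge0 => x; exact: sqr_ge0.
have [Gz|Gz] := eqVneq G 0.
  rewrite Gz mulr0; have [->|az] := eqVneq a 0; first by rewrite expr0n.
  have := q ((F + 1) / a); rewrite Gz mulr0 addr0 mulfVK// => h; exfalso; lra.
have Gp : 0 < G by rewrite lt_neqAle eq_sym Gz.
have := q (a / G); rewrite -[X in 0 <= X](mulfK Gz).
rewrite pmulr_lge0 ?invr_gt0// (_ : (F - a / G * a *+ 2 + (a / G) ^+ 2 * G) * G = F * G - a ^+ 2);
  last by field.
by rewrite subr_ge0.
Qed.

End expectation.

Lemma sqrrD_le (R : realDomainType) (x y : R) :
  (x + y) ^+ 2 <= 2 * x ^+ 2 + 2 * y ^+ 2.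
Proof. by rewrite -subr_ge0; have := sqr_ge0 (x - y); nra. Qed.

Definition Var d (T : measurableType d) (R : realType) (mu : probability T R)
  (f : T -> R) : R := Ex mu (fun x => (f x - Ex mu f) ^+ 2).

Section variance.
Context d (T : measurableType d) (R : realType) (mu : probability T R).
Implicit Types (f g : T -> R).

Lemma Var_le_sqr f : bmeas f -> Var mu f <= Ex mu (fun x => f x ^+ 2).
Proof. by move=> bf; rewrite /Var Ex_sqr_center// lerBlDr lerDl sqr_ge0. Qed.

Lemma VarD_le f g : bmeas f -> bmeas g ->
  Var mu (fun x => f x + g x) <= 2 * Var mu f + 2 * Var mu g.
Proof.
move=> bf bg; rewrite /Var -!ExZl -?ExD; [|bm..].
apply: le_Ex; [by bm..|move=> x].
by rewrite ExD// opprD addrACA sqrrD_le.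
Qed.

Lemma VarZ c f : bmeas f -> Var mu (fun x => c * f x) = c ^+ 2 * Var mu f.
Proof.
move=> bf; rewrite /Var ExZl//.
rewrite -[RHS](@ExZl _ _ _ _ _ (fun x => (f x - Ex mu f) ^+ 2)); last by bm.
by apply: eq_Ex => x; rewrite -mulrBr exprMn.
Qed.

Lemma VarN f : bmeas f -> Var mu (fun x => - f x) = Var mu f.
Proof.
move=> bf; rewrite -[RHS]mul1r -[in RHS](expr1n _ 2) -sqrrN -VarZ//.
by congr Var; apply/funext => x; rewrite mulN1r.
Qed.

Lemma VarB_le f g : bmeas f -> bmeas g ->
  Var mu (fun x => f x - g x) <= 2 * Var mu f + 2 * Var mu g.
Proof. by move=> bf bg; rewrite -(VarN bg) VarD_le//; bm. Qed.

Lemma VarDc f c : bmeas f -> Var mu (fun x => f x + c) = Var mu f.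
Proof.
move=> bf; rewrite /Var ExD ?Ex_cst//; last by bm.
by apply: eq_Ex => x; congr (_ ^+ 2); ring.
Qed.

End variance.

(** * Product measures and i.i.d. samples *)

Section product_expectation.
Context d1 d2 (T1 : measurableType d1) (T2 : measurableType d2) (R : realType).
Variables (P : probability T1 R) (Q : probability T2 R).
Implicit Types f : T1 * T2 -> R.

Lemma bmeas_fst (g : T1 -> R) : bmeas g -> bmeas (fun z : T1 * T2 => g z.1).
Proof. by move=> bg; apply: bmeas_comp bg; exact: measurable_fst. Qed.

Lemma bmeas_snd (g : T2 -> R) : bmeas g -> bmeas (fun z : T1 * T2 => g z.2).
Proof. by move=> bg; apply: bmeas_comp bg; exact: measurable_snd. Qed.

Lemma bmeas_pair1 f x : bmeas f -> bmeas (fun y => f (x, y)).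
Proof. by move=> bf; apply: bmeas_comp bf; exact: measurable_pair1. Qed.

Lemma bmeas_pair2 f y : bmeas f -> bmeas (fun x => f (x, y)).
Proof. by move=> bf; apply: bmeas_comp bf; exact: measurable_pair2. Qed.

Lemma normr_Ex_le d (T : measurableType d) (mu : probability T R) (g : T -> R) B :
  bmeas g -> (forall x, `|g x| <= B) -> `|Ex mu g| <= B.
Proof.
move=> bg hB; apply: le_trans (normr_Ex mu bg) _.
by apply: Ex_le_cst => //; exact: bmeas_norm.
Qed.

Let EFin_Ex_prod f x : bmeas f ->
  (Ex Q (fun y => f (x, y)))%:E = fubini_F Q (EFin \o f) x.
Proof. by move=> bf; rewrite ExE//; exact: bmeas_pair1. Qed.

Lemma bmeas_Ex2 f : bmeas f -> bmeas (fun x => Ex Q (fun y => f (x, y))).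
Proof.
move=> bf; split; last first.
  by have [B _ hB] := bmeas_ub bf; exists B => x; apply: normr_Ex_le => //;
    exact: bmeas_pair1.
apply/measurable_EFinP; rewrite (_ : _ \o _ = fubini_F Q (EFin \o f)).
  apply: (measurable_fubini_F (m1 := P)).
  exact: (bmeas_integrable (prod_prob P Q) bf).
by apply/funext => x /=; rewrite EFin_Ex_prod.
Qed.

Lemma Ex_prod f : bmeas f ->
  Ex (prod_prob P Q) f = Ex P (fun x => Ex Q (fun y => f (x, y))).
Proof.
move=> bf; apply: EFin_inj; rewrite !ExE//; last exact: bmeas_Ex2.
transitivity (\int[P]_x fubini_F Q (EFin \o f) x)%E.
  symmetry; apply: integral12_prod_meas1.
  exact: (bmeas_integrable (prod_prob P Q) bf).
by apply: eq_integral => x _; rewrite EFin_Ex_prod.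
Qed.

End product_expectation.

Section product_swap.
Context d1 d2 (T1 : measurableType d1) (T2 : measurableType d2) (R : realType).
Variables (P : probability T1 R) (Q : probability T2 R).
Implicit Types f : T1 * T2 -> R.

Lemma bmeas_swap f : bmeas f -> bmeas (fun z : T2 * T1 => f (z.2, z.1)).
Proof. by move=> bf; apply: bmeas_comp bf; exact: measurable_swap. Qed.

Lemma bmeas_Ex1 f : bmeas f -> bmeas (fun y => Ex P (fun x => f (x, y))).
Proof. by move=> bf; apply: (bmeas_Ex2 Q P (bmeas_swap bf)). Qed.

Lemma Ex_swap f : bmeas f ->
  Ex P (fun x => Ex Q (fun y => f (x, y))) =
  Ex Q (fun y => Ex P (fun x => f (x, y))).
Proof.
move=> bf; apply: EFin_inj.
rewrite !ExE; [|exact: bmeas_Ex1|exact: bmeas_Ex2].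
transitivity (\int[P]_x \int[Q]_y (f (x, y))%:E)%E.
  by apply: eq_integral => x _; rewrite ExE//; exact: bmeas_pair1.
rewrite (Fubini (f := EFin \o f)).
  by apply: eq_integral => x _; rewrite ExE//; exact: bmeas_pair2.
exact: (bmeas_integrable (prod_prob P Q) bf).
Qed.

Lemma Ex_fst (g : T1 -> R) : bmeas g -> Ex (prod_prob P Q) (fun z => g z.1) = Ex P g.
Proof.
move=> bg; rewrite (Ex_prod _ _ (bmeas_fst T2 bg)).
by apply: eq_Ex => x; rewrite /= Ex_cst.
Qed.

Lemma Ex_snd (g : T2 -> R) : bmeas g -> Ex (prod_prob P Q) (fun z => g z.2) = Ex Q g.
Proof. by move=> bg; rewrite (Ex_prod _ _ (bmeas_snd T1 bg)) /= Ex_cst. Qed.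

End product_swap.

Lemma Ex_distribution d d' (T : measurableType d) (T' : measurableType d')
    (R : realType) (P : probability T R) (X : {RV P >-> T'}) (f : T' -> R) :
  bmeas f -> Ex (distribution P X) f = Ex P (fun x => f (X x)).
Proof.
move=> bf; have bfX : bmeas (fun x => f (X x)) by exact: bmeas_comp bf.
apply: EFin_inj; rewrite !ExE// integral_distribution//.
- by apply/measurable_EFinP; exact: bmeas_meas.
- exact: bmeas_integrable.
Qed.

Section iid_expectation.
Context d (T : measurableType d) (R : realType) (P : probability T R).

Lemma bmeas_tnth n (f : T -> R) (i : 'I_n) :
  bmeas f -> bmeas (fun D : n.-tuple T => f (tnth D i)).
Proof. by move=> bf; apply: bmeas_comp bf; exact: measurable_tnth. Qed.

Lemma bmeas_cons n (F : n.+1.-tuple T -> R) :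
  bmeas F -> bmeas (fun z : T * n.-tuple T => F (tuple_cons z)).
Proof. by move=> bF; apply: bmeas_comp bF; exact: measurable_tuple_cons. Qed.

Lemma Ex_iid0 (F : 0.-tuple T -> R) : bmeas F -> Ex (iid P 0) F = F [tuple].
Proof.
by move=> bF; rewrite -[RHS](Ex_cst (iid P 0)); apply: eq_Ex => x; rewrite tuple0.
Qed.

Lemma Ex_iidS n (F : n.+1.-tuple T -> R) : bmeas F ->
  Ex (iid P n.+1) F = Ex P (fun o => Ex (iid P n) (fun D => F (tuple_cons (o, D)))).
Proof.
move=> bF; rewrite [LHS]Ex_distribution//.
by rewrite (Ex_prod _ _ (bmeas_cons bF)).
Qed.

Definition Sum n (f : T -> R) (D : n.-tuple T) : R := \sum_(i < n) f (tnth D i).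

Lemma Sum_cons n (f : T -> R) (z : T * n.-tuple T) :
  Sum f (tuple_cons z) = f z.1 + Sum f z.2.
Proof.
rewrite /Sum big_ord_recl tnth0; congr (_ + _).
by apply: eq_bigr => i _; rewrite tnthS.
Qed.

Lemma Sum0 (f : T -> R) (D : 0.-tuple T) : Sum f D = 0.
Proof. by rewrite /Sum big_ord0. Qed.

Lemma bmeas_Sum n (f : T -> R) : bmeas f -> bmeas (@Sum n f).
Proof. by move=> bf; apply: bmeas_sum => i; exact: bmeas_tnth. Qed.

Lemma Ex_Sum n (f : T -> R) : bmeas f -> Ex (iid P n) (Sum f) = n%:R * Ex P f.
Proof.
move=> bf; elim: n => [|n IH].
  by rewrite Ex_iid0 ?Sum0 ?mul0r//; exact: bmeas_Sum.
rewrite Ex_iidS; last exact: bmeas_Sum.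
rewrite -natr1 mulrDl mul1r -IH.
transitivity (Ex P (fun o => f o + Ex (iid P n) (Sum f))).
  apply: eq_Ex => o; rewrite -[X in _ = X + _](Ex_cst (iid P n)) -ExD.
  - by apply: eq_Ex => D; rewrite Sum_cons.
  - exact: bmeas_cst.
  - exact: bmeas_Sum.
by rewrite ExD ?Ex_cst 1?addrC//; exact: bmeas_cst.
Qed.

(** The n diagonal pairs contribute the expectation of f g, and the n (n - 1)
   other pairs are independent. *)
Lemma Ex_SumM n (f g : T -> R) : bmeas f -> bmeas g ->
  Ex (iid P n) (fun D => Sum f D * Sum g D) =
  n%:R * Ex P (fun o => f o * g o) + (n%:R ^+ 2 - n%:R) * (Ex P f * Ex P g).
Proof.
move=> bf bg; have bfg : bmeas (fun o => f o * g o) by bm.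
have bS k h : bmeas h -> bmeas (@Sum k h) by exact: bmeas_Sum.
elim: n => [|n IH].
  by rewrite Ex_iid0; [rewrite !Sum0; ring|apply: bmeasM; exact: bmeas_Sum].
rewrite Ex_iidS; last by apply: bmeasM; exact: bmeas_Sum.
transitivity (Ex P (fun o => f o * g o + f o * (n%:R * Ex P g) + g o * (n%:R * Ex P f)
   + Ex (iid P n) (fun D => Sum f D * Sum g D))).
  apply: eq_Ex => o; rewrite -!Ex_Sum//.
  transitivity (Ex (iid P n) (fun D => f o * g o + f o * Sum g D + g o * Sum f D
    + Sum f D * Sum g D)).
    by apply: eq_Ex => D; rewrite !Sum_cons /=; ring.
  have := bS n _ bf; have := bS n _ bg => bSg bSf.
  by rewrite !ExD ?ExZl ?Ex_cst//; bm.
rewrite !ExD ?ExZr ?Ex_cst ?IH ?(ExZr, ExZl)//; [|bm..].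
by rewrite -natr1; ring.
Qed.

Lemma Var_Sum n (f : T -> R) : bmeas f ->
  Var (iid P n) (Sum f) = n%:R * Var P f.
Proof.
move=> bf; have bS := @bmeas_Sum n _ bf; rewrite /Var !Ex_sqr_center//.
under eq_Ex do rewrite expr2; rewrite Ex_SumM// Ex_Sum//.
by under [X in _ = _ * (X - _)]eq_Ex do rewrite expr2; ring.
Qed.

Lemma Ex_iid_prod n (f : 'I_n -> T -> R) : (forall i, bmeas (f i)) ->
  Ex (iid P n) (fun D => \prod_(i < n) f i (tnth D i)) = \prod_(i < n) Ex P (f i).
Proof.
have bp k (h : 'I_k -> T -> R) : (forall i, bmeas (h i)) ->
    bmeas (fun D : k.-tuple T => \prod_(i < k) h i (tnth D i)).
  by move=> bh; apply: bmeas_prod => i; exact: bmeas_tnth.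
elim: n f => [|n IH] f bf.
  by rewrite Ex_iid0 ?big_ord0//; exact: bp.
rewrite Ex_iidS; last exact: bp.
rewrite big_ord_recl -IH// -ExZr//; apply: eq_Ex => o.
rewrite -ExZl; last by apply: (bp _ (fun i => f (lift ord0 i))).
apply: eq_Ex => D; rewrite big_ord_recl tnth0; congr (_ * _).
by apply: eq_bigr => i _; rewrite tnthS.
Qed.

(** By exchangeability, weighting a symmetric statistic by a sum over the sample
    amounts to singling out one observation. The hypothesis on F holds for
    polynomials: it makes all the expectations below meaningful. *)
Lemma Ex_size_bias n (phi u v : T -> R) (F : R -> R -> R) :
  bmeas phi -> bmeas u -> bmeas v ->
  (forall d' (T' : measurableType d') (a b : T' -> R),
     bmeas a -> bmeas b -> bmeas (fun t => F (a t) (b t))) ->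
  Ex (iid P n.+1) (fun D => Sum phi D * F (Sum u D) (Sum v D)) =
  n.+1%:R * Ex P (fun o => phi o *
    Ex (iid P n) (fun D => F (u o + Sum u D) (v o + Sum v D))).
Proof.
move=> bphi bu bv; elim: n F => [|n IH] F bF.
  rewrite mul1r Ex_iidS; last first.
    by apply: bmeasM; [|apply: bF]; exact: bmeas_Sum.
  apply: eq_Ex => o; rewrite -ExZl; last first.
    by apply: bF; apply: bmeasD; [bm|exact: bmeas_Sum|bm|exact: bmeas_Sum].
  by apply: eq_Ex => D; rewrite !Sum_cons !Sum0 !addr0.
have bS k h : bmeas h -> bmeas (@Sum k h) by exact: bmeas_Sum.
have bFS k x y : bmeas (fun D : k.-tuple T => F (x + Sum u D) (y + Sum v D)).
  by apply: bF; apply: bmeasD; [bm|exact: bmeas_Sum|bm|exact: bmeas_Sum].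
have bE k : bmeas (fun o => Ex (iid P k) (fun D => F (u o + Sum u D) (v o + Sum v D))).
  apply: (bmeas_Ex2 P _ (f := fun z => F (u z.1 + Sum u z.2) (v z.1 + Sum v z.2))).
  by apply: bF; apply: bmeasD;
    [exact: bmeas_fst|apply: bmeas_snd; exact: bmeas_Sum|
     exact: bmeas_fst|apply: bmeas_snd; exact: bmeas_Sum].
rewrite Ex_iidS; last by apply: bmeasM; [|apply: bF]; exact: bmeas_Sum.
transitivity (Ex P (fun o => phi o *
    Ex (iid P n.+1) (fun D => F (u o + Sum u D) (v o + Sum v D))
  + n.+1%:R * Ex P (fun o' => phi o' *
    Ex (iid P n) (fun D => F (u o + (u o' + Sum u D)) (v o + (v o' + Sum v D)))))).
  apply: eq_Ex => o; rewrite -(IH (fun x y => F (u o + x) (v o + y))); last first.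
    by move=> d' T' a b ba bb; apply: bF; bm.
  rewrite -[phi o * _]ExZl; last exact: bFS.
  rewrite -ExD.
  - by apply: eq_Ex => D; rewrite !Sum_cons/= mulrDl.
  - by apply: bmeasM; [bm|exact: bFS].
  - by apply: bmeasM; [exact: bS|exact: bFS].
pose f (z : T * T) := phi z.2 *
    Ex (iid P n) (fun D => F (u z.1 + (u z.2 + Sum u D)) (v z.1 + (v z.2 + Sum v D))).
have bf : bmeas f.
  apply: bmeasM; first exact: bmeas_snd.
  apply: (bmeas_Ex2 (prod_prob P P) _ (f := fun t : (T * T) * n.-tuple T =>
    F (u t.1.1 + (u t.1.2 + Sum u t.2)) (v t.1.1 + (v t.1.2 + Sum v t.2)))).
  have b1 h : bmeas h -> bmeas (fun t : (T * T) * n.-tuple T => h t.1.1).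
    by move=> bh; apply: (bmeas_fst _ (g := fun x : T * T => h x.1)); exact: bmeas_fst.
  have b2 h : bmeas h -> bmeas (fun t : (T * T) * n.-tuple T => h t.1.2).
    by move=> bh; apply: (bmeas_fst _ (g := fun x : T * T => h x.2)); exact: bmeas_snd.
  have b3 h : bmeas h -> bmeas (fun t : (T * T) * n.-tuple T => Sum h t.2).
    by move=> bh; apply: bmeas_snd; exact: bS.
  by apply: bF; apply: bmeasD; [exact: b1|apply: bmeasD; [exact: b2|exact: b3]|
    exact: b1|apply: bmeasD; [exact: b2|exact: b3]].
rewrite ExD; [|by apply: bmeasM => //; exact: bE|].
  rewrite ExZl; last exact: (bmeas_Ex2 P P bf).
  rewrite -[n.+2%:R]nat1r mulrDl mul1r; congr (_ + _ * _).
  rewrite (Ex_swap _ _ bf); apply: eq_Ex => o.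
  rewrite /f /= ExZl; last first.
    apply: (bmeas_Ex2 P _ (f := fun z => F (u z.1 + (u o + Sum u z.2))
      (v z.1 + (v o + Sum v z.2)))).
    by apply: bF; apply: bmeasD; [exact: bmeas_fst|apply: bmeasD; [bm|]|
      exact: bmeas_fst|apply: bmeasD; [bm|]]; apply: bmeas_snd; exact: bS.
  congr (_ * _); rewrite Ex_iidS; last exact: bFS.
  apply: eq_Ex => o'; apply: eq_Ex => D; rewrite !Sum_cons/=.
  by congr F; rewrite addrCA.
by apply: bmeasM; [bm|exact: (bmeas_Ex2 P P bf)].
Qed.

End iid_expectation.

Ltac bm_leaf ::= first [apply: bmeas_Sum | apply: bmeas_tnth].

(** * Variance of bilinear statistics *)

Lemma sqrr3_le (R : realDomainType) (x y z : R) :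
  (x + y + z) ^+ 2 <= 3 * (x ^+ 2 + y ^+ 2 + z ^+ 2).
Proof.
rewrite -subr_ge0.
have := sqr_ge0 (x - y); have := sqr_ge0 (y - z); have := sqr_ge0 (x - z); nra.
Qed.

Lemma normr_sumM_le (R : realFieldType) (I : finType) (a y : I -> R) (K : R) :
  \sum_m a m ^+ 2 <= K -> \sum_m y m ^+ 2 <= K -> `|\sum_m a m * y m| <= K.
Proof.
move=> ha hy; apply: (@le_trans _ _ (\sum_m 2^-1 * (a m ^+ 2 + y m ^+ 2))).
  apply: le_trans (ler_norm_sum _ _ _) _; apply: ler_sum => m _.
  rewrite normrM -subr_ge0 -(real_normK (num_real (a m))) -(real_normK (num_real (y m))).
  by have := sqr_ge0 (`|a m| - `|y m|); nra.
by rewrite -mulr_sumr big_split/=; lra.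
Qed.

Section bilinear.
Context d (T : measurableType d) (R : realType) (P : probability T R).
Context (I : finType).
Implicit Types (a y : I -> T -> R).

Definition dot n a y (D : n.-tuple T) : R := \sum_m Sum (a m) D * Sum (y m) D.

Lemma bmeas_dot n a y : (forall m, bmeas (a m)) -> (forall m, bmeas (y m)) ->
  bmeas (@dot n a y).
Proof.
by move=> ba by_; apply: bmeas_sum => m; apply: bmeasM; exact: bmeas_Sum.
Qed.

(** A family is B-Bessel when its linear combinations have second moments
    controlled by the squared norms of the coefficients. *)
Definition bessel (B : R) a := forall v : I -> R,
  Ex P (fun o => (\sum_m v m * a m o) ^+ 2) <= B * \sum_m v m ^+ 2.

(** Adding one observation o changes the centred statistic by a quantity which
    has mean zero given the other observations: the second moments of these
    increments add up. *)
Lemma Ex_dot_centered a y (B K L : R) n :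
  (forall m, bmeas (a m)) -> (forall m, bmeas (y m)) ->
  (forall m, Ex P (a m) = 0) -> (forall m, Ex P (y m) = 0) ->
  0 <= B -> bessel B a -> bessel B y ->
  \sum_m Ex P (fun o => a m o ^+ 2) <= K -> \sum_m Ex P (fun o => y m o ^+ 2) <= K ->
  (forall o, `|\sum_m a m o * y m o| <= L) ->
  Ex (iid P n) (fun D => (dot a y D - n%:R * Ex P (fun o => \sum_m a m o * y m o)) ^+ 2)
  <= 3 * n%:R ^+ 2 * B * K + 3 * n%:R * L ^+ 2.
Proof.
move=> ba by_ a0 y0 B0 Ba By Ka Ky hL; set c := Ex P _.
have bay : bmeas (fun o => \sum_m a m o * y m o) by bm.
elim: n => [|n IH].
  rewrite Ex_iid0; last by apply: bmeasX; apply: bmeasB; [exact: bmeas_dot|bm].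
  rewrite /dot mul0r subr0 big1 ?expr0n/= ?mulr0 ?mul0r ?addr0//.
  by move=> m _; rewrite !Sum0 mulr0.
pose Z (D : n.-tuple T) := dot a y D - n%:R * c.
(* The increment of the centred statistic when z.1 is added to z.2. *)
pose W (z : T * n.-tuple T) := (\sum_m Sum (y m) z.2 * a m z.1) +
  (\sum_m Sum (a m) z.2 * y m z.1) + (\sum_m a m z.1 * y m z.1 - c).
have bS h : bmeas h -> bmeas (@Sum _ T R n h) by exact: bmeas_Sum.
have bZ : bmeas Z by apply: bmeasB; [exact: bmeas_dot|bm].
have bSa m : bmeas (fun z : T * n.-tuple T => Sum (a m) z.2) by apply: bmeas_snd; exact: bS.
have bSy m : bmeas (fun z : T * n.-tuple T => Sum (y m) z.2) by apply: bmeas_snd; exact: bS.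
have ba1 m : bmeas (fun z : T * n.-tuple T => a m z.1) by exact: bmeas_fst.
have by1 m : bmeas (fun z : T * n.-tuple T => y m z.1) by exact: bmeas_fst.
have bW : bmeas W.
  by rewrite /W; bm.
have bW1 D : bmeas (fun o => W (o, D)) by exact: bmeas_pair2.
have EW D : Ex P (fun o => W (o, D)) = 0.
  rewrite /W /= !(ExD, ExB) ?Ex_cst ?subrr ?addr0//; [|bm..].
  rewrite !Ex_sum; [|by move=> m; bm..].
  by rewrite !big1 ?addr0// => m _; rewrite ExZl// ?a0 ?y0 mulr0.
have ZS z : dot a y (tuple_cons z) - n.+1%:R * c = Z z.2 + W z.
  rewrite /Z /W /dot.
  rewrite (eq_bigr (fun m => Sum (a m) z.2 * Sum (y m) z.2 + Sum (y m) z.2 * a m z.1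
    + Sum (a m) z.2 * y m z.1 + a m z.1 * y m z.1)); last first.
    by move=> m _; rewrite !Sum_cons; ring.
  by rewrite !big_split/= -natr1; ring.
have bZ2 : bmeas (fun z : T * n.-tuple T => Z z.2) by exact: bmeas_snd.
rewrite Ex_iidS; last by apply: bmeasX; apply: bmeasB; [exact: bmeas_dot|bm].
have -> : Ex P (fun o => Ex (iid P n)
    (fun D => (dot a y (tuple_cons (o, D)) - n.+1%:R * c) ^+ 2)) =
  Ex (iid P n) (fun D => Ex P (fun o => (Z D + W (o, D)) ^+ 2)).
  rewrite -(Ex_swap _ _ (f := fun z => (Z z.2 + W z) ^+ 2)); last by bm.
  by apply: eq_Ex => o; apply: eq_Ex => D; rewrite ZS.
have EZW D : Ex P (fun o => (Z D + W (o, D)) ^+ 2) =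
    Z D ^+ 2 + Ex P (fun o => W (o, D) ^+ 2).
  transitivity (Ex P (fun o => Z D ^+ 2 + (2 * Z D) * W (o, D) + W (o, D) ^+ 2)).
    by apply: eq_Ex => o; ring.
  by rewrite !ExD ?ExZl ?Ex_cst ?EW ?mulr0 ?addr0//; bm.
have bEW2 : bmeas (fun D => Ex P (fun o => W (o, D) ^+ 2)).
  by apply: (bmeas_Ex1 P (iid P n) (f := fun z => W z ^+ 2)); bm.
rewrite (eq_Ex _ EZW) ExD; [|bm|bm].
have EW2 D : Ex P (fun o => W (o, D) ^+ 2) <=
    3 * (B * (\sum_m Sum (y m) D ^+ 2) + B * (\sum_m Sum (a m) D ^+ 2) + L ^+ 2).
  apply: (@le_trans _ _ (Ex P (fun o => 3 * ((\sum_m Sum (y m) D * a m o) ^+ 2 +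
     (\sum_m Sum (a m) D * y m o) ^+ 2 + (\sum_m a m o * y m o - c) ^+ 2)))).
    apply: le_Ex; [by bm..|move=> o]; exact: sqrr3_le.
  rewrite ExZl; last by bm.
  rewrite ler_pM2l// !ExD; [|bm..].
  apply: lerD; first by apply: lerD; [exact: Ba|exact: By].
  apply: le_trans (Var_le_sqr P bay) _; apply: Ex_le_cst; first by bm.
  by move=> o; rewrite -(real_normK (num_real _)) lerXn2r ?nnegrE// (le_trans _ (hL o)).
have ESq h : bmeas h -> Ex P h = 0 ->
    Ex (iid P n) (fun D => Sum h D ^+ 2) = n%:R * Ex P (fun o => h o ^+ 2).
  move=> bh h0; under eq_Ex do rewrite expr2.
  by rewrite Ex_SumM// h0 mulr0 mulr0 addr0; under eq_Ex do rewrite -expr2.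
have EEW2 : Ex (iid P n) (fun D => Ex P (fun o => W (o, D) ^+ 2)) <=
    3 * (B * (n%:R * K) + B * (n%:R * K) + L ^+ 2).
  apply: le_trans (le_Ex _ _ _ EW2) _; [bm|bm|].
  have bsum (h : I -> T -> R) : (forall m, bmeas (h m)) ->
      bmeas (fun D : n.-tuple T => \sum_m Sum (h m) D ^+ 2).
    by move=> bh; apply: bmeas_sum => m; apply: bmeasX; exact: bS.
  have Esum (h : I -> T -> R) : (forall m, bmeas (h m)) -> (forall m, Ex P (h m) = 0) ->
      \sum_m Ex P (fun o => h m o ^+ 2) <= K ->
      Ex (iid P n) (fun D => \sum_m Sum (h m) D ^+ 2) <= n%:R * K.
    move=> bh h0 hK; rewrite Ex_sum; last by move=> m; apply: bmeasX; exact: bS.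
    by rewrite (eq_bigr _ (fun m _ => ESq _ (bh m) (h0 m))) -mulr_sumr ler_wpM2l.
  rewrite ExZl; last by bm.
  rewrite ler_pM2l// !(ExD, ExZl, Ex_cst); [|bm..].
  by rewrite lerD2r lerD// ler_wpM2l// Esum.
apply: le_trans (lerD IH EEW2) _.
have K0 : 0 <= K.
  by apply: le_trans Ka; apply: sumr_ge0 => m _; apply: Ex_ge0 => o; exact: sqr_ge0.
have BK0 := mulr_ge0 B0 K0.
rewrite -natr1 -subr_ge0.
rewrite [X in 0 <= X](_ : _ = 3 * (B * K)); last by ring.
by rewrite mulr_ge0.
Qed.

(** Duality: the Bessel property is tested against the coefficients E[a m]
   themselves. *)
Lemma Ex_bessel a (B : R) : (forall m, bmeas (a m)) -> 0 <= B -> bessel B a ->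
  \sum_m Ex P (a m) ^+ 2 <= B.
Proof.
move=> ba B0 Ba; set s := \sum_m _.
have s0 : 0 <= s by apply: sumr_ge0 => m _; exact: sqr_ge0.
have h : s ^+ 2 <= B * s.
  apply: le_trans (Ba (fun m => Ex P (a m))).
  have -> : s = Ex P (fun o => \sum_m Ex P (a m) * a m o).
    by rewrite Ex_sum; [apply: eq_bigr => m _; rewrite ExZl// expr2|move=> m; bm].
  by apply: Ex_sqr_ge; bm.
have [->//|sn0] := eqVneq s 0.
have sp : 0 < s by rewrite lt_neqAle eq_sym sn0.
by rewrite expr2 ler_pM2r in h.
Qed.

(** Centring both families splits the statistic into its centred version, of
    order n sqrt K, and a sum of independent terms scaled by n. *)
Lemma Var_dot a y (B K : R) n :
  (forall m, bmeas (a m)) -> (forall m, bmeas (y m)) ->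
  0 <= B -> bessel B a -> bessel B y ->
  (forall o, \sum_m a m o ^+ 2 <= K) -> (forall o, \sum_m y m o ^+ 2 <= K) ->
  Var (iid P n) (dot a y) <=
  8 * B ^+ 2 * n%:R ^+ 3 + 6 * n%:R ^+ 2 * B * K + 96 * n%:R * K ^+ 2.
Proof.
move=> ba by_ B0 Ba By Ka Ky.
have Ex2 (h : I -> T -> R) : (forall m, bmeas (h m)) -> (forall o, \sum_m h m o ^+ 2 <= K) ->
    \sum_m Ex P (fun o => h m o ^+ 2) <= K.
  move=> bh hK; rewrite -Ex_sum; last by move=> m; bm.
  by apply: Ex_le_cst => //; bm.
pose ctr (h : I -> T -> R) m o := h m o - Ex P (h m).
have bctr h : (forall m, bmeas (h m)) -> forall m, bmeas (ctr h m).
  by move=> bh m; rewrite /ctr; bm.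
have Ectr h : (forall m, bmeas (h m)) -> forall m, Ex P (ctr h m) = 0.
  by move=> bh m; rewrite /ctr ExB ?Ex_cst ?subrr//; bm.
have Bctr h : (forall m, bmeas (h m)) -> bessel B h -> bessel B (ctr h).
  move=> bh Bh v; apply: le_trans (Bh v).
  have bv : bmeas (fun o => \sum_m v m * h m o) by bm.
  apply: le_trans (Var_le_sqr P bv); rewrite le_eqVlt; apply/orP; left; apply/eqP.
  apply: eq_Ex => o; congr (_ ^+ 2); rewrite Ex_sum; last by move=> m; bm.
  by rewrite -sumrB; apply: eq_bigr => m _; rewrite ExZl// -mulrBr.
have Kctr h : (forall m, bmeas (h m)) -> (forall o, \sum_m h m o ^+ 2 <= K) ->
    \sum_m Ex P (fun o => ctr h m o ^+ 2) <= K.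
  move=> bh hK; apply: le_trans (Ex2 _ bh hK); apply: ler_sum => m _.
  exact: Var_le_sqr.
have Lctr h : (forall m, bmeas (h m)) -> (forall o, \sum_m h m o ^+ 2 <= K) ->
    forall o, \sum_m ctr h m o ^+ 2 <= 4 * K.
  move=> bh hK o; apply: (@le_trans _ _ (2 * K + 2 * K)); last by lra.
  apply: (@le_trans _ _ (\sum_m (2 * h m o ^+ 2 + 2 * Ex P (h m) ^+ 2))).
    by apply: ler_sum => m _; rewrite -[Ex P (h m) ^+ 2]sqrrN sqrrD_le.
  rewrite big_split/= -!mulr_sumr lerD ?ler_pM2l//.
  apply: le_trans (Ex2 _ bh hK); apply: ler_sum => m _; exact: Ex_sqr_ge.
pose c := Ex P (fun o => \sum_m ctr a m o * ctr y m o).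
pose g o := \sum_m Ex P (y m) * a m o + \sum_m Ex P (a m) * y m o.
have bg : bmeas g by rewrite /g; bm.
have dotE (D : n.-tuple T) : dot a y D = dot (ctr a) (ctr y) D + n%:R * Sum g D
    - n%:R ^+ 2 * \sum_m Ex P (a m) * Ex P (y m).
  have SE h m : Sum (ctr h m) D = Sum (h m) D - n%:R * Ex P (h m).
    by rewrite /Sum /ctr sumrB sumr_const card_ord mulr_natl.
  have -> : Sum g D = \sum_m (Ex P (y m) * Sum (a m) D + Ex P (a m) * Sum (y m) D).
    rewrite /Sum /g big_split/= [in RHS]big_split/=.
    by congr (_ + _); rewrite exchange_big; apply: eq_bigr => m _; rewrite mulr_sumr.
  rewrite /dot !mulr_sumr -big_split/= -sumrB; apply: eq_bigr => m _.
  by rewrite !SE; ring.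
have bd : bmeas (@dot n (ctr a) (ctr y)) by apply: bmeas_dot; exact: bctr.
have bSg : bmeas (fun D : n.-tuple T => n%:R * Sum g D).
  by apply: bmeasM; [bm|exact: bmeas_Sum].
have -> : Var (iid P n) (dot a y) =
    Var (iid P n) (fun D => dot (ctr a) (ctr y) D + n%:R * Sum g D).
  rewrite -[RHS](VarDc _ (- (n%:R ^+ 2 * \sum_m Ex P (a m) * Ex P (y m)))); last exact: bmeasD.
  by congr Var; apply/funext => D; rewrite dotE.
apply: le_trans (VarD_le _ bd bSg) _.
rewrite VarZ ?Var_Sum//; last exact: bmeas_Sum.
have Vd : Var (iid P n) (dot (ctr a) (ctr y)) <=
    3 * n%:R ^+ 2 * B * K + 3 * n%:R * (4 * K) ^+ 2.
  apply: le_trans (Ex_sqr_center_le _ (n%:R * c) bd) _.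
  apply: Ex_dot_centered => //; [exact: bctr|exact: bctr|exact: Ectr|exact: Ectr|
    exact: Bctr|exact: Bctr|exact: Kctr|exact: Kctr|].
  by move=> o; apply: normr_sumM_le; exact: Lctr.
have Vg : Var P g <= 4 * B ^+ 2.
  apply: le_trans (Var_le_sqr P bg) _.
  apply: (@le_trans _ _ (Ex P (fun o => 2 * (\sum_m Ex P (y m) * a m o) ^+ 2 +
      2 * (\sum_m Ex P (a m) * y m o) ^+ 2))).
    by apply: le_Ex; [bm..|move=> o]; exact: sqrrD_le.
  have h1 := le_trans (Ba (fun m => Ex P (y m)))
    (ler_wpM2l B0 (Ex_bessel by_ B0 By)).
  have h2 := le_trans (By (fun m => Ex P (a m)))
    (ler_wpM2l B0 (Ex_bessel ba B0 Ba)).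
  by rewrite ExD ?ExZl; [|bm..]; nra.
have n0 : 0 <= n%:R :> R by [].
have := ler_wpM2l (exprn_ge0 3 n0) Vg; nra.
Qed.

End bilinear.

(** * Moments of counts *)

Section counts.
Context d (T : measurableType d) (R : realType) (P : probability T R).
Variables (u v : T -> R) (p q : R).
Hypotheses (bu : bmeas u) (bv : bmeas v).
Hypothesis u01 : forall o, u o = 0 \/ u o = 1.
Hypothesis v01 : forall o, v o = 0 \/ v o = 1 /\ u o = 1.
Hypotheses (up : Ex P u <= p) (vq : Ex P v <= q).

Let bS n h : bmeas h -> bmeas (@Sum _ T R n h). Proof. exact: bmeas_Sum. Qed.

Let u0 o : 0 <= u o. Proof. by have [->|->] := u01 o. Qed.
Let v0 o : 0 <= v o. Proof. by have [->|[-> _]] := v01 o. Qed.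
Let Sv0 n (D : n.-tuple T) : 0 <= Sum v D. Proof. by apply: sumr_ge0. Qed.
Let p0 : 0 <= p. Proof. by apply: le_trans up; apply: Ex_ge0. Qed.
Let q0 : 0 <= q. Proof. by apply: le_trans vq; apply: Ex_ge0. Qed.

Lemma Ex_sqr_count n :
  Ex (iid P n) (fun D => Sum u D ^+ 2) <= n%:R * p + (n%:R * p) ^+ 2.
Proof.
under eq_Ex do rewrite expr2.
rewrite Ex_SumM// (eq_Ex _ (g := u)); last first.
  by move=> o; have [->|->] := u01 o; rewrite ?mulr0 ?mulr1.
have E0 : 0 <= Ex P u by apply: Ex_ge0.
apply: lerD; first by rewrite ler_wpM2l.
apply: (@le_trans _ _ (n%:R ^+ 2 * (Ex P u * Ex P u))).
  by rewrite ler_wpM2r ?mulr_ge0// gerBl.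
by rewrite exprMn ler_wpM2l ?exprn_ge0// expr2 ler_pM.
Qed.

(** An observation counted by v is counted by u too, so size bias shifts both
   counts by one. *)
Lemma Ex_count_bias n (F : R -> R -> R) :
  (forall d' (T' : measurableType d') (a b : T' -> R),
     bmeas a -> bmeas b -> bmeas (fun t => F (a t) (b t))) ->
  Ex (iid P n.+1) (fun D => Sum v D * F (Sum u D) (Sum v D)) =
  n.+1%:R * Ex P v * Ex (iid P n) (fun D => F (1 + Sum u D) (1 + Sum v D)).
Proof.
move=> bF; rewrite Ex_size_bias// -mulrA -ExZr//; congr (_ * _); apply: eq_Ex => o.
by have [->|[-> ->]//] := v01 o; rewrite !mul0r.
Qed.

Lemma Ex_sqr_count_shift n c : 0 <= c -> Ex (iid P n) (fun D => (c + Sum u D) ^+ 2) <=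
  2 * c ^+ 2 + 2 * (n%:R * p + (n%:R * p) ^+ 2).
Proof.
move=> c0; apply: (@le_trans _ _ (Ex (iid P n) (fun D => 2 * c ^+ 2 + 2 * Sum u D ^+ 2))).
  by apply: le_Ex; [bm..|move=> D; exact: sqrrD_le].
rewrite ExD ?ExZl ?Ex_cst//; [|bm..].
by rewrite lerD2l ler_pM2l// Ex_sqr_count.
Qed.

(** Size bias is applied to the two factors Sum v in turn, each time for a
   factor n q; second moments of the larger count remain. *)
Lemma Ex_count4 n : Ex (iid P n) (fun D => Sum u D ^+ 2 * Sum v D ^+ 2) <=
  n%:R * q * (2 + 2 * (n%:R * p) + 2 * (n%:R * p) ^+ 2 +
    n%:R * q * (8 + 2 * (n%:R * p) + 2 * (n%:R * p) ^+ 2)).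
Proof.
case: n => [|n].
  by rewrite Ex_iid0; [rewrite !Sum0 !mul0r expr0n/= mulr0|bm].
have mono (m k : nat) : (m <= k)%N ->
    m%:R * p + (m%:R * p) ^+ 2 <= k%:R * p + (k%:R * p) ^+ 2 :> R.
  move=> mk; have h : m%:R * p <= k%:R * p by rewrite ler_wpM2r// ler_nat.
  by rewrite lerD// lerXn2r ?nnegrE ?mulr_ge0.
rewrite (eq_Ex _ (g := fun D => Sum v D * (Sum v D * Sum u D ^+ 2))); last first.
  by move=> D; ring.
rewrite (Ex_count_bias n (F := fun x y => y * x ^+ 2)); last first.
  by move=> *; bm.
have Ev0 : 0 <= Ex P v by apply: Ex_ge0.
apply: ler_pM; [by rewrite mulr_ge0| |by rewrite ler_wpM2l|].
  by apply: Ex_ge0 => D; rewrite mulr_ge0 ?sqr_ge0 ?addr_ge0.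
rewrite (eq_Ex _ (g := fun D => (1 + Sum u D) ^+ 2 + Sum v D * (1 + Sum u D) ^+ 2)); last first.
  by move=> D; rewrite mulrDl mul1r.
rewrite ExD; [|bm|bm].
apply: lerD.
  apply: le_trans (Ex_sqr_count_shift _ ler01) _.
  by have := mono n n.+1 (leqnSn n); lra.
case: n => [|n] in mono *.
  rewrite Ex_iid0; last by bm.
  by rewrite !Sum0 mul0r !(mulr_ge0, addr_ge0).
rewrite (Ex_count_bias n (F := fun x y => (1 + x) ^+ 2)); last first.
  by move=> *; bm.
apply: ler_pM; [by rewrite mulr_ge0| | |].
- by apply: Ex_ge0 => D; exact: sqr_ge0.
- by rewrite ler_pM// ler_nat.
rewrite (eq_Ex _ (g := fun D => (2 + Sum u D) ^+ 2)); last first.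
  by move=> D; rewrite addrA.
apply: le_trans (Ex_sqr_count_shift _ _) _ => //.
by have := mono n n.+2 (leq_trans (leqnSn n) (leqnSn _)); lra.
Qed.

End counts.

(** * Functions that agree on a set of full measure *)

Section full_measure.
Context d (T : measurableType d) (R : realType) (mu : probability T R).

Lemma full_ae (G : set T) (Q : T -> Prop) :
  measurable G -> mu G = 1%E -> (forall x, G x -> Q x) -> {ae mu, forall x, Q x}.
Proof.
move=> mG G1 GQ; exists (~` G); split; first exact: measurableC.
  by have := probability_setC mu mG; rewrite G1 subee.
by move=> x /= nQ Gx; apply: nQ; exact: GQ.
Qed.

Lemma ae_full (G : set T) : measurable G -> {ae mu, forall x, G x} -> mu G = 1%E.
Proof.
move=> mG aeG; have : mu (~` G) = 0%E.
  by apply/negligibleP; [exact: measurableC|exact: aeG].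
move=> G0; rewrite -[G]setCK probability_setC ?G0 ?sube0//.
exact: measurableC.
Qed.

Lemma ae_ex_full (Q : T -> Prop) : {ae mu, forall x, Q x} ->
  exists G, [/\ measurable G, mu G = 1%E & forall x, G x -> Q x].
Proof.
move=> [N [mN N0 sN]]; exists (~` N); split; first exact: measurableC.
  by rewrite probability_setC// N0 sube0.
by move=> x Nx; apply: contrapT => nQ; apply: Nx; exact: sN.
Qed.

Lemma eq_full_integral (G : set T) (f g : T -> R) : measurable G -> mu G = 1%E ->
  (forall x, G x -> f x = g x) -> measurable_fun setT f -> measurable_fun setT g ->
  (\int[mu]_x (f x)%:E = \int[mu]_x (g x)%:E)%E.
Proof.
move=> mG G1 fg mf mg; apply: ae_eq_integral => //; try exact/measurable_EFinP.
by apply: full_ae mG G1 _ => x /fg ->.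
Qed.

Lemma eq_full_Ex (G : set T) (f g : T -> R) : measurable G -> mu G = 1%E ->
  (forall x, G x -> f x = g x) -> measurable_fun setT f -> measurable_fun setT g ->
  Ex mu f = Ex mu g.
Proof.
by move=> mG G1 fg mf mg; congr fine; exact: eq_full_integral mG G1 fg mf mg.
Qed.

(** An arbitrary measurable statistic is thus handled through a bounded one
   with which it agrees almost surely. *)
Lemma EP_full (G : set T) (f g : T -> R) : measurable G -> mu G = 1%E ->
  (forall x, G x -> f x = g x) -> measurable_fun setT f -> bmeas g ->
  'E_mu[f]%E = (Ex mu g)%:E.
Proof.
move=> mG G1 fg mf bg; rewrite unlock ExE//.
by apply: eq_full_integral mG G1 fg mf _; exact: bmeas_meas.
Qed.

Lemma VP_full (G : set T) (f g : T -> R) : measurable G -> mu G = 1%E ->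
  (forall x, G x -> f x = g x) -> measurable_fun setT f -> bmeas g ->
  'V_mu[f]%E = (Var mu g)%:E.
Proof.
move=> mG G1 fg mf bg; rewrite /variance covariance.unlock.
rewrite (EP_full mG G1 fg mf bg) [fine _]/= /Var.
apply: (EP_full mG G1) => [x /fg fgx| |]; last by bm.
- by rewrite -fgx /= expr2.
- apply: measurable_funM; apply: measurable_funB => //; exact: measurable_cst.
Qed.

End full_measure.

Lemma prod_prob_full d1 d2 (T1 : measurableType d1) (T2 : measurableType d2)
    (R : realType) (P : probability T1 R) (Q : probability T2 R)
    (A : set T1) (B : set T2) : measurable A -> measurable B ->
  P A = 1%E -> Q B = 1%E -> prod_prob P Q (A `*` B) = 1%E.
Proof.
move=> mA mB A1 B1; rewrite /prod_prob [LHS]product_measure1E//.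
by rewrite -[RHS]mule1; congr (_ * _)%E.
Qed.

Section iid_full.
Context d (T : measurableType d) (R : realType) (P : probability T R).
Variable (G : set T).
Hypotheses (mG : measurable G) (G1 : P G = 1%E).

Definition all_in n : set (n.-tuple T) := [set D | forall i, G (tnth D i)].

Lemma measurable_all_in n : measurable (@all_in n).
Proof.
rewrite (_ : all_in (n := n) = \big[setI/setT]_(i < n) ((@tnth n T ^~ i) @^-1` G)).
  apply: bigsetI_measurable => i _.
  by rewrite -[X in measurable X]setTI; exact: measurable_tnth.
rewrite -bigcap_seq; apply/seteqP; split=> [D h i _|D h i]; first exact: h.
by apply: h => /=; rewrite mem_index_enum.
Qed.

Lemma iid_full n : iid P n (@all_in n) = 1%E.
Proof.
elim: n => [|n IH].
  rewrite (_ : all_in (n := 0) = setT) ?probability_setT//.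
  by apply/seteqP; split=> // D _; case.
transitivity (prod_prob P (iid P n) (G `*` @all_in n)); last first.
  by apply: prod_prob_full => //; exact: measurable_all_in.
rewrite [LHS]/=/distribution /pushforward; congr (prod_prob _ _ _).
apply/seteqP; split=> [[x D] h|[x D] [Gx h] i].
  split; first by have := h ord0; rewrite /= tnth0.
  by move=> i; have := h (lift ord0 i); rewrite tnthS.
by have [j ->|->] := unliftP ord0 i; rewrite ?tnthS ?tnth0//; exact: h.
Qed.

End iid_full.

(** * The uniform laws on the interval and on the cube *)

Section uniform.
Context (R : realType).

Lemma unif01E (A : set R) : measurable A ->
  @unif01 R A = lebesgue_measure (A `&` `[0%R, 1%R]%classic).
Proof.
move=> mA; rewrite /unif01 /uniform_prob integral_uniform_pdf.
rewrite (eq_integral (fun=> 1%E)); last first.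
  move=> x; rewrite inE => -[_ /=]; rewrite in_itv/= /uniform_pdf => ->.
  by rewrite subr0 invr1.
rewrite integral_cst ?mul1e//; apply: measurableI => //; exact: measurable_itv.
Qed.

Lemma Ex_indic d (T : measurableType d) (mu : probability T R) (A : set T) :
  measurable A -> (Ex mu (\1_A))%:E = mu A.
Proof.
move=> mA; rewrite ExE; last exact: bmeas_indic.
by rewrite integral_indic// setIT.
Qed.

Lemma unif01_full : @unif01 R `[0%R, 1%R]%classic = 1%E.
Proof.
rewrite unif01E ?setIid; last exact: measurable_itv.
by rewrite lebesgue_measure_itv/= lte_fin ltr01 oppr0 adde0.
Qed.

Lemma unif01_le (t : R) : 0 <= t <= 1 -> Ex (@unif01 R) (\1_[set u | u <= t]) = t.
Proof.
move=> /andP[t0 t1]; have mt : measurable [set u : R | u <= t].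
  by rewrite -[X in measurable X]set_itvNyc; exact: measurable_itv.
apply: EFin_inj; rewrite Ex_indic// [LHS]unif01E//.
rewrite (_ : _ `&` _ = `[0, t]%classic).
  by rewrite lebesgue_measure_itv/= lte_fin; case: ltgtP t0 => //= [_ _|<-]; rewrite ?oppr0 ?adde0.
apply/seteqP; split=> u /=; rewrite !in_itv/=.
  by move=> [-> /andP[->]].
by move=> /andP[-> ut]; split=> //=; exact: le_trans t1.
Qed.

Lemma unif01_ball (x r : R) : 0 <= r ->
  Ex (@unif01 R) (\1_[set u | `|u - x| <= r]) <= 2 * r.
Proof.
move=> r0; have E : [set u | `|u - x| <= r] = `[x - r, x + r]%classic.
  by apply/seteqP; split=> u /=; rewrite in_itv/= ler_distl.
have mE : measurable [set u : R | `|u - x| <= r] by rewrite E; exact: measurable_itv.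
rewrite -lee_fin Ex_indic// [leLHS]unif01E//.
apply: (@le_trans _ _ (lebesgue_measure `[x - r, x + r]%classic)).
  apply: le_measure; rewrite ?inE.
  - by apply: measurableI => //; exact: measurable_itv.
  - exact: measurable_itv.
  - by rewrite E; exact: subIsetl.
rewrite lebesgue_measure_itv/= lte_fin; case: ifPn => _.
  by rewrite -EFinB lee_fin; lra.
by rewrite lee_fin mulr_ge0.
Qed.

Definition clamp (a b t : R) : R := Num.max a (Num.min b t).

Lemma clamp_in a b t : a <= b -> a <= clamp a b t <= b.
Proof. by move=> ab; rewrite /clamp le_max lexx ge_max ab ge_min lexx. Qed.

Lemma normr_clamp a b t : a <= b -> `|clamp a b t| <= `|a| + `|b|.
Proof.
move=> /(clamp_in t)/andP[h1 h2]; rewrite ler_norml.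
have := ler_norm b; have := ler_norm (- a); rewrite normrN.
by have := normr_ge0 a; have := normr_ge0 b => *; apply/andP; split; lra.
Qed.

Lemma clamp_id a b t : a <= t <= b -> clamp a b t = t.
Proof. by move=> /andP[at_ tb]; rewrite /clamp (min_idPr tb) (max_idPr at_). Qed.

Lemma measurable_between d' (T : measurableType d') (k : T -> R) a b :
  measurable_fun setT k -> measurable [set t | a <= k t <= b].
Proof.
move=> mk; rewrite (_ : [set t | _] = (fun t => (a <= k t) && (k t <= b)) @^-1` [set true]) //.
rewrite -[X in measurable X]setTI; apply: measurable_and => //.
- by apply: measurable_fun_ler => //; exact: measurable_cst.
- by apply: measurable_fun_ler => //; exact: measurable_cst.
Qed.

Lemma measurable_clamp a b : measurable_fun setT (clamp a b).
Proof.
apply: measurable_maxr; first exact: measurable_cst.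
by apply: measurable_minr; [exact: measurable_cst|exact: measurable_id].
Qed.

Variable d : nat.

(** The nearest point of the cube: it turns a function which is only known on the
    cube into a bounded measurable function on the whole space. *)
Definition retract (x : d.-tuple R) : d.-tuple R := map_tuple (clamp 0 1) x.

Lemma retract_cube x : cube (retract x).
Proof. by move=> i; rewrite tnth_map clamp_in. Qed.

Lemma retract_id x : cube x -> retract x = x.
Proof. by move=> cx; apply: eq_from_tnth => i; rewrite tnth_map clamp_id. Qed.

Lemma measurable_retract : measurable_fun setT retract.
Proof.
apply/measurable_fun_tnthP => i.
rewrite (_ : _ \o _ = fun x => clamp 0 1 (tnth x i)).
  by apply: measurableT_comp; [exact: measurable_clamp|exact: measurable_tnth].
by apply/funext => x /=; rewrite tnth_map.
Qed.

Lemma cubeE : @cube R d = @all_in _ R `[0%R, 1%R]%classic d.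
Proof. by apply/seteqP; split=> x h i; have := h i; rewrite /= in_itv. Qed.

Lemma measurable_cube : measurable (@cube R d).
Proof. by rewrite cubeE; apply: measurable_all_in; exact: measurable_itv. Qed.

Lemma unif_cube_full : unif_cube R d (@cube R d) = 1%E.
Proof.
by rewrite cubeE; apply: iid_full; [exact: measurable_itv|exact: unif01_full].
Qed.

(** Composition with retract makes the values taken off the cube irrelevant:
   regression functions are only constrained on the cube. *)
Definition cmeas (f : d.-tuple R -> R) := bmeas (f \o retract).

Definition Ec (f : d.-tuple R -> R) := Ex (unif_cube R d) (f \o retract).

Lemma integral_cubeE f : cmeas f ->
  (\int[unif_cube R d]_(x in cube (d:=d)) (f x)%:E = (Ec f)%:E)%E.
Proof.
move=> bf; rewrite integral_mkcond [RHS]ExE//.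
transitivity (\int[unif_cube R d]_x (((f \o retract) \* \1_(@cube R d)) x)%:E)%E.
  apply: eq_integral => x _; rewrite patchE /= indicE; case: ifPn => cx /=.
    by rewrite mulr1 retract_id//; exact: set_mem.
  by rewrite mulr0.
apply: (eq_full_integral measurable_cube unif_cube_full).
- by move=> x cx /=; rewrite indicE mem_set// mulr1.
- apply: measurable_funM; first exact: bmeas_meas.
  exact: measurable_indic measurable_cube.
- exact: bmeas_meas.
Qed.

Lemma Ec_cubeE f : cmeas f -> \int[unif_cube R d]_(x in cube (d:=d)) f x = Ec f.
Proof. by move=> cf; rewrite /Rintegral integral_cubeE. Qed.

Lemma inner_Ec f g : cmeas f -> cmeas g -> inner f g = Ec (fun x => f x * g x).
Proof. by move=> bf bg; apply: Ec_cubeE; exact: (bmeasM bf bg). Qed.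

End uniform.

(** * Conditional expectations given the covariate *)

Section layer_cake.
Context d (T : measurableType d) d' (T' : measurableType d') (R : realType).
Variables (P : probability T R) (X : T -> T').
Hypothesis mX : measurable_fun setT X.

(** A bounded function h with values in [0, 1] is the average over u of the
    indicators of its level sets h >= u, so indicators suffice. *)
Lemma Ex_indic_ext (D : T -> R) (h : T' -> R) : bmeas D -> bmeas h ->
  (forall B, measurable B -> Ex P (fun x => D x * \1_B (X x)) = 0) ->
  Ex P (fun x => D x * h (X x)) = 0.
Proof.
move=> bD bh D0; have [M M0 hM] := bmeas_ub bh.
have c0 : 0 < 2 * M + 1 by rewrite ltr_wpDl// mulr_ge0.
pose k y := (h y + M) / (2 * M + 1).
have bk : bmeas k by rewrite /k; bm.
have k01 y : 0 <= k y <= 1.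
  have := hM y; rewrite ler_norml => /andP[h1 h2].
  by rewrite /k ler_pdivlMr// ler_pdivrMr// mul0r mul1r; apply/andP; split; lra.
have bkX : bmeas (fun x => k (X x)) by exact: bmeas_comp bk.
pose A := [set z : T * R | z.2 <= k (X z.1)].
have mA : measurable A.
  rewrite (_ : A = (fun z : T * R => z.2 <= k (X z.1)) @^-1` [set true]) //.
  rewrite -[X in measurable X]setTI; apply: measurable_fun_ler => //.
  by apply: (bmeas_meas (f := fun z : T * R => k (X z.1))); exact: (bmeas_fst _ bkX).
have bA : bmeas (fun z : T * R => D z.1 * \1_A z).
  by apply: bmeasM; [exact: bmeas_fst|exact: bmeas_indic].
have ED : Ex P D = 0.
  by rewrite -(D0 setT measurableT); apply: eq_Ex => x; rewrite indicT mulr1.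
have E : Ex P (fun x => D x * k (X x)) = 0.
  transitivity (Ex P (fun x => Ex (@unif01 R) (fun u => D x * \1_A (x, u)))).
    apply: eq_Ex => x; rewrite ExZl; last first.
      by apply: (bmeas_pair1 (f := \1_A)); exact: bmeas_indic.
    by congr (_ * _); rewrite -[LHS](unif01_le (k01 _)).
  rewrite (Ex_swap P (@unif01 R) bA) -[RHS](Ex_cst (@unif01 R)); apply: eq_Ex => u.
  apply: (D0 [set y | u <= k y]).
  rewrite (_ : [set y | u <= k y] = (fun y => u <= k y) @^-1` [set true]) //.
  rewrite -[X in measurable X]setTI; apply: measurable_fun_ler => //.
  exact: bmeas_meas.
transitivity (Ex P (fun x => (2 * M + 1) * (D x * k (X x)) - M * D x)).
  by apply: eq_Ex => x; rewrite /k; field; rewrite gt_eqF.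
by rewrite ExB ?ExZl ?E ?ED ?mulr0 ?subr0//; bm.
Qed.

End layer_cake.

Section cond_exp_existence.
Context (R : realType) (d : nat) (P : probability (datum R d) R).

Lemma measurable_obsX : measurable_fun setT (@obsX R d).
Proof.
exact: (measurableT_comp measurable_fst measurable_fst).
Qed.

Lemma measurable_obsA : measurable_fun setT (@obsA R d).
Proof.
exact: (measurableT_comp measurable_snd measurable_fst).
Qed.

Lemma measurable_obsY : measurable_fun setT (@obsY R d).
Proof. exact: measurable_snd. Qed.

Lemma integral_preX (B : set (d.-tuple R)) (phi : datum R d -> R) :
  (\int[P]_(o in @obsX R d @^-1` B) (phi o)%:E =
   \int[P]_o (phi o * \1_B (obsX o))%:E)%E.
Proof.
rewrite integral_mkcond; apply: eq_integral => o _.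
rewrite patchE indicE; case: ifPn => oB.
  by rewrite mem_set ?mulr1//; exact: set_mem oB.
by rewrite memNset ?mulr0//; move: oB; rewrite notin_setE.
Qed.

HB.instance Definition _ := isMeasurableFun.Build _ _ _ _ (@obsX R d) measurable_obsX.

(** Radon-Nikodym: the charge B |-> E[F; X in B] has a density with respect to
    the law of X. *)
Lemma is_cond_exp_exists (F : datum R d -> R) :
  P.-integrable setT (EFin \o F) -> exists g, is_cond_exp P F g.
Proof.
move=> iF.
pose nu := pushforward (induced_charge iF) (@obsX R d).
pose mu : probability (d.-tuple R) R := distribution P (@obsX R d).
have numu : nu `<< mu.
  apply/null_content_dominatesP => B mB muB.
  rewrite /nu /pushforward /induced_charge null_set_integral//.
  - by rewrite -[X in measurable X]setTI; exact: measurable_obsX.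
  - by apply: measurable_funTS; exact: measurable_int iF.
have [f [ff fi fE]] : exists f : d.-tuple R -> \bar R,
    [/\ forall x, f x \is a fin_num, mu.-integrable setT f &
      forall B, measurable B -> nu B = (\int[mu]_(x in B) f x)%E].
  eexists; split; [move=> x; exact: (Radon_Nikodym_fin_num x numu)|
    exact: (Radon_Nikodym_integrable numu)|].
  by move=> B mB; exact: (Radon_Nikodym_integral numu mB).
have mf : measurable_fun setT f by exact: measurable_int fi.
exists (fine \o f).
have fEF x : (fine (f x))%:E = f x by rewrite fineK.
have iX : P.-integrable setT (f \o @obsX R d).
  apply/integrableP; split.
    by apply: measurableT_comp => //; exact: measurable_obsX.
  move/integrableP : fi => [_]; apply: le_lt_trans.
  rewrite [leRHS]ge0_integral_distribution//.
  by apply: measurableT_comp.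
split.
- by apply: measurableT_comp.
- by rewrite (_ : _ \o _ = f \o @obsX R d)//; apply/funext => x /=; rewrite fEF.
- move=> B mB; have mXB : measurable (@obsX R d @^-1` B).
    by rewrite -[X in measurable X]setTI; exact: measurable_obsX.
  transitivity (nu B); last by [].
  rewrite fE// [RHS]integral_pushforward//.
  + by apply: eq_integral => x _ /=; rewrite fEF.
  + exact: (integrableS measurableT).
Qed.

End cond_exp_existence.

(** * Uniformly continuous functions on the cube *)

Section uniform_continuity.
Context (R : realType) (d : nat) (h : d.-tuple R -> R).
Hypothesis uch : unif_continuous_cube h.

Let cell N (k : 'I_N.+1) : set R :=
  [set t | k%:R <= N%:R * t < k%:R + 1].

Let measurable_cell N (k : 'I_N.+1) : measurable (cell k).
Proof.
have mN : measurable_fun setT (fun t : R => N%:R * t).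
  by apply: measurable_funM; [exact: measurable_cst|exact: measurable_id].
rewrite (_ : cell k = (fun t => (k%:R <= N%:R * t) && (N%:R * t < k%:R + 1)) @^-1` [set true]) //.
rewrite -[X in measurable X]setTI; apply: measurable_and => //.
- by apply: measurable_fun_ler => //; exact: measurable_cst.
- by apply: measurable_fun_ltr => //; exact: measurable_cst.
Qed.

Let node N (k : {ffun 'I_d -> 'I_N.+1}) : d.-tuple R :=
  [tuple (k i)%:R / N%:R | i < d].

(** The step function taking on each cell of the grid of mesh 1/N the value of h
    at the lower corner. *)
Let step N (x : d.-tuple R) : R :=
  \sum_(k : {ffun 'I_d -> 'I_N.+1}) h (node k) *
    \prod_(i < d) \1_(cell (k i)) (tnth (retract x) i).

Let bmeas_step N : bmeas (step N).
Proof.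
apply: bmeas_sum => k; apply: bmeasM; first exact: bmeas_cst.
apply: bmeas_prod => i.
apply: (bmeas_comp (h := fun x : d.-tuple R => tnth (retract x) i)
  (f := \1_(cell (k i)))); last exact: bmeas_indic.
by apply: (measurableT_comp (measurable_tnth i)); exact: measurable_retract.
Qed.

Let stepE N x : (0 < N)%N -> exists2 k : {ffun 'I_d -> 'I_N.+1},
  step N x = h (node k) & cube (node k) /\
  forall i, `|tnth (node k) i - tnth (retract x) i| <= N%:R^-1.
Proof.
move=> N0; have Np : 0 < N%:R :> R by rewrite ltr0n.
pose t i := tnth (retract x) i.
have t01 i : 0 <= t i <= 1 by exact: retract_cube.
have kP i : (Num.truncn (N%:R * t i) < N.+1)%N.
  have /andP[t0 t1] := t01 i; rewrite ltnS truncn_le_nat -natr1.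
  by rewrite (@le_lt_trans _ _ N%:R) ?ltrDl// ger_pMr.
pose k := [ffun i => Ordinal (kP i)] : {ffun 'I_d -> 'I_N.+1}.
have kE i : (k i)%:R <= N%:R * t i < (k i)%:R + 1.
  rewrite ffunE /= natr1; apply: truncn_itv.
  by have /andP[t0 t1] := t01 i; rewrite mulr_ge0.
have nE i : tnth (node k) i = (k i)%:R / N%:R by rewrite tnth_mktuple.
exists k; last split.
- rewrite /step (bigD1 k)//= [X in _ + X]big1 ?addr0.
    by rewrite big1 ?mulr1// => i _; rewrite indicE mem_set//; exact: kE.
  move=> k' kk'; have [i ki] : exists i, k' i != k i.
    apply/existsP; rewrite -negb_forall; apply: contra kk' => /forallP H.
    by apply/eqP/ffunP => i; exact/eqP/H.
  rewrite (bigD1 i)//= indicE memNset ?mul0r ?mulr0//= => /andP[h1 h2].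
  have /andP[h3 h4] := kE i; move/eqP: ki; apply; apply/val_inj => /=.
  apply/eqP; rewrite eqn_leq; apply/andP; split; rewrite -ltnS -(ltr_nat R) -natr1.
    exact: le_lt_trans h1 h4.
  exact: le_lt_trans h3 h2.
- move=> i; rewrite nE divr_ge0//= ler_pdivrMr// mul1r ler_nat.
  by rewrite -ltnS.
- move=> i; rewrite nE; have /andP[h1 h2] := kE i.
  have -> : (k i)%:R / N%:R - tnth (retract x) i = ((k i)%:R - N%:R * t i) / N%:R.
    by rewrite mulrBl mulrAC divff ?mul1r// gt_eqF.
  rewrite normrM [`|_^-1|]gtr0_norm ?invr_gt0// ler_piMl ?invr_ge0//.
  by rewrite ler_norml; apply/andP; split; lra.
Qed.

Let step_cvg e : 0 < e -> exists2 N0, (0 < N0)%N &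
  forall N, (N0 <= N)%N -> forall x, `|h (retract x) - step N x| < e.
Proof.
move=> /uch[r r0 hr]; exists (Num.truncn r^-1).+1 => // N NN x.
have N0 : (0 < N)%N by exact: leq_trans NN.
have [k -> [ck kx]] := stepE x N0; rewrite distrC; apply: hr => //.
  exact: retract_cube.
move=> i; apply: le_lt_trans (kx i) _.
rewrite invf_plt ?posrE ?ltr0n//; apply: lt_le_trans (truncnS_gt _) _.
by rewrite ler_nat.
Qed.

(** Uniform continuity makes h a uniform limit of step functions on grids,
   which are bounded and measurable. *)
Lemma unif_continuous_cmeas : cmeas h.
Proof.
split.
  apply: (@measurable_fun_cvg _ _ _ setT step) => //.
    by move=> N; exact: bmeas_meas.
  move=> x _; apply/cvgrPdist_lt => e e0; have [N0 _ hN] := step_cvg e0.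
  by exists N0 => // N /= NN; exact: hN.
have [N0 _ hN] := step_cvg ltr01.
have [B _ hB] := bmeas_ub (bmeas_step N0).
exists (1 + B) => x; rewrite -[_ x](subrK (step N0 x)).
by apply: le_trans (ler_normD _ _) _; rewrite lerD// ltW// hN.
Qed.

End uniform_continuity.

(** * Regression functions and the functional *)

Section covariate.
Context (R : realType) (d : nat) (P : probability (datum R d) R).
Hypothesis lawX : forall B, measurable B -> P (@obsX R d @^-1` B) = unif_cube R d B.
Implicit Types (f : datum R d -> R) (g h : d.-tuple R -> R).

Lemma Ex_law g : bmeas g -> Ex P (fun o => g (obsX o)) = Ex (unif_cube R d) g.
Proof.
move=> bg; rewrite -[LHS](Ex_distribution (P := P) (@obsX R d) bg).
congr fine; apply: eq_measure_integral => B mB _; exact: lawX.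
Qed.

Lemma Ex_law_retract g : cmeas g ->
  Ex P (fun o => g (retract (obsX o))) = Ec g.
Proof. by move=> cg; exact: (Ex_law cg). Qed.

Lemma measurable_preX B : measurable B -> measurable (@obsX R d @^-1` B).
Proof. by move=> mB; rewrite -[X in measurable X]setTI; exact: measurable_obsX. Qed.

Lemma bmeas_preX g : cmeas g -> bmeas (fun o : datum R d => g (retract (obsX o))).
Proof. by move=> cg; apply: (bmeas_comp _ cg); exact: measurable_obsX. Qed.

Let full_X : P (@obsX R d @^-1` @cube R d) = 1%E.
Proof. by rewrite lawX ?unif_cube_full//; exact: measurable_cube. Qed.

Let mfull_X : measurable (@obsX R d @^-1` @cube R d).
Proof. by apply: measurable_preX; exact: measurable_cube. Qed.

(** The definition of a regression function g of f only tests it on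
   indicators of events about X; Ex_indic_ext passes to bounded functions h of
   X. Here fc is a bounded version of f. *)
Lemma Ex_cond_exp f fc g h : measurable_fun setT f -> bmeas fc ->
  {ae P, forall o, f o = fc o} -> is_cond_exp P f g -> cmeas g -> cmeas h ->
  Ex P (fun o => fc o * h (retract (obsX o))) = Ec (fun x => g x * h x).
Proof.
move=> mf bfc ffc [mg ig Eg] cg ch.
have [G [mG G1 hG]] := ae_ex_full ffc.
have bgX := bmeas_preX cg.
have E0 : Ex P (fun o => (fc o - g (retract (obsX o))) * h (retract (obsX o))) = 0.
  have := @Ex_indic_ext _ _ _ _ _ P _ (@measurable_obsX R d) _ (h \o @retract R d) (bmeasB bfc bgX) ch.
  apply.
  move=> B mB.
  have b1 : bmeas (fun o : datum R d => \1_B (obsX o) : R).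
    by apply: bmeas_comp (bmeas_indic R mB); exact: measurable_obsX.
  rewrite (eq_Ex _ (g := fun o => fc o * \1_B (obsX o) - g (retract (obsX o)) * \1_B (obsX o)));
    last by move=> o; rewrite mulrBl.
  rewrite ExB; [|bm|bm]; apply/eqP; rewrite subr_eq0; apply/eqP.
  have mB1 := bmeas_meas b1.
  apply: EFin_inj; rewrite !ExE; [|bm|bm].
  transitivity (\int[P]_(o in @obsX R d @^-1` B) (f o)%:E)%E.
    rewrite integral_preX; apply: (eq_full_integral mG G1).
    - by move=> o /hG ->.
    - by apply: measurable_funM => //; exact: bmeas_meas.
    - exact: measurable_funM.
  rewrite -Eg// integral_preX; apply: (eq_full_integral mfull_X full_X).
  - by move=> o /= /retract_id ->.
  - by apply: measurable_funM => //; apply: (measurableT_comp mg); exact: measurable_obsX.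
  - by apply: measurable_funM => //; exact: bmeas_meas.
transitivity (Ex P (fun o => g (retract (obsX o)) * h (retract (obsX o)))).
  have bhX := bmeas_preX ch.
  apply/eqP; rewrite -subr_eq0 -ExB; [|bm|bm].
  by rewrite -[X in _ == X]E0; apply/eqP/eq_Ex => o; rewrite mulrBl.
rewrite (Ex_law_retract (g := fun x => g x * h x))//.
exact: (bmeasM cg ch).
Qed.

(** Two regression functions of f have the same integral on every set, with
   respect to the law of X. *)
Lemma cond_exp_unique f g g' : is_cond_exp P f g -> is_cond_exp P f g' ->
  {ae P, forall o, g (obsX o) = g' (obsX o)}.
Proof.
move=> [mg ig Eg] [mg' ig' Eg'].
pose mu : probability (d.-tuple R) R := distribution P (@obsX R d).
have E k B : measurable_fun setT k -> P.-integrable setT (EFin \o (k \o @obsX R d)) ->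
    measurable B -> (\int[mu]_(x in B) (k x)%:E = \int[P]_(o in @obsX R d @^-1` B) (k (obsX o))%:E)%E.
  move=> mk ik mB; rewrite [LHS]integral_pushforward//.
  - by apply/measurable_EFinP.
  - by apply: (integrableS measurableT) => //; exact: measurable_preX.
have : ae_eq mu setT (EFin \o g) (EFin \o g').
  apply: integral_ae_eq => //.
  - by apply: integrable_pushforward => //; exact/measurable_EFinP.
  - exact/measurable_EFinP.
  - by move=> B _ mB; rewrite /= !E// Eg// Eg'.
move=> /ae_ex_full[G [mG G1 hG]].
apply: (full_ae (measurable_preX mG)); first exact: G1.
by move=> o /hG /(_ I) [].
Qed.

End covariate.

Section model_facts.
Context (R : realType) (d : nat) (w : wavelets R) (J0 : nat).
Context (alpha beta M C1 C2 : R) (P : probability (datum R d) R).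
Hypothesis C12 : C1 <= C2.

Definition obsAc (o : datum R d) : R := clamp C1 C2 (obsA o).
Definition obsYc (o : datum R d) : R := clamp C1 C2 (obsY o).
Definition obsXc (o : datum R d) : d.-tuple R := retract (obsX o).

(** The nearest admissible observation: almost every observation is its own. *)
Definition clampD (o : datum R d) : datum R d := (obsXc o, obsAc o, obsYc o).

Definition admissible : set (datum R d) :=
  [set o | cube (obsX o) /\ (C1 <= obsA o <= C2 /\ C1 <= obsY o <= C2)].

Lemma clampD_id o : admissible o -> clampD o = o.
Proof.
case: o => -[x a] y [cx [ha hy]].
by rewrite /clampD /obsXc /obsAc /obsYc retract_id// !clamp_id.
Qed.

Lemma measurable_admissible : measurable admissible.
Proof.
apply: measurableI; first by apply: measurable_preX; exact: measurable_cube.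
by apply: measurableI; apply: measurable_between; [exact: measurable_obsA|exact: measurable_obsY].
Qed.

Lemma bmeas_clamp d' (T : measurableType d') (k : T -> R) :
  measurable_fun setT k -> bmeas (fun t => clamp C1 C2 (k t)).
Proof.
move=> mk; split; first by apply: (measurableT_comp _ mk); exact: measurable_clamp.
by exists (`|C1| + `|C2|) => t; exact: normr_clamp.
Qed.

Lemma bmeas_obsAc : bmeas obsAc. Proof. by apply: bmeas_clamp; exact: measurable_obsA. Qed.
Lemma bmeas_obsYc : bmeas obsYc. Proof. by apply: bmeas_clamp; exact: measurable_obsY. Qed.

Hypothesis modelP : model w J0 alpha beta M C1 C2 P.

Let lawX : forall B, measurable B -> P (@obsX R d @^-1` B) = unif_cube R d B.
Proof. by case: modelP. Qed.

Lemma admissible_full : P admissible = 1%E.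
Proof.
apply: ae_full; first exact: measurable_admissible.
case: modelP => _ hAY _ _.
have hX : {ae P, forall o, cube (obsX o)}.
  apply: (full_ae (G := @obsX R d @^-1` @cube R d)) => //.
  - by apply: measurable_preX; exact: measurable_cube.
  - by rewrite lawX ?unif_cube_full//; exact: measurable_cube.
by apply: filterS2 hX hAY => o ? ?; split.
Qed.

Lemma ae_obsAc : {ae P, forall o, obsA o = obsAc o}.
Proof.
apply: (full_ae measurable_admissible admissible_full) => o [_ [h _]].
by rewrite /obsAc clamp_id.
Qed.

Lemma ae_obsYc : {ae P, forall o, obsY o = obsYc o}.
Proof.
apply: (full_ae measurable_admissible admissible_full) => o [_ [_ h]].
by rewrite /obsYc clamp_id.
Qed.

(** The arbitrary versions of the regression functions that psi refers to may
   be replaced by p and b almost surely; the conditional covariance then expands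
   as usual. *)
Lemma psiE p b : cmeas p -> cmeas b -> is_cond_exp P (@obsA R d) p ->
  is_cond_exp P (@obsY R d) b ->
  psi P = Ex P (fun o => obsAc o * obsYc o) - Ec (fun x => p x * b x).
Proof.
move=> cp cb hp hb.
have bA := bmeas_obsAc; have bY := bmeas_obsYc.
have bpX := bmeas_preX cp; have bbX := bmeas_preX cb.
have hp' : is_cond_exp P (@obsA R d) (cond_exp P (@obsA R d)) by exact: (xgetI _ hp).
have hb' : is_cond_exp P (@obsY R d) (cond_exp P (@obsY R d)) by exact: (xgetI _ hb).
pose F o := (obsA o - cond_exp P (@obsA R d) (obsX o)) *
            (obsY o - cond_exp P (@obsY R d) (obsX o)).
pose Fc o := (obsAc o - p (obsXc o)) * (obsYc o - b (obsXc o)).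
have bFc : bmeas Fc by rewrite /Fc; bm.
have mF : measurable_fun setT F.
  case: hp' hb' => [mp _ _] [mb _ _].
  apply: measurable_funM; apply: measurable_funB.
  - exact: measurable_obsA.
  - by apply: (measurableT_comp mp); exact: measurable_obsX.
  - exact: measurable_obsY.
  - by apply: (measurableT_comp mb); exact: measurable_obsX.
have FFc : {ae P, forall o, F o = Fc o}.
  have hX := full_ae measurable_admissible admissible_full (fun _ => id).
  apply: filterS2 (filterI (cond_exp_unique hp hp') (cond_exp_unique hb hb')) hX.
  move=> o [h1 h2] Go; have E := clampD_id Go; rewrite /F /Fc -h1 -h2.
  have EX : obsX o = obsXc o by rewrite -{1}E.
  have EA : obsA o = obsAc o by rewrite -{1}E.
  have EY : obsY o = obsYc o by rewrite -{1}E.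
  by rewrite EX EA EY.
have [G [mG G1 hG]] := ae_ex_full FFc.
have iF : P.-integrable setT (EFin \o F).
  apply/integrableP; split; first exact/measurable_EFinP.
  have /integrableP[_] := bmeas_integrable P bFc; apply: le_lt_trans.
  rewrite le_eqVlt; apply/orP; left; apply/eqP.
  apply: ae_eq_integral => //.
  - by apply: measurableT_comp => //; exact/measurable_EFinP.
  - by apply: measurableT_comp => //; apply/measurable_EFinP; exact: bmeas_meas.
  - by apply: (full_ae mG G1) => o /hG /= ->.
have [_ _ Ec_] : is_cond_exp P F (cond_cov P (@obsA R d) (@obsY R d)).
  have [g hg] := is_cond_exp_exists iF; exact: (xgetI _ hg).
have -> : psi P = Ex P Fc.
  rewrite /psi; congr fine; rewrite unlock.
  have := Ec_ setT measurableT; rewrite preimage_setT => ->.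
  by apply: (eq_full_integral mG G1 hG) => //; exact: bmeas_meas.
have EA := Ex_cond_exp lawX (@measurable_obsA R d) bA ae_obsAc hp cp cb.
have EY := Ex_cond_exp lawX (@measurable_obsY R d) bY ae_obsYc hb cb cp.
have Epb := Ex_law_retract lawX (g := fun x => p x * b x) (bmeasM cp cb).
transitivity (Ex P (fun o => obsAc o * obsYc o - obsAc o * b (obsXc o)
   - obsYc o * p (obsXc o) + p (obsXc o) * b (obsXc o))).
  by apply: eq_Ex => o; rewrite /Fc; ring.
rewrite ExD ?ExB; [|bm..].
rewrite EA EY [X in _ + X]Epb (_ : Ec (fun x => b x * p x) = Ec (fun x => p x * b x)).
  by rewrite addrAC; ring.
by congr Ec; apply/funext => x; rewrite mulrC.
Qed.

End model_facts.

(** * One-dimensional wavelets *)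

Section heine.
Context (R : realType).

(** Heine: compactness of the segment yields a uniform radius. The second
   point may lie outside. *)
Lemma segment_unif_continuous (f : R -> R) (a b e : R) : continuous f -> 0 < e ->
  exists2 r : R, 0 < r &
    forall s t, a <= s <= b -> `|s - t| < r -> `|f s - f t| < e.
Proof.
move=> cf e0.
have cK := @segment_compact R a b.
have := (compact_near_coveringP _).1 cK _ (0^'+ : set_system R)
  (fun r s => forall t, `|s - t| < r -> `|f s - f t| < e) _.
case.
  move=> s _; have e2 : 0 < e / 2 by rewrite divr_gt0.
  have [r /= r0 hr] := (cvgrPdist_lt _ _).1 (cf s) _ e2.
  have r2 : 0 < r / 2 by rewrite divr_gt0.
  exists (ball s (r / 2), [set u | 0 < u < r / 2]); first split => /=.
  - exact: nbhsx_ballx.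
  - by exists (r / 2) => //= u /=; rewrite sub0r normrN => hu u0; rewrite u0 (le_lt_trans (ler_norm _) hu).
  move=> [s' u] /= [hs' /andP[u0 hu]] t ht.
  rewrite -(subrKA (f s)) (le_lt_trans (ler_normD _ _))// (splitr e) ltrD//.
    by rewrite distrC hr//= (lt_le_trans hs')// ler_pdivrMr// ler_peMr ?ler1n// ltW.
  apply: hr => /=; rewrite -(subrKA s') (splitr r) (le_lt_trans (ler_normD _ _))// ltrD//.
  exact: lt_trans ht hu.
move=> r /= r0 hr; exists (r / 2); first by rewrite divr_gt0.
move=> s t sab; apply: (hr (r / 2)) => //=.
- rewrite sub0r normrN gtr0_norm ?divr_gt0// ltr_pdivrMr// ltr_pMr//.
  by rewrite (_ : 1 = 1%:R)// ltr_nat.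
- by rewrite divr_gt0.
Qed.

End heine.

Section wavelets1.
Context (R : realType) (d : nat) (w : wavelets R) (S J0 : nat).
Hypotheses (d_gt0 : (0 < d)%N) (w_CDV : is_CDV_basis d w S J0).

Lemma wgen_support : exists2 L : R, 0 < L & forall b e x, L < `|x| ->
  wgen (w := w) b e x = 0.
Proof.
have [L hL] := CDV_compact_support w_CDV.
exists (Num.max L 1); first by rewrite lt_max ltr01 orbT.
by move=> b e x; rewrite gt_max => /andP[Lx _]; exact: hL.
Qed.

Lemma wgen_bounded : exists2 B : R, 0 < B & forall b e x, `|wgen (w := w) b e x| <= B.
Proof.
have [L L0 hL] := wgen_support.
have B1 b e : exists2 B : R, 0 <= B & forall x, `|wgen (w := w) b e x| <= B.
  have cf : continuous (wgen (w := w) b e : R -> R) by exact: (CDV_continuous w_CDV).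
  have : {within `[- L, L], continuous (fun x => `|wgen (w := w) b e x|)}.
    apply: continuous_subspaceT => x; apply: continuous_comp; first exact: cf.
    exact: norm_continuous.
  have LL : - L <= L by lra.
  case/(EVT_max LL) => c _ hc; exists `|wgen (w := w) b e c| => // x.
  have [xL|Lx] := leP `|x| L; last by rewrite hL// normr0.
  by apply: hc; rewrite in_itv/= -ler_norml.
have Bb b : exists2 B : R, 0 <= B & forall e x, `|wgen (w := w) b e x| <= B.
  have [f f0 hf] : exists2 f : gen_index w -> R, (forall e, 0 <= f e) &
      forall e x, `|wgen (w := w) b e x| <= f e.
    have := @choice _ _ (fun e B => 0 <= B /\ forall x, `|wgen (w := w) b e x| <= B).
    case=> [e|f hf]; first by have [B B0 hB] := B1 b e; exists B.
    by exists f => e; case: (hf e).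
  exists (\sum_e f e); first by apply: sumr_ge0.
  move=> e x; apply: le_trans (hf e x) _; rewrite (bigD1 e)//= lerDl.
  by apply: sumr_ge0.
have [B0 B00 hB0] := Bb false; have [B2 B20 hB2] := Bb true.
exists (B0 + B2 + 1); first by rewrite ltr_wpDl// addr_ge0.
by case=> e x; [apply: le_trans (hB2 e x) _|apply: le_trans (hB0 e x) _]; lra.
Qed.

Lemma measurable_wave1 b j (i : 'I_(wnum w j)) : measurable_fun setT (wave1 b i).
Proof.
apply: measurable_funM; first exact: measurable_cst.
apply: measurableT_comp.
  apply: continuous_measurable_fun; exact: (CDV_continuous w_CDV).
apply: measurable_funB; last exact: measurable_cst.
by apply: measurable_funM; [exact: measurable_cst|exact: measurable_id].
Qed.

Lemma continuous_wave1 b j (i : 'I_(wnum w j)) : continuous (wave1 b i).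
Proof.
move=> x; pose aff (x : R) := 2 ^+ j * x - (wshift b i)%:~R.
have caff : {for x, continuous aff}.
  by apply: cvgB; [apply: cvgM; [exact: cvg_cst|exact: cvg_id]|exact: cvg_cst].
have cg : {for aff x, continuous (wgen (w := w) b (wtype b i) : R -> R)}.
  exact: (CDV_continuous w_CDV).
by apply: cvgM; [exact: cvg_cst|exact: continuous_comp caff cg].
Qed.

Lemma bmeas_wave1 b j (i : 'I_(wnum w j)) : bmeas (wave1 b i).
Proof.
split; first exact: measurable_wave1.
have [B B0 hB] := wgen_bounded; exists (Num.sqrt (2 ^+ j) * B) => x.
by rewrite normrM ger0_norm// ler_wpM2l.
Qed.

Lemma bmeas_wave (o : orient d) j (m : loc d w j) : bmeas (wave o m).
Proof. by apply: bmeas_prod => i; apply: bmeas_tnth; exact: bmeas_wave1. Qed.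

Lemma cmeas_bmeas (f : d.-tuple R -> R) : bmeas f -> cmeas f.
Proof. by move=> bf; apply: bmeas_comp bf; exact: measurable_retract. Qed.

Lemma cmeas_wave (o : orient d) j (m : loc d w j) : cmeas (wave o m).
Proof. by apply: cmeas_bmeas; exact: bmeas_wave. Qed.

(** The type and the shift determine the function: two indices sharing them would
    violate orthonormality. *)
Lemma wave1_inj b j (i i' : 'I_(wnum w j)) : (J0 <= j)%N ->
  wtype b i = wtype b i' -> wshift b i = wshift b i' -> i = i'.
Proof.
move=> J0j et es; apply/eqP/negPn/negP => ii'.
pose o : orient d := [ffun=> b].
pose m : loc d w j := [ffun=> i].
pose k0 : 'I_d := Ordinal d_gt0.
pose m' : loc d w j := [ffun k => if k == k0 then i' else i].
have mm' : m != m'.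
  by apply/negP => /eqP/ffunP/(_ k0); rewrite !ffunE eqxx => /eqP; exact/negP.
have wmm' : wave o m = wave o m'.
  apply/funext => x; apply: eq_bigr => k _; rewrite !ffunE; case: eqP => // _.
  by rewrite /wave1 et es.
have : inner (wave o m) (wave o m) = inner (wave o m) (wave o m') by rewrite -wmm'.
case: (boolP b) => bb; last first.
  have -> : o = orient0 d by apply/ffunP => k; rewrite !ffunE; exact/negbTE.
  rewrite !(CDV_Phi_orthonormal w_CDV)// eqxx (negbTE mm') => /eqP.
  by rewrite oner_eq0.
have o0 : o != orient0 d.
  by apply/negP => /eqP/ffunP/(_ k0); rewrite !ffunE bb.
rewrite !(CDV_Psi_orthonormal w_CDV)// !eqxx (negbTE mm') => /eqP.
by rewrite oner_eq0.
Qed.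

(** The functions which do not vanish at t have their shift within L of 2^j
   t. Their types and shifts, which determine them, range over a set of bounded
   size. *)
Lemma wave1_overlap : exists N0 : nat, forall b j t, (J0 <= j)%N ->
  (#|[pred i : 'I_(wnum w j) | wave1 b i t != 0%R]| <= N0)%N.
Proof.
have [L L0 hL] := wgen_support.
pose K := `|Num.floor (2 * L + 1)|.+1%N.
exists (#|{: gen_index w * 'I_K}|)%N => b j t J0j.
pose f0 := Num.floor (2 ^+ j * t - L).
pose g (i : 'I_(wnum w j)) : gen_index w * 'I_K :=
  (wtype b i, inord `|wshift b i - f0|%N).
set A := [pred i | _].
have hA i : i \in A -> f0 <= wshift b i /\ wshift b i - f0 <= Num.floor (2 * L + 1).
  rewrite inE => wi.
  have : `|2 ^+ j * t - (wshift b i)%:~R| <= L.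
    by rewrite leNgt; apply/negP => /hL h; move: wi; rewrite /wave1 h mulr0 eqxx.
  rewrite ler_norml => /andP[h1 h2].
  have f1 : f0%:~R <= 2 ^+ j * t - L by exact: floor_le.
  have f2 : 2 ^+ j * t - L < (f0 + 1)%:~R by exact: floorD1_gt.
  rewrite intrD in f2; split.
    by rewrite -(ler_int R); lra.
  by rewrite floor_ge_int// rmorphB/=; lra.
have ginj : {in A &, injective g}.
  move=> i i' /hA[a1 a2] /hA[b1 b2] [e1 e2]; apply: wave1_inj e1 _ => //.
  have bd s : f0 <= s -> s - f0 <= Num.floor (2 * L + 1) -> (`|s - f0| < K)%N.
    move=> s1 s2; rewrite ltnS -lez_nat !gez0_abs//; last by rewrite subr_ge0.
    by apply: le_trans s2; rewrite subr_ge0.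
  move/(congr1 (@nat_of_ord _)): e2; rewrite !inordK ?bd// => /(congr1 Posz).
  by rewrite !gez0_abs ?subr_ge0// => /addIr.
by rewrite -(card_in_imset ginj) max_card.
Qed.

End wavelets1.

(** * Localisation of the projection kernel *)

Section near.
Context (R : realType) (d : nat).

(** A product over the coordinates, so that its expectation factorises. *)
Definition near_ind (L : R) j (y x : d.-tuple R) : R :=
  \prod_(i < d) \1_[set u | `|u - tnth y i| <= L / 2 ^+ j] (tnth x i).

Lemma measurable_ballr (a r : R) : measurable [set u : R | `|u - a| <= r].
Proof.
rewrite (_ : [set u | _] = `[a - r, a + r]%classic); first exact: measurable_itv.
by apply/seteqP; split=> u /=; rewrite in_itv/= ler_distl.
Qed.

Lemma bmeas_near_ind L j y : bmeas (near_ind L j y).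
Proof.
apply: bmeas_prod => i; apply: bmeas_tnth; apply: bmeas_indic.
exact: measurable_ballr.
Qed.

Lemma near_indP L j y x :
  near_ind L j y x = [forall i, `|tnth x i - tnth y i| <= L / 2 ^+ j]%:R.
Proof.
case: (boolP [forall i, _]) => [/forallP h|].
  by rewrite /near_ind big1// => i _; rewrite indicE mem_set//=; exact: h.
rewrite negb_forall => /existsP[i hi].
by rewrite /near_ind (bigD1 i)//= indicE memNset ?mul0r//=; exact/negP.
Qed.

Lemma near_ind01 L j y x : near_ind L j y x = 0 \/ near_ind L j y x = 1.
Proof. by rewrite near_indP; case: [forall i, _]; [right|left]. Qed.

(** Written in the form which the moments of nested counts require. *)
Lemma near_ind_mono L j j' y x : 0 <= L -> (j <= j')%N ->
  near_ind L j' y x = 0 \/ near_ind L j' y x = 1 /\ near_ind L j y x = 1.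
Proof.
move=> L0 jj'; rewrite !near_indP; case: (boolP [forall i, _ <= L / 2 ^+ j']) => h; [right|by left].
split=> //; suff -> : [forall i, `|tnth x i - tnth y i| <= L / 2 ^+ j] by [].
apply/forallP => i; move/forallP/(_ i): h => /le_trans; apply.
rewrite ler_wpM2l// lef_pV2 ?posrE ?exprn_gt0//.
by rewrite ler_weXn2l// ler1n.
Qed.

Lemma Ex_near_ind L j y : 0 <= L ->
  Ex (unif_cube R d) (near_ind L j y) <= (2 * L) ^+ d / 2 ^+ (j * d).
Proof.
move=> L0; rewrite /unif_cube /near_ind.
rewrite (Ex_iid_prod _ (f := fun i : 'I_d => \1_[set u | `|u - tnth y i| <= L / 2 ^+ j])); last first.
  by move=> i; apply: bmeas_indic; exact: measurable_ballr.
rewrite exprM -expr_div_n.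
have -> : (2 * L / 2 ^+ j) ^+ d = \prod_(i < d) (2 * L / 2 ^+ j).
  by rewrite prodr_const card_ord.
apply: ler_prod => i _; apply/andP; split; first by apply: Ex_ge0 => u; rewrite indicE.
by rewrite -mulrA; apply: unif01_ball; rewrite divr_ge0// exprn_ge0.
Qed.

End near.

Section kernel_bounds.
Context (R : realType) (d : nat) (w : wavelets R) (S J0 : nat).
Hypotheses (d_gt0 : (0 < d)%N) (w_CDV : is_CDV_basis d w S J0).

(** At any t a bounded number of terms are nonzero, each at most of order
   2^(j/2) B. *)
Lemma wave1_sum_le : exists2 C : R, 0 < C & forall b j (f : 'I_(wnum w j) -> R) t B,
  (J0 <= j)%N -> 0 <= B -> (forall i, `|f i| <= B) ->
  \sum_i `|wave1 b i t * f i| <= C * Num.sqrt (2 ^+ j) * B.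
Proof.
have [N0 hN] := wave1_overlap d_gt0 w_CDV.
have [G G0 hG] := wgen_bounded w_CDV.
exists (N0%:R * G + 1); first by rewrite ltr_wpDl// mulr_ge0// ltW.
move=> b j f t B J0j B0 hB.
rewrite (bigID (fun i => wave1 b i t != 0))/= [X in _ + X]big1 ?addr0; last first.
  by move=> i; rewrite negbK => /eqP ->; rewrite mul0r normr0.
have c0 : 0 <= Num.sqrt (2 ^+ j) * G :> R by rewrite mulr_ge0 ?sqrtr_ge0// ltW.
apply: (@le_trans _ _ (\sum_(i | wave1 b i t != 0) Num.sqrt (2 ^+ j) * G * B)).
  apply: ler_sum => i _; rewrite normrM ler_pM//.
  by rewrite normrM ger0_norm ?sqrtr_ge0// ler_wpM2l ?sqrtr_ge0.
rewrite sumr_const; apply: (@le_trans _ _ (N0%:R * (Num.sqrt (2 ^+ j) * G * B))).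
  rewrite -[leLHS]mulr_natl; apply: ler_wpM2r; first by rewrite mulr_ge0.
  by rewrite ler_nat; exact: hN.
rewrite -subr_ge0 [X in 0 <= X](_ : _ = Num.sqrt (2 ^+ j) * B); last by ring.
by rewrite mulr_ge0 ?sqrtr_ge0.
Qed.

Lemma wave1_le : exists2 C : R, 0 < C & forall b j (i : 'I_(wnum w j)) t,
  `|wave1 b i t| <= C * Num.sqrt (2 ^+ j).
Proof.
have [G G0 hG] := wgen_bounded w_CDV; exists G => // b j i t.
by rewrite normrM ger0_norm ?sqrtr_ge0// mulrC ler_wpM2r ?sqrtr_ge0.
Qed.

Definition kernel1 j (s t : R) : R := \sum_(i < wnum w j) wave1 false i s * wave1 false i t.

(** A nonzero term forces both points into the support of the same basis
   function, hence within 2 L / 2^j of each other. *)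
Lemma kernel1_le : exists2 C : R, 0 < C & exists2 L : R, 0 < L & forall j s t,
  (J0 <= j)%N ->
  `|kernel1 j s t| <= C * 2 ^+ j * \1_[set u | `|u - t| <= L / 2 ^+ j] s.
Proof.
have [C1 C10 h1] := wave1_sum_le; have [C2 C20 h2] := wave1_le.
have [L L0 hL] := wgen_support w_CDV.
exists (C1 * C2); first by rewrite mulr_gt0.
exists (2 * L) => [|j s t J0j]; first by rewrite mulr_gt0.
have p2 : 0 < 2 ^+ j :> R by rewrite exprn_gt0.
case: (boolP (`|s - t| <= 2 * L / 2 ^+ j)) => st.
  rewrite indicE mem_set// mulr1.
  apply: le_trans (ler_norm_sum _ _ _) _.
  apply: le_trans (h1 _ _ _ _ (C2 * Num.sqrt (2 ^+ j)) J0j _ _) _ => //.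
    by rewrite mulr_ge0 ?sqrtr_ge0// ltW.
  rewrite mulrACA -expr2 sqr_sqrtr//; exact: ltW.
rewrite indicE memNset ?mulr0; last exact/negP.
rewrite /kernel1 big1 ?normr0// => i _.
apply/eqP; rewrite mulf_eq0; apply/negPn/negP; rewrite negb_or => /andP[hs ht].
have bd u : wave1 false i u != 0 -> `|2 ^+ j * u - (wshift false i)%:~R| <= L.
  by move=> wu; rewrite leNgt; apply/negP => /hL h; move: wu; rewrite /wave1 h mulr0 eqxx.
move/negP: st; apply; rewrite ler_pdivlMr// -[2 ^+ j]gtr0_norm// -normrM.
have := bd _ hs; have := bd _ ht; rewrite !ler_norml => /andP[a1 a2] /andP[b1 b2].
by apply/andP; split; lra.
Qed.

(** The basis consists of tensor products. *)
Lemma proj_kernelE j (x y : d.-tuple R) :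
  proj_kernel w j x y = \prod_(i < d) kernel1 j (tnth x i) (tnth y i).
Proof.
rewrite /kernel1 bigA_distr_bigA/=; apply: eq_bigr => m _.
by rewrite /Phi /wave -big_split/=; apply: eq_bigr => i _; rewrite ffunE.
Qed.

Lemma proj_kernel_le : exists2 C : R, 0 < C & exists2 L : R, 0 < L & forall j (x y : d.-tuple R),
  (J0 <= j)%N -> `|proj_kernel w j x y| <= C * 2 ^+ (j * d) * near_ind L j y x.
Proof.
have [C C0 [L L0 h]] := kernel1_le.
exists (C ^+ d); first by rewrite exprn_gt0.
exists L => // j x y J0j; rewrite proj_kernelE normr_prod exprM -exprMn.
have -> : (C * 2 ^+ j) ^+ d = \prod_(i < d) (C * 2 ^+ j).
  by rewrite prodr_const card_ord.
rewrite -big_split/=; apply: ler_prod => i _.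
by rewrite normr_ge0/=; exact: h.
Qed.

(** With this orientation all factors are one-dimensional wavelets, so that
   the sum over all locations is a product over the coordinates (Psi_sumE). *)
Definition orient1 : orient d := [ffun=> true].

Lemma orient1_neq0 : orient1 != orient0 d.
Proof. by apply/negP => /eqP/ffunP/(_ (Ordinal d_gt0)); rewrite !ffunE. Qed.

Lemma Psi_sumE j (x : d.-tuple R) :
  \sum_(m : loc d w j) Psi orient1 m x = \prod_(i < d) \sum_(k < wnum w j) wave1 true k (tnth x i).
Proof.
rewrite bigA_distr_bigA/=; apply: eq_bigr => m _.
by apply: eq_bigr => i _; rewrite ffunE.
Qed.

(** The wavelets of one level overlap boundedly: up to a constant, their sum
   is no larger than one of them. *)
Lemma Psi_sum_le : exists2 C : R, 0 < C & forall j (x : d.-tuple R), (J0 <= j)%N ->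
  `|\sum_(m : loc d w j) Psi orient1 m x| <= C * Num.sqrt (2 ^+ j) ^+ d.
Proof.
have [C C0 h] := wave1_sum_le; exists (C ^+ d); first by rewrite exprn_gt0.
move=> j x J0j; rewrite Psi_sumE normr_prod -exprMn.
have -> : (C * Num.sqrt (2 ^+ j)) ^+ d = \prod_(i < d) (C * Num.sqrt (2 ^+ j)).
  by rewrite prodr_const card_ord.
apply: ler_prod => i _; rewrite normr_ge0/=.
apply: le_trans (ler_norm_sum _ _ _) _.
have := h true j (fun=> 1) (tnth x i) 1 J0j ler01; rewrite mulr1.
under eq_bigr do rewrite mulr1.
by apply => k; rewrite normr1.
Qed.

Lemma Psi_sum_unif_continuous j :
  unif_continuous_cube (fun x : d.-tuple R => \sum_(m : loc d w j) Psi orient1 m x).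
Proof.
pose g (t : R) := \sum_(k < wnum w j) wave1 true k t.
have cg : continuous g.
  by apply: continuous_big => [|k _]; [exact: add_continuous|exact: (continuous_wave1 w_CDV)].
have bg : exists2 B, 0 < B & forall t, `|g t| <= B.
  have [B B0 hB] : exists2 B, 0 <= B & forall t, `|g t| <= B.
    by apply: bmeas_ub; apply: bmeas_sum => k; exact: (bmeas_wave1 w_CDV).
  exists (B + 1); first by rewrite ltr_wpDl.
  by move=> t; apply: le_trans (hB t) _; rewrite lerDl.
have [B B0 hB] := bg.
suff H (s : seq 'I_d) e : 0 < e -> exists2 r : R, 0 < r & forall x y : d.-tuple R,
    cube x -> cube y -> (forall i, `|tnth x i - tnth y i| < r) ->
    `|\prod_(i <- s) g (tnth x i) - \prod_(i <- s) g (tnth y i)| < e.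
  move=> e e0; have [r r0 hr] := H (index_enum 'I_d) e e0; exists r => // x y cx cy xy.
  by rewrite !Psi_sumE; exact: hr.
have bP s' (x : d.-tuple R) : `|\prod_(i <- s') g (tnth x i)| <= B ^+ size s'.
  elim: s' => [|i s' IH]; first by rewrite big_nil normr1 expr0.
  by rewrite big_cons normrM exprS ler_pM.
elim: s e => [|i s IH] e e0.
  by exists 1 => // x y _ _ _; rewrite !big_nil subrr normr0.
have Bs : 0 < B ^+ size s by rewrite exprn_gt0.
have [r1 r10 h1] := @segment_unif_continuous R g 0 1 _ cg (divr_gt0 (divr_gt0 e0 (ltr0Sn _ 1)) Bs).
have [r2 r20 h2] := IH _ (divr_gt0 (divr_gt0 e0 (ltr0Sn _ 1)) B0).
exists (Num.min r1 r2); first by rewrite lt_min r10.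
move=> x y cx cy xy; rewrite !big_cons.
set px := \prod_(_ <- s) g (tnth x _); set py := \prod_(_ <- s) g (tnth y _).
rewrite (_ : _ - _ = (g (tnth x i) - g (tnth y i)) * px + g (tnth y i) * (px - py)); last by ring.
apply: le_lt_trans (ler_normD _ _) _; rewrite [ltRHS]splitr !normrM.
have xy1 k : `|tnth x k - tnth y k| < r1 by apply: lt_le_trans (xy k) _; rewrite ge_min lexx.
have xy2 k : `|tnth x k - tnth y k| < r2 by apply: lt_le_trans (xy k) _; rewrite ge_min lexx orbT.
have k1 := h1 _ _ (cx i) (xy1 i); have k2 := h2 _ _ cx cy xy2.
apply: ltrD.
  apply: (@le_lt_trans _ _ (`|g (tnth x i) - g (tnth y i)| * B ^+ size s)).
    by rewrite ler_wpM2l// bP.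
  by rewrite -ltr_pdivlMr.
apply: (@le_lt_trans _ _ (B * `|px - py|)); first by rewrite ler_wpM2r// hB.
by rewrite mulrC -ltr_pdivlMr.
Qed.

End kernel_bounds.

(** * Projections on the approximation spaces *)

Section cube_calculus.
Context (R : realType) (d : nat).
Implicit Types (f g h : d.-tuple R -> R).

Lemma cmeas_cst (c : R) : @cmeas R d (fun=> c). Proof. exact: bmeas_cst. Qed.

Lemma cmeasD f g : cmeas f -> cmeas g -> cmeas (fun x => f x + g x).
Proof. exact: bmeasD. Qed.

Lemma cmeasB f g : cmeas f -> cmeas g -> cmeas (fun x => f x - g x).
Proof. exact: bmeasB. Qed.

Lemma cmeasM f g : cmeas f -> cmeas g -> cmeas (fun x => f x * g x).
Proof. exact: bmeasM. Qed.

Lemma cmeasX f n : cmeas f -> cmeas (fun x => f x ^+ n).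
Proof. exact: bmeasX. Qed.

Lemma cmeas_sum (I : Type) (r : seq I) (Q : pred I) (F : I -> d.-tuple R -> R) :
  (forall i, cmeas (F i)) -> cmeas (fun x => \sum_(i <- r | Q i) F i x).
Proof. by move=> cF; apply: bmeas_sum => i; exact: cF. Qed.

Lemma EcD f g : cmeas f -> cmeas g -> Ec (fun x => f x + g x) = Ec f + Ec g.
Proof. exact: ExD. Qed.

Lemma EcB f g : cmeas f -> cmeas g -> Ec (fun x => f x - g x) = Ec f - Ec g.
Proof. exact: ExB. Qed.

Lemma EcZl c f : cmeas f -> Ec (fun x => c * f x) = c * Ec f.
Proof. exact: ExZl. Qed.

Lemma Ec_sum (I : Type) (r : seq I) (Q : pred I) (F : I -> d.-tuple R -> R) :
  (forall i, cmeas (F i)) ->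
  Ec (fun x => \sum_(i <- r | Q i) F i x) = \sum_(i <- r | Q i) Ec (F i).
Proof. by move=> cF; apply: Ex_sum => i; exact: cF. Qed.

Lemma eq_Ec f g : (forall x, cube x -> f x = g x) -> Ec f = Ec g.
Proof. by move=> fg; apply: eq_Ex => x; apply: fg; exact: retract_cube. Qed.

Lemma Ec_ge0 f : (forall x, 0 <= f x) -> 0 <= Ec f.
Proof. by move=> f0; apply: Ex_ge0 => x; exact: f0. Qed.

Lemma eq_cmeas f g : (forall x, cube x -> f x = g x) -> cmeas f -> cmeas g.
Proof.
move=> fg; rewrite /cmeas (_ : f \o _ = g \o @retract R d)//.
by apply/funext => x; apply: fg; exact: retract_cube.
Qed.

(** This agrees with inner on bounded functions (inner_Ec); it is phrased
   through Ec to inherit the calculus of expectations. *)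
Definition ip f g : R := Ec (fun x => f x * g x).

Lemma ipC f g : ip f g = ip g f.
Proof. by apply: eq_Ec => x _; rewrite mulrC. Qed.

Lemma eq_ipl f f' g : (forall x, cube x -> f x = f' x) -> ip f g = ip f' g.
Proof. by move=> ff'; apply: eq_Ec => x cx; rewrite ff'. Qed.

Lemma ipDl f g h : cmeas f -> cmeas g -> cmeas h ->
  ip (fun x => f x + g x) h = ip f h + ip g h.
Proof.
move=> cf cg ch; rewrite -EcD; [|exact: cmeasM..].
by apply: eq_Ec => x _; rewrite mulrDl.
Qed.

Lemma ipBl f g h : cmeas f -> cmeas g -> cmeas h ->
  ip (fun x => f x - g x) h = ip f h - ip g h.
Proof.
move=> cf cg ch; rewrite -EcB; [|exact: cmeasM..].
by apply: eq_Ec => x _; rewrite mulrBl.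
Qed.

Lemma ipZl c f h : cmeas f -> cmeas h -> ip (fun x => c * f x) h = c * ip f h.
Proof.
move=> cf ch; rewrite -EcZl; last exact: cmeasM.
by apply: eq_Ec => x _; rewrite mulrA.
Qed.

Lemma ip_suml (I : Type) (r : seq I) (Q : pred I) (c : I -> R)
    (F : I -> d.-tuple R -> R) h :
  (forall i, cmeas (F i)) -> cmeas h ->
  ip (fun x => \sum_(i <- r | Q i) c i * F i x) h = \sum_(i <- r | Q i) c i * ip (F i) h.
Proof.
move=> cF ch.
transitivity (Ec (fun x => \sum_(i <- r | Q i) c i * (F i x * h x))).
  by apply: eq_Ec => x _; rewrite mulr_suml; apply: eq_bigr => i _; rewrite mulrA.
rewrite Ec_sum; first by apply: eq_bigr => i _; rewrite EcZl//; exact: cmeasM.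
by move=> i; apply: cmeasM; [exact: cmeas_cst|exact: cmeasM].
Qed.

Lemma ip_ge0 f : 0 <= ip f f.
Proof. by apply: Ec_ge0 => x; rewrite -expr2 sqr_ge0. Qed.

Lemma ip_cauchy_schwarz f g : cmeas f -> cmeas g -> ip f g ^+ 2 <= ip f f * ip g g.
Proof.
move=> cf cg; apply: le_trans (Ex_cauchy_schwarz _ cf cg) _.
by rewrite le_eqVlt; apply/orP; left; apply/eqP; congr (_ * _);
  apply: eq_Ex => x /=; rewrite expr2.
Qed.

End cube_calculus.

Section projections.
Context (R : realType) (d : nat) (w : wavelets R) (S J0 : nat).
Hypotheses (d_gt0 : (0 < d)%N) (w_CDV : is_CDV_basis d w S J0).
Implicit Types (f g h p b : d.-tuple R -> R).

Lemma cmeas_Phi j (m : loc d w j) : cmeas (Phi m).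
Proof. exact: (cmeas_wave w_CDV). Qed.

Lemma cmeas_Psi o j (m : loc d w j) : cmeas (Psi o m).
Proof. exact: (cmeas_wave w_CDV). Qed.

Lemma ip_Phi j (m m' : loc d w j) : (J0 <= j)%N -> ip (Phi m) (Phi m') = (m == m')%:R.
Proof.
move=> J0j; rewrite -(CDV_Phi_orthonormal w_CDV)// inner_Ec//; exact: cmeas_Phi.
Qed.

Lemma ip_Psi l o o' (m m' : loc d w l) : (J0 <= l)%N ->
  o != orient0 d -> o' != orient0 d ->
  ip (Psi o m) (Psi o' m') = ((o == o') && (m == m'))%:R.
Proof.
move=> J0l o0 o0'; rewrite -(CDV_Psi_orthonormal w_CDV)// inner_Ec//; exact: cmeas_Psi.
Qed.

Lemma ip_Psi_levels l l' o o' (m : loc d w l) (m' : loc d w l') :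
  (J0 <= l)%N -> (J0 <= l')%N -> l != l' -> o != orient0 d -> o' != orient0 d ->
  ip (Psi o m) (Psi o' m') = 0.
Proof.
move=> J0l J0l' ll' o0 o0'; rewrite -(CDV_Psi_orthogonal_levels w_CDV J0l J0l' ll' o0 o0' m m').
by rewrite inner_Ec//; exact: cmeas_Psi.
Qed.

Lemma wavelet_span_orth j f l o (m : loc d w l) : (J0 <= j)%N -> (j <= l)%N ->
  o != orient0 d -> wavelet_span w J0 j f -> ip f (Psi o m) = 0.
Proof.
move=> J0j jl o0 [c [e fE]]; have J0l := leq_trans J0j jl.
rewrite (eq_ipl _ fE) ipDl; [| |by do 3 (apply: cmeas_sum => ?); apply: cmeasM;
  [exact: cmeas_cst|exact: cmeas_Psi]|exact: cmeas_Psi]; last first.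
  by apply: cmeas_sum => m'; apply: cmeasM; [exact: cmeas_cst|exact: cmeas_Phi].
rewrite ip_suml; [|move=> m'; exact: cmeas_Phi|exact: cmeas_Psi].
rewrite big1 ?add0r; last first.
  move=> m' _; rewrite -[ip _ _]inner_Ec; [|exact: cmeas_Phi|exact: cmeas_Psi].
  by rewrite (CDV_Phi_Psi_orthogonal w_CDV)// mulr0.
pose E l' x := \sum_(o' | o' != orient0 d) \sum_(m' : loc d w l') e l' o' m' * Psi o' m' x.
have cE l' : cmeas (E l').
  by do 2 (apply: cmeas_sum => ?); apply: cmeasM; [exact: cmeas_cst|exact: cmeas_Psi].
transitivity (ip (fun x => \sum_(J0 <= l' < j | (J0 <= l' < j)%N) 1 * E l' x) (Psi o m)).
  by apply: eq_ipl => x _; rewrite big_nat; apply: eq_bigr => l' _; rewrite mul1r.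
rewrite ip_suml//; last exact: cmeas_Psi.
rewrite big1// => l' /andP[J0l' l'j]; rewrite mul1r.
transitivity (ip (fun x => \sum_(o' | o' != orient0 d)
    1 * \sum_(m' : loc d w l') e l' o' m' * Psi o' m' x) (Psi o m)).
  by apply: eq_ipl => x _; apply: eq_bigr => o' _; rewrite mul1r.
rewrite ip_suml; [|move=> o'; apply: cmeas_sum => ?; apply: cmeasM;
  [exact: cmeas_cst|exact: cmeas_Psi]|exact: cmeas_Psi].
rewrite big1// => o' o0'; rewrite mul1r ip_suml; [|move=> ?; exact: cmeas_Psi|exact: cmeas_Psi].
rewrite big1// => m' _; rewrite ip_Psi_levels ?mulr0//.
by rewrite ltn_eqF// (leq_trans l'j).
Qed.

Lemma Vspace_Phi j (m : loc d w j) : Vspace w j (Phi m).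
Proof.
exists (fun m' => (m' == m)%:R) => x _; rewrite (bigD1 m)//= eqxx mul1r.
by rewrite big1 ?addr0// => m' /negbTE ->; rewrite mul0r.
Qed.

Lemma wavelet_span_mono j j' f : (j <= j')%N ->
  wavelet_span w J0 j f -> wavelet_span w J0 j' f.
Proof.
move=> jj' [c [e fE]]; exists c, (fun l o m => if (l < j)%N then e l o m else 0).
move=> x cx; rewrite fE//; congr (_ + _).
pose E l : R := \sum_(o | o != orient0 d) \sum_(m : loc d w l) e l o m * Psi o m x.
transitivity (\sum_(J0 <= l < j | (l < j)%N) E l).
  by rewrite big_nat_cond [RHS]big_nat_cond; apply: eq_bigl => l; case: (l < j)%N; rewrite ?andbT ?andbF.
have [J0j|jJ0] := leqP J0 j; last first.
  rewrite big_geq ?(ltnW jJ0)// big_nat big1// => l /andP[J0l _].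
  rewrite big1// => o _; rewrite big1// => m _.
  by rewrite ltnNge (leq_trans (ltnW jJ0) J0l) mul0r.
rewrite (big_cat_nat J0j jj')/= [X in _ = _ + X]big1_seq ?addr0; last first.
  move=> l /andP[_]; rewrite mem_index_iota => /andP[jl _].
  by rewrite big1// => o _; rewrite big1// => m _; rewrite ltnNge jl mul0r.
rewrite big_nat_cond [RHS]big_nat; apply: eq_big => [l|l /andP[_ lj]].
  by case: (l < j)%N; rewrite ?andbT ?andbF.
by apply: eq_bigr => o _; apply: eq_bigr => m _; rewrite lj.
Qed.

Lemma Vspace_mono j j' f : (J0 <= j)%N -> (j <= j')%N -> Vspace w j f -> Vspace w j' f.
Proof.
move=> J0j jj'; rewrite !(CDV_multiresolution w_CDV)//; last exact: leq_trans jj'.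
exact: wavelet_span_mono.
Qed.

(** Orthogonality is given for the scaling functions at level J0 only; those
   at level j are combinations of these and of the wavelets below level j. *)
Lemma ip_Phi_Psi j l o (m : loc d w j) (m' : loc d w l) : (J0 <= j)%N -> (j <= l)%N ->
  o != orient0 d -> ip (Phi m) (Psi o m') = 0.
Proof.
move=> J0j jl o0; apply: (wavelet_span_orth (j := j)) => //.
rewrite -(CDV_multiresolution w_CDV)//; exact: Vspace_Phi.
Qed.

Lemma Vspace_coef j f : (J0 <= j)%N -> Vspace w j f ->
  forall x, cube x -> f x = \sum_(m : loc d w j) ip f (Phi m) * Phi m x.
Proof.
move=> J0j [c fE] x cx; rewrite fE//; apply: eq_bigr => m _; congr (_ * _).
rewrite (eq_ipl _ fE) ip_suml; [|move=> ?; exact: cmeas_Phi|exact: cmeas_Phi].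
rewrite (bigD1 m)//= ip_Phi// eqxx mulr1 big1 ?addr0// => m' mm'.
by rewrite ip_Phi// (negbTE mm') mulr0.
Qed.

(** The inner product of the projections of p and b on V_j. *)
Definition dotp j p b : R := \sum_(m : loc d w j) ip p (Phi m) * ip b (Phi m).

(** Projecting h on V_j does not change its inner product with a function of
   V_j. *)
Lemma Vspace_dotp j f h : (J0 <= j)%N -> cmeas h -> Vspace w j f ->
  ip f h = dotp j f h.
Proof.
move=> J0j ch Vf; rewrite (eq_ipl _ (Vspace_coef J0j Vf)).
rewrite ip_suml//; last by move=> ?; exact: cmeas_Phi.
by apply: eq_bigr => m _; rewrite (ipC h).
Qed.

Definition proj j p x : R := \sum_(m : loc d w j) ip p (Phi m) * Phi m x.

Lemma Vspace_proj j p : Vspace w j (proj j p). Proof. by eexists. Qed.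

Lemma cmeas_proj j p : cmeas (proj j p).
Proof.
by apply: cmeas_sum => m; apply: cmeasM; [exact: cmeas_cst|exact: cmeas_Phi].
Qed.

Lemma ip_proj j p b : cmeas b -> ip (proj j p) b = dotp j p b.
Proof.
move=> cb; rewrite ip_suml//; last by move=> ?; exact: cmeas_Phi.
by apply: eq_bigr => m _; rewrite (ipC b).
Qed.

Lemma ip_proj_Phi j p (m : loc d w j) : (J0 <= j)%N -> ip (proj j p) (Phi m) = ip p (Phi m).
Proof.
move=> J0j; rewrite ip_suml; [|move=> ?; exact: cmeas_Phi|exact: cmeas_Phi].
rewrite (bigD1 m)//= ip_Phi// eqxx mulr1 big1 ?addr0// => m' mm'.
by rewrite ip_Phi// (negbTE mm') mulr0.
Qed.

(** Bessel's inequality: the squared norm of p - proj j p is nonnegative. *)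
Lemma dotp_le j p : (J0 <= j)%N -> cmeas p -> dotp j p p <= ip p p.
Proof.
move=> J0j cp; have cq := cmeas_proj j p.
have := ip_ge0 (fun x => p x - proj j p x).
have cpq : cmeas (fun x => p x - proj j p x) by exact: cmeasB.
rewrite ipBl// ![ip _ (fun x => _ - _)]ipC !ipBl// (ipC p (proj j p)).
rewrite [ip (proj j p) (proj j p)](_ : _ = dotp j p p); first by rewrite !ip_proj//; lra.
rewrite ip_proj//; apply: eq_bigr => m _; by rewrite ip_proj_Phi.
Qed.

Lemma dotp_cauchy_schwarz j p b : (J0 <= j)%N -> cmeas p -> cmeas b ->
  dotp j p b ^+ 2 <= ip p p * ip b b.
Proof.
move=> J0j cp cb; rewrite -ip_proj//.
apply: le_trans (ip_cauchy_schwarz (cmeas_proj j p) cb) _.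
rewrite ler_wpM2r ?ip_ge0// ip_proj ?(dotp_le J0j cp)//; last exact: cmeas_proj.
apply: le_trans (dotp_le J0j cp); rewrite le_eqVlt; apply/orP; left; apply/eqP.
by apply: eq_bigr => m _; rewrite ip_proj_Phi.
Qed.

(** V_(j+1) is the orthogonal sum of V_j and of the span of the wavelets at
   level j, so the projection of p on V_(j+1) is the sum r of its projections on
   both. *)
Lemma dotpS j p b : (J0 <= j)%N -> cmeas p -> cmeas b ->
  dotp j.+1 p b = dotp j p b +
    \sum_(o | o != orient0 d) \sum_(m : loc d w j) ip p (Psi o m) * ip b (Psi o m).
Proof.
move=> J0j cp cb; have J0j1 : (J0 <= j.+1)%N by exact: leq_trans (leqnSn j).
pose W x := \sum_(o | o != orient0 d) \sum_(m : loc d w j) ip p (Psi o m) * Psi o m x.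
have cW : cmeas W.
  by do 2 (apply: cmeas_sum => ?); apply: cmeasM; [exact: cmeas_cst|exact: cmeas_Psi].
have ipW h : cmeas h -> ip W h =
    \sum_(o | o != orient0 d) \sum_(m : loc d w j) ip p (Psi o m) * ip h (Psi o m).
  move=> ch; transitivity (ip (fun x => \sum_(o | o != orient0 d)
      1 * \sum_(m : loc d w j) ip p (Psi o m) * Psi o m x) h).
    by apply: eq_ipl => x _; apply: eq_bigr => o _; rewrite mul1r.
  rewrite ip_suml//; last by move=> o; apply: cmeas_sum => m; apply: cmeasM;
    [exact: cmeas_cst|exact: cmeas_Psi].
  apply: eq_bigr => o _; rewrite mul1r ip_suml//; last by move=> m; exact: cmeas_Psi.
  by apply: eq_bigr => m _; rewrite (ipC h).
pose r x := proj j p x + W x.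
have cr : cmeas r by apply: cmeasD => //; exact: cmeas_proj.
have rPhi (m : loc d w j) : ip r (Phi m) = ip p (Phi m).
  rewrite ipDl//; [|exact: cmeas_proj|exact: cmeas_Phi].
  rewrite ip_proj_Phi// ipW; last exact: cmeas_Phi.
  by rewrite big1 ?addr0// => o o0; rewrite big1// => m' _; rewrite ip_Phi_Psi// mulr0.
have rPsi o (m : loc d w j) : o != orient0 d -> ip r (Psi o m) = ip p (Psi o m).
  move=> o0; rewrite ipDl//; [|exact: cmeas_proj|exact: cmeas_Psi].
  rewrite ip_proj; last exact: cmeas_Psi.
  rewrite {1}/dotp big1 ?add0r; last first.
    by move=> m' _; rewrite (ipC (Psi _ _)) ip_Phi_Psi// mulr0.
  rewrite ipW; last exact: cmeas_Psi.
  rewrite (bigD1 o)//= (bigD1 m)//= ip_Psi// !eqxx/= mulr1.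
  rewrite big1 ?addr0; last by move=> m' mm'; rewrite ip_Psi// eqxx eq_sym (negbTE mm') mulr0.
  rewrite big1 ?addr0// => o' /andP[no0' oo']; rewrite big1// => m' _.
  by rewrite ip_Psi// eq_sym (negbTE oo') mulr0.
have rspan : wavelet_span w J0 j.+1 r.
  have := Vspace_proj j p; rewrite (CDV_multiresolution w_CDV)//.
  move=> [c [e pE]]; exists c, (fun l o m => if (l < j)%N then e l o m else ip p (Psi o m)).
  move=> x cx; rewrite /r pE// -addrA; congr (_ + _).
  rewrite big_nat_recr//=; congr (_ + _).
    rewrite big_nat [RHS]big_nat; apply: eq_bigr => l /andP[_ lj].
    by apply: eq_bigr => o _; apply: eq_bigr => m _; rewrite lj.
  by apply: eq_bigr => o _; apply: eq_bigr => m _; rewrite ltnn.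
have Vr : Vspace w j.+1 r by rewrite (CDV_multiresolution w_CDV).
(* The difference p - r is orthogonal to V_(j+1). *)
have coef g : Vspace w j.+1 g -> ip r g = ip p g.
  rewrite (CDV_multiresolution w_CDV)// => -[c [e gE]].
  pose v x := \sum_(m : loc d w J0) c m * Phi m x + \sum_(J0 <= l < j)
    \sum_(o | o != orient0 d) \sum_(m : loc d w l) e l o m * Psi o m x.
  pose u x := \sum_(o | o != orient0 d) \sum_(m : loc d w j) e j o m * Psi o m x.
  have Vv : Vspace w j v by rewrite (CDV_multiresolution w_CDV)//; exists c, e.
  have cu : cmeas u.
    by do 2 (apply: cmeas_sum => ?); apply: cmeasM; [exact: cmeas_cst|exact: cmeas_Psi].
  have cv : cmeas v.
    by apply: cmeasD; [apply: cmeas_sum => ?|do 3 (apply: cmeas_sum => ?)]; apply: cmeasM;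
      (exact: cmeas_cst || exact: cmeas_Psi || exact: cmeas_Phi).
  have guv x : cube x -> g x = v x + u x.
    by move=> cx; rewrite gE// big_nat_recr//= addrA.
  have ipu h : cmeas h -> ip u h = \sum_(o | o != orient0 d) \sum_(m : loc d w j) e j o m * ip h (Psi o m).
    move=> ch; transitivity (ip (fun x => \sum_(o | o != orient0 d)
        1 * \sum_(m : loc d w j) e j o m * Psi o m x) h).
      by apply: eq_ipl => x _; apply: eq_bigr => o _; rewrite mul1r.
    rewrite ip_suml//; last by move=> o; apply: cmeas_sum => m; apply: cmeasM;
      [exact: cmeas_cst|exact: cmeas_Psi].
    apply: eq_bigr => o _; rewrite mul1r ip_suml//; last by move=> m; exact: cmeas_Psi.
    by apply: eq_bigr => m _; rewrite (ipC h).
  rewrite !(ipC _ g) !(eq_ipl _ guv) (ipDl cv cu cr) (ipDl cv cu cp).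
  rewrite (Vspace_dotp J0j cr Vv) (Vspace_dotp J0j cp Vv) !ipu//.
  congr (_ + _); first by apply: eq_bigr => m _; rewrite rPhi.
  by apply: eq_bigr => o o0; apply: eq_bigr => m _; rewrite rPsi.
transitivity (ip r b).
  rewrite (Vspace_dotp J0j1 cb Vr); apply: eq_bigr => m _.
  by rewrite coef//; exact: Vspace_Phi.
by rewrite ipDl//; [rewrite ip_proj// ipW|exact: cmeas_proj].
Qed.

End projections.

(** * Approximation error and reproducing kernels *)

Section approximation.
Context (R : realType) (d : nat) (w : wavelets R) (S J0 : nat).
Hypotheses (d_gt0 : (0 < d)%N) (w_CDV : is_CDV_basis d w S J0).
Implicit Types (f g h p b : d.-tuple R -> R).

Lemma dotpBl j p g b : cmeas p -> cmeas g ->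
  dotp w j (fun x => p x - g x) b = dotp w j p b - dotp w j g b.
Proof.
move=> cp cg; rewrite -sumrB; apply: eq_bigr => m _.
by rewrite ipBl ?mulrBl//; exact: (cmeas_Phi w_CDV).
Qed.

(** By completeness some V_J contains g close to p; on g the projection
   changes nothing, and on p - g it does not increase the norm. *)
Lemma dotp_dense p b j0 e : cmeas p -> cmeas b -> 0 < e ->
  exists2 J, (J0 <= J)%N && (j0 <= J)%N & `|ip p b - dotp w J p b| <= e.
Proof.
move=> cp cb e0.
have k0 : 0 < ip b b + 1 by rewrite ltr_wpDl// ip_ge0.
(* Each of the two terms of the error has a square of at most del <b, b>,
   and so the square of the error is at most 4 del <b, b>. *)
pose del := e ^+ 2 / (4 * (ip b b + 1)).
have del0 : 0 < del by rewrite divr_gt0 ?exprn_gt0 ?mulr_gt0.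
have cpr : cmeas (p \o @retract R d).
  apply: (eq_cmeas _ cp) => x cx /=; by rewrite retract_id.
have [|J [g [gJ gdel]]] := CDV_complete w_CDV (bmeas_meas cp) _ del0.
  rewrite (integral_cubeE (f := fun x => (p \o @retract R d) x ^+ 2)) ?ltry//.
  exact: cmeasX.
pose J1 := maxn J (maxn J0 j0).
have J0J1 : (J0 <= J1)%N by rewrite /J1 !leq_max leqnn orbT.
have j0J1 : (j0 <= J1)%N by rewrite /J1 !leq_max leqnn !orbT.
exists J1; first by rewrite J0J1.
have Vg : Vspace w J1 g.
  rewrite (CDV_multiresolution w_CDV)//.
  by apply: wavelet_span_mono gJ; rewrite /J1 leq_max leqnn.
have cg : cmeas g.
  have [c gE] := Vg; apply: (@eq_cmeas _ _ (fun x => \sum_m c m * Phi m x)).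
    by move=> x cx; rewrite gE.
  by apply: cmeas_sum => m; apply: cmeasM; [exact: cmeas_cst|exact: (cmeas_Phi w_CDV)].
have cpg : cmeas (fun x => p x - g x) by exact: cmeasB.
have pgdel : ip (fun x => p x - g x) (fun x => p x - g x) < del.
  rewrite -lte_fin; apply: le_lt_trans gdel.
  rewrite (integral_cubeE (f := fun x => ((p \o @retract R d) x - g x) ^+ 2)); last first.
    by apply: cmeasX; exact: cmeasB.
  rewrite lee_fin le_eqVlt; apply/orP; left; apply/eqP; apply: eq_Ec => x cx /=.
  by rewrite retract_id// expr2.
have E : ip p b - dotp w J1 p b =
    ip (fun x => p x - g x) b - dotp w J1 (fun x => p x - g x) b.
  by rewrite ipBl// dotpBl// (Vspace_dotp w_CDV J0J1 cb Vg); ring.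
have e0' := ltW e0; rewrite E -ler_sqr ?nnegrE// (real_normK (num_real _)).
have h1 := ip_cauchy_schwarz cpg cb.
have h2 := dotp_cauchy_schwarz w_CDV J0J1 cpg cb.
set x := ip _ b in h1 *; set y := dotp _ _ _ _ in h2 *.
have hxy : (x - y) ^+ 2 <= 2 * x ^+ 2 + 2 * y ^+ 2.
  by have := sqrrD_le x (- y); rewrite sqrrN.
apply: le_trans hxy _.
set z := ip _ _ in pgdel h1 h2.
have z0 : 0 <= z by exact: ip_ge0.
have b0 : 0 <= ip b b by exact: ip_ge0.
have : z * (ip b b + 1) <= e ^+ 2 / 4.
  apply: (@le_trans _ _ (del * (ip b b + 1))); first by rewrite ler_pM2r// ltW.
  by rewrite /del invfM mulrA mulfVK// gt_eqF.
nra.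
Qed.

Lemma holder_coef gam M h l o (m : loc d w l) : holder_ball w J0 gam M h ->
  (J0 <= l)%N -> o != orient0 d ->
  `|ip h (Psi o m)| <= M / 2 `^ (l%:R * (gam + d%:R / 2)).
Proof.
move=> [uch hM] J0l o0; have ch := unif_continuous_cmeas uch.
have p0 : 0 < 2 `^ (l%:R * (gam + d%:R / 2)) :> R by rewrite powR_gt0.
rewrite ler_pdivlMr// mulrC -lee_fin; apply: le_trans hM.
apply: (@le_trans _ _ (ereal_sup [set u | exists l (o : orient d) (m : loc d w l),
       [/\ (J0 <= l)%N, o != orient0 d &
         u = (2 `^ (l%:R * (gam + d%:R / 2)) * `|inner h (Psi o m)|)%:E]]))%E.
  apply: ereal_sup_ubound; exists l, o, m; split => //.
  by rewrite inner_Ec//; exact: (cmeas_Psi w_CDV).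
rewrite leeDr// lee_fin mulr_ge0 ?powR_ge0//.
by apply: (big_ind (fun x => 0 <= x)) => // x y x0 y0; rewrite le_max x0.
Qed.

(** At level l there are of order 2^(l d) products of coefficients, of size
   M^2 2^(-l (alpha + beta + d)) at most. Their geometric series is summed from
   level j up to one where dotp_dense applies. *)
Lemma approximation_error (alpha beta M : R) : 0 < alpha + beta -> 0 <= M ->
  exists2 C : R, 0 < C & forall p b, holder_ball w J0 alpha M p ->
    holder_ball w J0 beta M b -> forall j, (J0 <= j)%N ->
    `|ip p b - dotp w j p b| <= C * (2 `^ (- (alpha + beta))) ^+ j.
Proof.
move=> ab0 M0; set q := 2 `^ _.
have q0 : 0 < q by rewrite powR_gt0.
have q1 : q < 1.
  have := gt0_ltr_powR ab0 (_ : 1 \in Num.nneg) (_ : 2 \in Num.nneg) (ltr1n R 2).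
  by rewrite powR1 !nnegrE !ler0n /q powRN invf_lt1 ?powR_gt0//; apply.
have [c c0 [Cc Cc0 hCc]] := CDV_card w_CDV.
pose D := #|orient d|%:R * Cc * M ^+ 2 + 1.
have D0 : 0 < D by rewrite ltr_wpDl// !mulr_ge0// ?ltW// sqr_ge0.
exists (D / (1 - q) + 1).
  by rewrite addr_gt0// divr_gt0// subr_gt0.
move=> p b hp hb j J0j.
have cp := unif_continuous_cmeas hp.1; have cb := unif_continuous_cmeas hb.1.
have detail l : (J0 <= l)%N -> `|\sum_(o | o != orient0 d) \sum_(m : loc d w l)
    ip p (Psi o m) * ip b (Psi o m)| <= D * q ^+ l.
  move=> J0l.
  have pw : (2 `^ (l%:R * (alpha + d%:R / 2)))^-1 * (2 `^ (l%:R * (beta + d%:R / 2)))^-1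
      = q ^+ l / 2 ^+ (l * d) :> R.
    have -> : q ^+ l = 2 `^ (- (alpha + beta) * l%:R) by rewrite powRrM powR_mulrn// powR_ge0.
    have -> : 2 ^+ (l * d) = 2 `^ (l * d)%:R :> R by rewrite powR_mulrn.
    have n2 : (2 : R) != 0 by rewrite pnatr_eq0.
    rewrite -!powRN -!powRD ?n2 ?implybT//.
    by congr (_ `^ _); rewrite natrM; lra.
  apply: (@le_trans _ _ (\sum_(o : orient d) \sum_(m : loc d w l)
      M ^+ 2 * (q ^+ l / 2 ^+ (l * d)))).
    rewrite [leRHS](bigID (fun o => o != orient0 d))/= -[leLHS]addr0 lerD//; last first.
      apply: sumr_ge0 => o _; apply: sumr_ge0 => m _.
      by rewrite !mulr_ge0 ?sqr_ge0 ?invr_ge0 ?exprn_ge0// ltW.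
    apply: le_trans (ler_norm_sum _ _ _) _; apply: ler_sum => o o0.
    apply: le_trans (ler_norm_sum _ _ _) _; apply: ler_sum => m _.
    rewrite normrM -pw expr2 mulrACA ler_pM//; exact: holder_coef.
  rewrite sumr_const sumr_const -!mulrnA -[X in X <= _]mulr_natl natrM.
  have /andP[_ hl] := hCc _ J0l.
  have p2 : 0 < 2 ^+ (l * d) :> R by rewrite exprn_gt0.
  apply: (@le_trans _ _ (Cc * 2 ^+ (l * d) * #|orient d|%:R * (M ^+ 2 * (q ^+ l / 2 ^+ (l * d))))).
    rewrite ler_wpM2r ?ler_wpM2r// !mulr_ge0 ?sqr_ge0 ?invr_ge0 ?exprn_ge0// ltW//.
  rewrite [leLHS](_ : _ = #|orient d|%:R * Cc * M ^+ 2 * q ^+ l); last first.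
    by field; rewrite gt_eqF.
  by rewrite ler_wpM2r ?exprn_ge0 ?ltW// ltrDl.
have tail n : `|dotp w (j + n) p b - dotp w j p b| <= D / (1 - q) * (q ^+ j - q ^+ (j + n)).
  elim: n => [|n IH]; first by rewrite addn0 !subrr normr0 mulr0.
  have J0n : (J0 <= j + n)%N by rewrite (leq_trans J0j)// leq_addr.
  rewrite addnS (dotpS w_CDV J0n cp cb) addrAC.
  apply: le_trans (ler_normD _ _) _; apply: le_trans (lerD IH (detail _ J0n)) _.
  rewrite le_eqVlt; apply/orP; left; apply/eqP; rewrite exprS.
  by field; rewrite subr_eq0 eq_sym lt_eqF.
have e0 : 0 < q ^+ j by rewrite exprn_gt0.
have [J /andP[J0J jJ] hJ] := dotp_dense j cp cb e0.
have h := tail (J - j)%N; rewrite subnKC// in h.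
have -> : ip p b - dotp w j p b =
    (dotp w J p b - dotp w j p b) + (ip p b - dotp w J p b) by ring.
apply: le_trans (ler_normD _ _) _; rewrite mulrDl mul1r lerD//.
apply: le_trans h _; rewrite ler_wpM2l//; first by rewrite divr_ge0 ?subr_ge0 ?ltW.
by rewrite lerBlDr lerDl exprn_ge0// ltW.
Qed.

Lemma kernel_reproducing j f u : (J0 <= j)%N -> cube u -> Vspace w j f ->
  ip (proj_kernel w j u) f = f u.
Proof.
move=> J0j cu Vf; rewrite (Vspace_coef w_CDV J0j Vf cu).
have cf : cmeas f.
  have [c fE] := Vf; apply: (@eq_cmeas _ _ (fun x => \sum_m c m * Phi m x)).
    by move=> x cx; rewrite fE.
  by apply: cmeas_sum => m; apply: cmeasM; [exact: cmeas_cst|exact: (cmeas_Phi w_CDV)].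
rewrite ip_suml//; last by move=> m; exact: (cmeas_Phi w_CDV).
by apply: eq_bigr => m _; rewrite mulrC (ipC f).
Qed.

Lemma Vspace_kernel j (u : d.-tuple R) : Vspace w j (proj_kernel w j u).
Proof. by exists (fun m => Phi m u). Qed.

Lemma kernelC j (x y : d.-tuple R) : proj_kernel w j x y = proj_kernel w j y x.
Proof. by apply: eq_bigr => m _; rewrite mulrC. Qed.

(** The kernel of the coarser space belongs to the finer space, hence is
   reproduced by the kernel of the latter. *)
Lemma ip_kernels j1 j2 (u v : d.-tuple R) : (J0 <= j1)%N -> (J0 <= j2)%N ->
  cube u -> cube v ->
  ip (proj_kernel w j1 u) (proj_kernel w j2 v) = proj_kernel w (minn j1 j2) u v.
Proof.
move=> J01 J02 cu cv; have [j12|/ltnW j21] := leqP j1 j2.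
  rewrite ipC kernel_reproducing//.
  apply: (Vspace_mono w_CDV J01 j12); exact: Vspace_kernel.
rewrite kernel_reproducing//; first exact: kernelC.
by apply: (Vspace_mono w_CDV J02 j21); exact: Vspace_kernel.
Qed.

End approximation.

(** * Conditional means and the three subsamples *)

Section conditional_mean.
Context d1 d (T1 : measurableType d1) (T : measurableType d) (R : realType).
Variables (mu : probability T1 R) (P : probability T R) (n : nat).
Hypothesis n_gt0 : (0 < n)%N.
Variable g : T1 * T -> R.
Hypothesis bg : bmeas g.

(** The average of g(z.1, .) over the sample z.2, which is independent of
   z.1. *)
Definition cmean (z : T1 * n.-tuple T) : R :=
  n%:R^-1 * Sum (fun o => g (z.1, o)) z.2.

Lemma bmeas_cmean : bmeas cmean.
Proof.
apply: bmeasM; first exact: bmeas_cst.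
apply: bmeas_sum => i.
apply: (bmeas_comp (h := fun z : T1 * n.-tuple T => (z.1, tnth z.2 i)) _ bg).
apply: measurable_fun_pair; first exact: measurable_fst.
by apply: (measurableT_comp (measurable_tnth i)); exact: measurable_snd.
Qed.

Let n0 : n%:R != 0 :> R. Proof. by rewrite pnatr_eq0 -lt0n. Qed.

Let h x := Ex P (fun o => g (x, o)).

Let bh : bmeas h. Proof. exact: (bmeas_Ex2 mu P bg). Qed.

Let Ex_cmean1 x : Ex (iid P n) (fun D => cmean (x, D)) = h x.
Proof.
have bgx : bmeas (fun o => g (x, o)) by exact: bmeas_pair1.
rewrite /cmean/= ExZl; last exact: bmeas_Sum.
by rewrite Ex_Sum// mulKf.
Qed.

Lemma Ex_cmean : Ex (prod_prob mu (iid P n)) cmean = Ex mu h.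
Proof. by rewrite Ex_prod ?(eq_Ex _ Ex_cmean1)//; exact: bmeas_cmean. Qed.

(** The law of total variance: given z.1 the average has mean h(z.1), and its
   variance is at most 1/n times a conditional second moment. *)
Lemma Var_cmean : Var (prod_prob mu (iid P n)) cmean <=
  n%:R^-1 * Ex mu (fun x => Ex P (fun o => g (x, o) ^+ 2)) + Var mu h.
Proof.
have bc := bmeas_cmean; have bg2 : bmeas (fun z => g z ^+ 2) by bm.
rewrite /Var Ex_cmean Ex_prod; last by bm.
have bE2 : bmeas (fun x => Ex P (fun o => g (x, o) ^+ 2)) by exact: (bmeas_Ex2 mu P bg2).
rewrite -ExZl// -ExD; [|bm|bm].
have bl : bmeas (fun z => (cmean z - Ex mu h) ^+ 2) by bm.
apply: le_Ex; [exact: (bmeas_Ex2 mu (iid P n) bl)|bm|move=> x].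
have bcx : bmeas (fun D => cmean (x, D)) by exact: bmeas_pair1.
have bgx : bmeas (fun o => g (x, o)) by exact: bmeas_pair1.
rewrite Ex_sqrB// Ex_cmean1.
have -> : Ex (iid P n) (fun D => cmean (x, D) ^+ 2) =
    Var (iid P n) (fun D => cmean (x, D)) + h x ^+ 2.
  by rewrite /Var Ex_sqr_center// Ex_cmean1 subrK.
have -> : Var (iid P n) (fun D => cmean (x, D)) = n%:R^-1 * Var P (fun o => g (x, o)).
  rewrite /cmean/= VarZ; last exact: bmeas_Sum.
  by rewrite Var_Sum//; field; exact: n0.
have := ler_wpM2l (_ : 0 <= n%:R^-1) (Var_le_sqr P bgx).
rewrite invr_ge0 ler0n => /(_ isT) H.
rewrite -addrA -addrA; apply: lerD => //.
by rewrite le_eqVlt; apply/orP; left; apply/eqP; ring.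
Qed.

End conditional_mean.

Section three_samples.
Context (R : realType) (d : nat) (P : probability (datum R d) R) (n : nat).
Notation smp := (n.-tuple (datum R d)).
Notation mu := (iid P n).
Notation law := (samples_law P n).
Implicit Types G : smp * smp -> R.

Lemma Ex_samples (F : samples R d n -> R) : bmeas F -> Ex law F =
  Ex mu (fun D1 => Ex mu (fun D2 => Ex mu (fun D3 => F (D1, D2, D3)))).
Proof.
move=> bF; rewrite /samples_law Ex_prod// Ex_prod//.
exact: (bmeas_Ex2 (prod_prob mu mu) mu bF).
Qed.

Lemma bmeas_12 G : bmeas G -> bmeas (fun s : samples R d n => G s.1).
Proof. exact: bmeas_fst. Qed.

Lemma bmeas_13 G : bmeas G -> bmeas (fun s : samples R d n => G (s.1.1, s.2)).
Proof.
move=> bG; apply: (bmeas_comp _ bG).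
apply: measurable_fun_pair; last exact: measurable_snd.
by apply: (measurableT_comp measurable_fst); exact: measurable_fst.
Qed.

Lemma Ex_12 G : bmeas G -> Ex law (fun s => G s.1) = Ex (prod_prob mu mu) G.
Proof. exact: Ex_fst. Qed.

Lemma Ex_13 G : bmeas G -> Ex law (fun s => G (s.1.1, s.2)) = Ex (prod_prob mu mu) G.
Proof.
move=> bG; rewrite Ex_samples; last exact: bmeas_13.
by rewrite Ex_prod//; apply: eq_Ex => D1; rewrite /= Ex_cst.
Qed.

Lemma Ex_1 (G : smp -> R) : bmeas G -> Ex law (fun s => G s.1.1) = Ex mu G.
Proof.
by move=> bG; rewrite (Ex_12 (G := fun z => G z.1)) ?Ex_fst//; exact: bmeas_fst.
Qed.

Lemma Ex_2 (G : smp -> R) : bmeas G -> Ex law (fun s => G s.1.2) = Ex mu G.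
Proof.
by move=> bG; rewrite (Ex_12 (G := fun z => G z.2)) ?Ex_snd//; exact: bmeas_snd.
Qed.

Lemma Var_12 G : bmeas G -> Var law (fun s => G s.1) = Var (prod_prob mu mu) G.
Proof.
by move=> bG; rewrite /Var Ex_12// (Ex_12 (G := fun z => (G z - _) ^+ 2))//; bm.
Qed.

Lemma Var_13 G : bmeas G -> Var law (fun s => G (s.1.1, s.2)) = Var (prod_prob mu mu) G.
Proof.
by move=> bG; rewrite /Var Ex_13// (Ex_13 (G := fun z => (G z - _) ^+ 2))//; bm.
Qed.

Lemma Var_1 (G : smp -> R) : bmeas G -> Var law (fun s => G s.1.1) = Var mu G.
Proof.
by move=> bG; rewrite /Var Ex_1// (Ex_1 (G := fun z => (G z - _) ^+ 2))//; bm.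
Qed.

Lemma Var_2 (G : smp -> R) : bmeas G -> Var law (fun s => G s.1.2) = Var mu G.
Proof.
by move=> bG; rewrite /Var Ex_2// (Ex_2 (G := fun z => (G z - _) ^+ 2))//; bm.
Qed.

End three_samples.

(** * The estimators evaluated at admissible samples *)

Lemma measurable_fun_sum (I : Type) d (T : measurableType d) (R : realType)
    (r : seq I) (Q : pred I) (F : I -> T -> R) :
  (forall i, measurable_fun setT (F i)) ->
  measurable_fun setT (fun x => \sum_(i <- r | Q i) F i x).
Proof.
move=> mF; elim: r => [|i r IH].
  by under eq_fun do rewrite big_nil; exact: measurable_cst.
under eq_fun do rewrite big_cons.
by case: (Q i) => //; exact: measurable_funD.
Qed.

Section estimator_measurability.
Context (R : realType) (d : nat) (w : wavelets R) (S J0 : nat).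
Hypotheses (w_CDV : is_CDV_basis d w S J0).
Context (n j1 j2 : nat).
Notation smp := (n.-tuple (datum R d)).

Let mPhi j (m : loc d w j) : measurable_fun setT (Phi m).
Proof. by apply: bmeas_meas; exact: (bmeas_wave w_CDV). Qed.

Definition scoreA j (m : loc d w j) (o : datum R d) : R := obsA o * Phi m (obsX o).
Definition scoreY j (m : loc d w j) (o : datum R d) : R := obsY o * Phi m (obsX o).

Let hatE (c : datum R d -> R) j (D : smp) x :
  sample_mean (fun o => c o * proj_kernel w j (obsX o) x) D =
  n%:R^-1 * \sum_(m : loc d w j) Sum (fun o => c o * Phi m (obsX o)) D * Phi m x.
Proof.
rewrite /sample_mean; congr (_ * _).
under [RHS]eq_bigr do rewrite mulr_suml.
rewrite exchange_big/=; apply: eq_bigr => i _.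
by rewrite mulr_sumr; apply: eq_bigr => m _; rewrite mulrA.
Qed.

Lemma p_hatE j (D : smp) x :
  p_hat w j D x = n%:R^-1 * \sum_(m : loc d w j) Sum (scoreA m) D * Phi m x.
Proof. exact: hatE. Qed.

Lemma b_hatE j (D : smp) x :
  b_hat w j D x = n%:R^-1 * \sum_(m : loc d w j) Sum (scoreY m) D * Phi m x.
Proof. exact: hatE. Qed.

Let cmeas_hat (c : datum R d -> R) j (D : smp) :
  cmeas (fun x => sample_mean (fun o => c o * proj_kernel w j (obsX o) x) D).
Proof.
apply: bmeasM; first exact: bmeas_cst.
apply: bmeas_sum => i; apply: bmeasM; first exact: bmeas_cst.
by apply: bmeas_sum => m; apply: bmeasM; [exact: bmeas_cst|exact: (cmeas_Phi w_CDV)].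
Qed.

Lemma cmeas_p_hat j (D : smp) : cmeas (p_hat w j D).
Proof. exact: cmeas_hat. Qed.

Lemma cmeas_b_hat j (D : smp) : cmeas (b_hat w j D).
Proof. exact: cmeas_hat. Qed.

Definition plugin (D : smp) : R := ip (p_hat w j1 D) (b_hat w j2 D).

Lemma plugin_integral (D : smp) :
  \int[unif_cube R d]_(x in cube (d:=d)) (p_hat w j1 D x * b_hat w j2 D x) = plugin D.
Proof.
by apply: Ec_cubeE; apply: cmeasM; [exact: cmeas_p_hat|exact: cmeas_b_hat].
Qed.

(** The inner product of two kernels is the kernel at the coarser level, by
   nestedness of the approximation spaces (ip_kernels). *)
Lemma pluginE (D : smp) : (J0 <= j1)%N -> (J0 <= j2)%N ->
  (forall i, cube (obsX (tnth D i))) ->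
  plugin D = n%:R^-1 ^+ 2 * \sum_(m : loc d w (minn j1 j2)) Sum (scoreA m) D * Sum (scoreY m) D.
Proof.
move=> J01 J02 cD.
have cK j u : cmeas (proj_kernel w j u : d.-tuple R -> R).
  by apply: cmeas_sum => m; apply: cmeasM; [exact: cmeas_cst|exact: (cmeas_Phi w_CDV)].
have pE : p_hat w j1 D = fun x => n%:R^-1 * \sum_(i < n) obsA (tnth D i) * proj_kernel w j1 (obsX (tnth D i)) x.
  by [].
have bE : b_hat w j2 D = fun x => n%:R^-1 * \sum_(i < n) obsY (tnth D i) * proj_kernel w j2 (obsX (tnth D i)) x.
  by [].
have cS j (c : 'I_n -> R) : cmeas (fun x : d.-tuple R => \sum_(i < n) c i * proj_kernel w j (obsX (tnth D i)) x).
  by apply: cmeas_sum => i; apply: cmeasM; [exact: cmeas_cst|exact: cK].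
rewrite /plugin pE ipZl; [|exact: cS|exact: cmeas_b_hat].
rewrite ipC bE ipZl; [|exact: cS|exact: cS].
rewrite mulrA -expr2 ip_suml; [|by move=> i; exact: cK|exact: cS]; congr (_ * _).
under eq_bigr => i _.
  rewrite ipC ip_suml; [|by move=> k; exact: cK|exact: cK].
  under eq_bigr => k _ do rewrite (ip_kernels w_CDV J01 J02 (cD k) (cD i)).
  over.
rewrite /=; under [RHS]eq_bigr do rewrite mulr_suml.
rewrite [RHS]exchange_big/=.
under [RHS]eq_bigr do (under eq_bigr do rewrite mulr_sumr).
under [RHS]eq_bigr do rewrite exchange_big/=.
under eq_bigr do rewrite mulr_sumr.
rewrite exchange_big/=; apply: eq_bigr => k _; apply: eq_bigr => i _.
rewrite !mulr_sumr; apply: eq_bigr => m _; rewrite /scoreA /scoreY; ring.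
Qed.

Let mscoreA j (m : loc d w j) : measurable_fun setT (scoreA m).
Proof.
apply: measurable_funM; first exact: measurable_obsA.
by apply: (measurableT_comp (mPhi m)); exact: measurable_obsX.
Qed.

Let mscoreY j (m : loc d w j) : measurable_fun setT (scoreY m).
Proof.
apply: measurable_funM; first exact: measurable_obsY.
by apply: (measurableT_comp (mPhi m)); exact: measurable_obsX.
Qed.

Let measurable_Sum (f : datum R d -> R) : measurable_fun setT f ->
  measurable_fun setT (@Sum _ _ _ n f).
Proof.
move=> mf; apply: measurable_fun_sum => i.
by apply: (measurableT_comp mf); exact: measurable_tnth.
Qed.

Let mS11 : measurable_fun setT (fun s : samples R d n => s.1.1).
Proof. by apply: (measurableT_comp measurable_fst); exact: measurable_fst. Qed.

Let mS12 : measurable_fun setT (fun s : samples R d n => s.1.2).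
Proof. by apply: (measurableT_comp measurable_snd); exact: measurable_fst. Qed.

Lemma measurable_plugin : measurable_fun setT plugin.
Proof.
have E : plugin = fun D => n%:R^-1 * (n%:R^-1 * \sum_(m' : loc d w j2) \sum_(m : loc d w j1)
    (Sum (scoreY m') D * (Sum (scoreA m) D * ip (Phi m) (Phi m')))).
  apply/funext => D; rewrite /plugin.
  have cS j (c : loc d w j -> R) : cmeas (fun x => \sum_m c m * Phi m x).
    by apply: cmeas_sum => m; apply: cmeasM; [exact: cmeas_cst|exact: (cmeas_Phi w_CDV)].
  rewrite (_ : p_hat w j1 D = fun x => n%:R^-1 * \sum_(m : loc d w j1) Sum (scoreA m) D * Phi m x);
    last by apply/funext => x; exact: p_hatE.
  rewrite ipZl; [|exact: cS|exact: cmeas_b_hat]; congr (_ * _).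
  rewrite (_ : b_hat w j2 D = fun x => n%:R^-1 * \sum_(m : loc d w j2) Sum (scoreY m) D * Phi m x);
    last by apply/funext => x; exact: b_hatE.
  rewrite ipC ipZl; [|exact: cS|exact: cS]; congr (_ * _).
  rewrite ip_suml; [|move=> m; exact: (cmeas_Phi w_CDV)|exact: cS].
  apply: eq_bigr => m' _; rewrite -mulr_sumr; congr (_ * _).
  by rewrite ipC ip_suml => [|m|] //; exact: (cmeas_Phi w_CDV).
rewrite E; do 2 (apply: measurable_funM; first exact: measurable_cst).
do 2 (apply: measurable_fun_sum => ?).
apply: measurable_funM; first exact: measurable_Sum.
by apply: measurable_funM; [exact: measurable_Sum|exact: measurable_cst].
Qed.

Let measurable_hat j (f : loc d w j -> datum R d -> R)
    (D : samples R d n -> smp) (x : samples R d n -> d.-tuple R) :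
  (forall m, measurable_fun setT (f m)) -> measurable_fun setT D -> measurable_fun setT x ->
  measurable_fun setT (fun s => n%:R^-1 * \sum_m Sum (f m) (D s) * Phi m (x s)).
Proof.
move=> mf mD mx; apply: measurable_funM; first exact: measurable_cst.
apply: measurable_fun_sum => m; apply: measurable_funM.
  by apply: (measurableT_comp _ mD); exact: measurable_Sum.
exact: (measurableT_comp (mPhi m) mx).
Qed.

Lemma measurable_psi_INT : measurable_fun setT (@psi_INT R d w n j1 j2).
Proof.
rewrite (_ : psi_INT _ _ _ = fun s : samples R d n =>
   n%:R^-1 * Sum (fun o => obsA o * obsY o) s.1.2 - plugin s.1.1); last first.
  by apply/funext => -[[D1 D2] D3]; rewrite /psi_INT plugin_integral.
apply: measurable_funB; last exact: (measurableT_comp measurable_plugin mS11).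
apply: measurable_funM; first exact: measurable_cst.
apply: (measurableT_comp _ mS12); apply: measurable_Sum.
by apply: measurable_funM; [exact: measurable_obsA|exact: measurable_obsY].
Qed.

Lemma measurable_psi_MC : measurable_fun setT (@psi_MC R d w n j1 j2).
Proof.
rewrite (_ : psi_MC _ _ _ = fun s : samples R d n =>
   n%:R^-1 * Sum (fun o => obsA o * obsY o) s.1.2 -
   n%:R^-1 * \sum_(i < n) (p_hat w j1 s.1.1 (obsX (tnth s.2 i)) *
     b_hat w j2 s.1.1 (obsX (tnth s.2 i)))); last first.
  by apply/funext => -[[D1 D2] D3].
apply: measurable_funB; apply: measurable_funM; try exact: measurable_cst.
  apply: (measurableT_comp _ mS12); apply: measurable_Sum.
  by apply: measurable_funM; [exact: measurable_obsA|exact: measurable_obsY].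
apply: measurable_fun_sum => i.
have mX : measurable_fun setT (fun s : samples R d n => obsX (tnth s.2 i)).
  by apply: (measurableT_comp (@measurable_obsX R d)); apply: (measurableT_comp (measurable_tnth i)).
apply: measurable_funM.
- by under eq_fun do rewrite p_hatE; exact: measurable_hat.
- by under eq_fun do rewrite b_hatE; exact: measurable_hat.
Qed.

Lemma measurable_psi_IF : measurable_fun setT (@psi_IF R d w n j1 j2).
Proof.
rewrite (_ : psi_IF _ _ _ = fun s : samples R d n =>
   n%:R^-1 * \sum_(i < n) ((obsA (tnth s.1.2 i) - p_hat w j1 s.1.1 (obsX (tnth s.1.2 i))) *
     (obsY (tnth s.1.2 i) - b_hat w j2 s.1.1 (obsX (tnth s.1.2 i))))); last first.
  by apply/funext => -[[D1 D2] D3].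
apply: measurable_funM; first exact: measurable_cst.
apply: measurable_fun_sum => i.
have mi : measurable_fun setT (fun s : samples R d n => tnth s.1.2 i).
  exact: (measurableT_comp (measurable_tnth i) mS12).
have mX : measurable_fun setT (fun s : samples R d n => obsX (tnth s.1.2 i)).
  exact: (measurableT_comp (@measurable_obsX R d) mi).
apply: measurable_funM; apply: measurable_funB.
- exact: (measurableT_comp (@measurable_obsA R d) mi).
- by under eq_fun do rewrite p_hatE; exact: measurable_hat.
- exact: (measurableT_comp (@measurable_obsY R d) mi).
- by under eq_fun do rewrite b_hatE; exact: measurable_hat.
Qed.

End estimator_measurability.

(** * Moments of the estimators at clamped observations *)

Section clamped_estimators.
Context (R : realType) (d : nat) (w : wavelets R) (S J0 : nat).
Hypotheses (d_gt0 : (0 < d)%N) (w_CDV : is_CDV_basis d w S J0).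
Context (C1 C2 : R) (P : probability (datum R d) R).
Hypothesis C12 : C1 <= C2.
Hypothesis lawX : forall B, measurable B -> P (@obsX R d @^-1` B) = unif_cube R d B.
Hypothesis admP : P (admissible (d := d) C1 C2) = 1%E.
Context (n j1 j2 : nat).
Hypotheses (n_gt0 : (0 < n)%N) (J01 : (J0 <= j1)%N) (J02 : (J0 <= j2)%N).
Notation smp := (n.-tuple (datum R d)).
Notation mu := (iid P n).
Notation law := (samples_law P n).
Notation Ac := (@obsAc R d C1 C2).
Notation Yc := (@obsYc R d C1 C2).
Notation Xc := (@obsXc R d).
Notation cl := (@clampD R d C1 C2).
Notation jm := (minn j1 j2).

Let J0m : (J0 <= jm)%N. Proof. by rewrite leq_min J01. Qed.
Let n0 : n%:R != 0 :> R. Proof. by rewrite pnatr_eq0 -lt0n. Qed.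
Let bA : bmeas Ac. Proof. exact: bmeas_obsAc. Qed.
Let bY : bmeas Yc. Proof. exact: bmeas_obsYc. Qed.

Definition clampS (s : samples R d n) : samples R d n :=
  (map_tuple cl s.1.1, map_tuple cl s.1.2, map_tuple cl s.2).

Let Gn := @all_in _ _ (admissible (d := d) C1 C2) n.

Definition admissibleS : set (samples R d n) := (Gn `*` Gn) `*` Gn.

Lemma measurable_admissibleS : measurable admissibleS.
Proof.
have mG : measurable Gn by apply: measurable_all_in; exact: measurable_admissible.
by apply: measurableX => //; exact: measurableX.
Qed.

Lemma admissibleS_full : law admissibleS = 1%E.
Proof.
have mG : measurable Gn by apply: measurable_all_in; exact: measurable_admissible.
have G1 : mu Gn = 1%E by apply: iid_full => //; exact: measurable_admissible.
by apply: prod_prob_full => //; [exact: measurableX|exact: prod_prob_full].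
Qed.

Lemma clampS_id s : admissibleS s -> clampS s = s.
Proof.
have H (D : smp) : Gn D -> map_tuple cl D = D.
  by move=> GD; apply: eq_from_tnth => i; rewrite tnth_map clampD_id//; exact: GD.
by case: s => [[D1 D2] D3] [[/= g1 g2] g3]; rewrite /clampS /= !H.
Qed.

(** Almost every sample is admissible and is equal to its clamped version,
   for which the statistic is bounded. *)
Lemma E_clamp (F : samples R d n -> R) c : measurable_fun setT F -> bmeas (F \o clampS) ->
  'E_law[(fun s => F s - c)%R]%E = (Ex law (F \o clampS) - c)%:E.
Proof.
move=> mF bF.
rewrite (EP_full (g := fun s => (F \o clampS) s - c) measurable_admissibleS admissibleS_full).
- by rewrite ExB ?Ex_cst//; exact: bmeas_cst.
- by move=> s /clampS_id h /=; rewrite h.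
- by apply: measurable_funB => //; exact: measurable_cst.
- by apply: bmeasB => //; exact: bmeas_cst.
Qed.

Lemma V_clamp (F : samples R d n -> R) : measurable_fun setT F -> bmeas (F \o clampS) ->
  'V_law[F]%E = (Var law (F \o clampS))%:E.
Proof.
move=> mF bF; apply: (VP_full measurable_admissibleS admissibleS_full) => //.
by move=> s /clampS_id h /=; rewrite h.
Qed.

Definition fA j (m : loc d w j) (o : datum R d) : R := Ac o * Phi m (Xc o).
Definition fY j (m : loc d w j) (o : datum R d) : R := Yc o * Phi m (Xc o).

Lemma bmeas_PhiX j (m : loc d w j) : bmeas (fun o : datum R d => Phi m (Xc o)).
Proof. by apply: bmeas_preX; exact: (cmeas_Phi w_CDV). Qed.

Lemma bmeas_fA j (m : loc d w j) : bmeas (fA m).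
Proof. by apply: bmeasM => //; exact: bmeas_PhiX. Qed.

Lemma bmeas_fY j (m : loc d w j) : bmeas (fY m).
Proof. by apply: bmeasM => //; exact: bmeas_PhiX. Qed.

Lemma Sum_clamp (f : datum R d -> R) (D : smp) : Sum f (map_tuple cl D) = Sum (f \o cl) D.
Proof. by apply: eq_bigr => i _; rewrite tnth_map. Qed.

Definition pc j (D : smp) : d.-tuple R -> R := p_hat w j (map_tuple cl D).
Definition bc j (D : smp) : d.-tuple R -> R := b_hat w j (map_tuple cl D).

Lemma pcE j D x : pc j D x = n%:R^-1 * \sum_(m : loc d w j) Sum (fA m) D * Phi m x.
Proof.
by rewrite /pc p_hatE; congr (_ * _); apply: eq_bigr => m _; rewrite Sum_clamp.
Qed.

Lemma bcE j D x : bc j D x = n%:R^-1 * \sum_(m : loc d w j) Sum (fY m) D * Phi m x.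
Proof.
by rewrite /bc b_hatE; congr (_ * _); apply: eq_bigr => m _; rewrite Sum_clamp.
Qed.

Definition pluginc (D : smp) : R :=
  n%:R^-1 ^+ 2 * dot (@fA jm) (@fY jm) D.

Lemma plugincE (D : smp) : ip (pc j1 D) (bc j2 D) = pluginc D.
Proof.
rewrite -[LHS]/(plugin w j1 j2 (map_tuple cl D)) (pluginE w_CDV)//; last first.
  by move=> i; rewrite tnth_map; exact: retract_cube.
by congr (_ * _); apply: eq_bigr => m _; rewrite !Sum_clamp.
Qed.

Lemma bmeas_pluginc : bmeas pluginc.
Proof.
by apply: bmeasM; [exact: bmeas_cst|apply: bmeas_dot; [exact: bmeas_fA|exact: bmeas_fY]].
Qed.

Let U (D : smp) : R := n%:R^-1 * Sum (fun o => Ac o * Yc o) D.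
Let bU : bmeas U. Proof. by apply: bmeasM; [exact: bmeas_cst|apply: bmeas_Sum; bm]. Qed.

Let gMC (z : smp * datum R d) : R := pc j1 z.1 (Xc z.2) * bc j2 z.1 (Xc z.2).
Let gIF (z : smp * datum R d) : R :=
  (Ac z.2 - pc j1 z.1 (Xc z.2)) * (Yc z.2 - bc j2 z.1 (Xc z.2)).

Let bmeas_pcX j : bmeas (fun z : smp * datum R d => pc j z.1 (Xc z.2)).
Proof.
under eq_fun do rewrite pcE.
apply: bmeasM; first exact: bmeas_cst.
apply: bmeas_sum => m; apply: bmeasM.
  by apply: bmeas_fst; apply: bmeas_Sum; exact: bmeas_fA.
by apply: (bmeas_snd _ (g := fun o => Phi m (Xc o))); exact: bmeas_PhiX.
Qed.

Let bmeas_bcX j : bmeas (fun z : smp * datum R d => bc j z.1 (Xc z.2)).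
Proof.
under eq_fun do rewrite bcE.
apply: bmeasM; first exact: bmeas_cst.
apply: bmeas_sum => m; apply: bmeasM.
  by apply: bmeas_fst; apply: bmeas_Sum; exact: bmeas_fY.
by apply: (bmeas_snd _ (g := fun o => Phi m (Xc o))); exact: bmeas_PhiX.
Qed.

Let bgMC : bmeas gMC. Proof. by apply: bmeasM. Qed.
Let bgIF : bmeas gIF.
Proof. by apply: bmeasM; apply: bmeasB => //; exact: bmeas_snd. Qed.

Lemma INT_clamp s : psi_INT w j1 j2 (clampS s) = U s.1.2 - pluginc s.1.1.
Proof.
case: s => [[D1 D2] D3]; rewrite /psi_INT /clampS /=.
rewrite (plugin_integral w_CDV) -plugincE; congr (_ - _).
by rewrite /U /sample_mean; congr (_ * _); apply: eq_bigr => i _; rewrite tnth_map.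
Qed.

Lemma MC_clamp s : psi_MC w j1 j2 (clampS s) = U s.1.2 - cmean gMC (s.1.1, s.2).
Proof.
case: s => [[D1 D2] D3]; rewrite /psi_MC /clampS /=; congr (_ - _).
  by rewrite /U /sample_mean; congr (_ * _); apply: eq_bigr => i _; rewrite tnth_map.
by rewrite /cmean /sample_mean; congr (_ * _); apply: eq_bigr => i _; rewrite tnth_map.
Qed.

Lemma IF_clamp s : psi_IF w j1 j2 (clampS s) = cmean gIF s.1.
Proof.
case: s => [[D1 D2] D3]; rewrite /psi_IF /clampS /=.
by rewrite /cmean /sample_mean; congr (_ * _); apply: eq_bigr => i _; rewrite tnth_map.
Qed.

Lemma Ex_gMC D : Ex P (fun o => gMC (D, o)) = pluginc D.
Proof.
rewrite -plugincE; apply: (Ex_law_retract lawX (g := fun x => pc j1 D x * bc j2 D x)).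
by apply: cmeasM; [exact: (cmeas_p_hat w_CDV)|exact: (cmeas_b_hat w_CDV)].
Qed.

(** The integrals of p b_hat and b p_hat: the basis coefficients of p and b
   are the expectations of the scores. *)
Let linY (D : smp) : R := n%:R^-1 * Sum (fun o => \sum_(m : loc d w j2) Ex P (fA m) * fY m o) D.
Let linA (D : smp) : R := n%:R^-1 * Sum (fun o => \sum_(m : loc d w j1) Ex P (fY m) * fA m o) D.

Let b_linY1 : bmeas (fun o => \sum_(m : loc d w j2) Ex P (fA m) * fY m o).
Proof. by apply: bmeas_sum => m; apply: bmeasM; [exact: bmeas_cst|exact: bmeas_fY]. Qed.
Let b_linA1 : bmeas (fun o => \sum_(m : loc d w j1) Ex P (fY m) * fA m o).
Proof. by apply: bmeas_sum => m; apply: bmeasM; [exact: bmeas_cst|exact: bmeas_fA]. Qed.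
Let b_linY : bmeas linY.
Proof. by apply: bmeasM; [exact: bmeas_cst|exact: bmeas_Sum]. Qed.
Let b_linA : bmeas linA.
Proof. by apply: bmeasM; [exact: bmeas_cst|exact: bmeas_Sum]. Qed.

Lemma Ex_gIF D : Ex P (fun o => gIF (D, o)) =
  Ex P (fun o => Ac o * Yc o) - linY D - linA D + pluginc D.
Proof.
have bp : bmeas (fun o => pc j1 D (Xc o)) by exact: (bmeas_pair1 D (bmeas_pcX j1)).
have bb : bmeas (fun o => bc j2 D (Xc o)) by exact: (bmeas_pair1 D (bmeas_bcX j2)).
have hY : Ex P (fun o => Ac o * bc j2 D (Xc o)) = linY D.
  transitivity (Ex P (fun o => n%:R^-1 * \sum_(m : loc d w j2) Sum (fY m) D * fA m o)).
    apply: eq_Ex => o; rewrite bcE mulrCA mulr_sumr; congr (_ * _).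
    by apply: eq_bigr => m _; rewrite /fA; ring.
  rewrite ExZl; last by apply: bmeas_sum => m; apply: bmeasM; [exact: bmeas_cst|exact: bmeas_fA].
  rewrite Ex_sum; last by move=> m; apply: bmeasM; [exact: bmeas_cst|exact: bmeas_fA].
  congr (_ * _); rewrite /Sum exchange_big/=; apply: eq_bigr => m _.
  by rewrite ExZl; [rewrite mulrC mulr_sumr|exact: bmeas_fA].
have hA : Ex P (fun o => Yc o * pc j1 D (Xc o)) = linA D.
  transitivity (Ex P (fun o => n%:R^-1 * \sum_(m : loc d w j1) Sum (fA m) D * fY m o)).
    apply: eq_Ex => o; rewrite pcE mulrCA mulr_sumr; congr (_ * _).
    by apply: eq_bigr => m _; rewrite /fY; ring.
  rewrite ExZl; last by apply: bmeas_sum => m; apply: bmeasM; [exact: bmeas_cst|exact: bmeas_fY].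
  rewrite Ex_sum; last by move=> m; apply: bmeasM; [exact: bmeas_cst|exact: bmeas_fY].
  congr (_ * _); rewrite /Sum exchange_big/=; apply: eq_bigr => m _.
  by rewrite ExZl; [rewrite mulrC mulr_sumr|exact: bmeas_fY].
rewrite -hY -hA -Ex_gMC.
have bg1 : bmeas (fun o => gMC (D, o)) by exact: bmeas_pair1.
rewrite -!ExB -?ExD; [|by bm..].
by apply: eq_Ex => o; rewrite /gIF /gMC /=; ring.
Qed.

(** The expectation of A Y K(X, X) for the kernel K at the coarser level: the
   contribution of an observation paired with itself. *)
Definition kappa : R := Ex P (fun o => \sum_(m : loc d w jm) fA m o * fY m o).
(** The inner product dotp of the regression functions, in terms of the law
   of the observations. *)
Definition dotc j : R := \sum_(m : loc d w j) Ex P (fA m) * Ex P (fY m).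

(** Of the n^2 pairs of observations, the n diagonal ones have mean kappa
   instead of dotc. *)
Lemma Ex_pluginc : Ex mu pluginc = dotc jm - n%:R^-1 * (dotc jm - kappa).
Proof.
have bF := @bmeas_fA jm; have bG := @bmeas_fY jm.
have bd : bmeas (@dot _ _ R _ n (@fA jm) (@fY jm)) by exact: bmeas_dot.
rewrite ExZl// /dot Ex_sum; last by move=> m; apply: bmeasM; exact: bmeas_Sum.
under eq_bigr => m _ do rewrite Ex_SumM//.
rewrite big_split/= -!mulr_sumr -Ex_sum; last by move=> m; bm.
by rewrite -/kappa -/(dotc jm); field; exact: n0.
Qed.

Let EU : Ex mu U = Ex P (fun o => Ac o * Yc o).
Proof. by rewrite ExZl ?Ex_Sum; [field; exact: n0|bm|apply: bmeas_Sum; bm]. Qed.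

Lemma Ex_INT : bmeas (@psi_INT R d w n j1 j2 \o clampS) /\
  Ex law (@psi_INT R d w n j1 j2 \o clampS) =
  Ex P (fun o => Ac o * Yc o) - dotc jm + n%:R^-1 * (dotc jm - kappa).
Proof.
have E : @psi_INT R d w n j1 j2 \o clampS = fun s => U s.1.2 - pluginc s.1.1.
  by apply/funext => s; exact: INT_clamp.
have b1 : bmeas (fun s : samples R d n => U s.1.2).
  by apply: (bmeas_12 (G := fun z => U z.2)); exact: bmeas_snd.
have b2 : bmeas (fun s : samples R d n => pluginc s.1.1).
  by apply: (bmeas_12 (G := fun z => pluginc z.1)); apply: bmeas_fst; exact: bmeas_pluginc.
rewrite E; split; first by bm.
rewrite ExB// (Ex_2 _ bU) (Ex_1 _ bmeas_pluginc) EU Ex_pluginc; ring.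
Qed.

Lemma Ex_MC : bmeas (@psi_MC R d w n j1 j2 \o clampS) /\
  Ex law (@psi_MC R d w n j1 j2 \o clampS) =
  Ex P (fun o => Ac o * Yc o) - dotc jm + n%:R^-1 * (dotc jm - kappa).
Proof.
have E : @psi_MC R d w n j1 j2 \o clampS = fun s => U s.1.2 - cmean gMC (s.1.1, s.2).
  by apply/funext => s; exact: MC_clamp.
have b1 : bmeas (fun s : samples R d n => U s.1.2).
  by apply: (bmeas_12 (G := fun z => U z.2)); exact: bmeas_snd.
have bc := bmeas_cmean n bgMC.
have b2 := bmeas_13 bc.
rewrite E; split; first by bm.
rewrite ExB// (Ex_2 _ bU) (Ex_13 _ bc) EU Ex_cmean// (eq_Ex _ Ex_gMC) Ex_pluginc; ring.
Qed.

(** The cross terms subtract dotc j1 and dotc j2; the plug-in term gives the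
   coarser of these two back. *)
Lemma Ex_IF : bmeas (@psi_IF R d w n j1 j2 \o clampS) /\
  Ex law (@psi_IF R d w n j1 j2 \o clampS) =
  Ex P (fun o => Ac o * Yc o) - dotc (maxn j1 j2) - n%:R^-1 * (dotc jm - kappa).
Proof.
have E : @psi_IF R d w n j1 j2 \o clampS = fun s => cmean gIF s.1.
  by apply/funext => s; exact: IF_clamp.
have bc := bmeas_cmean n bgIF.
rewrite E; split; first exact: bmeas_12 bc.
rewrite (Ex_12 _ bc) Ex_cmean// (eq_Ex _ Ex_gIF).
have bp := bmeas_pluginc.
rewrite ExD; [|by bm|by bm].
rewrite !ExB ?Ex_cst//; [|by bm..].
rewrite Ex_pluginc.
have -> : Ex mu linY = dotc j2.
  rewrite ExZl ?Ex_Sum//; last exact: bmeas_Sum.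
  rewrite Ex_sum; last by move=> m; apply: bmeasM; [exact: bmeas_cst|exact: bmeas_fY].
  rewrite mulKf//; apply: eq_bigr => m _; rewrite ExZl//; exact: bmeas_fY.
have -> : Ex mu linA = dotc j1.
  rewrite ExZl ?Ex_Sum//; last exact: bmeas_Sum.
  rewrite Ex_sum; last by move=> m; apply: bmeasM; [exact: bmeas_cst|exact: bmeas_fA].
  by rewrite mulKf//; apply: eq_bigr => m _; rewrite ExZl 1?mulrC//; exact: bmeas_fA.
by case: (leqP j1 j2) => _; ring.
Qed.

(** ** Variances *)

Context (B Kc L : R).
Hypotheses (B0 : 0 <= B) (Kc0 : 0 <= Kc) (L0 : 0 <= L).
Hypotheses (hA : forall o, `|Ac o| <= B) (hY : forall o, `|Yc o| <= B).
Hypothesis hK : forall j (x y : d.-tuple R), (J0 <= j)%N ->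
  `|proj_kernel w j x y| <= Kc * 2 ^+ (j * d) * near_ind L j y x.

Let sqB (c : datum R d -> R) o : (forall o, `|c o| <= B) -> c o ^+ 2 <= B ^+ 2.
Proof. by move=> hc; rewrite -(real_normK (num_real (c o))) lerXn2r ?nnegrE. Qed.

(** The factor c is bounded, and the Phi m are orthonormal for the law of X.
   *)
Let bessel_score (c : datum R d -> R) j : bmeas c -> (forall o, `|c o| <= B) -> (J0 <= j)%N ->
  bessel P (B ^+ 2) (fun (m : loc d w j) o => c o * Phi m (Xc o)).
Proof.
move=> b_c hc J0j v; have bPhi := @bmeas_PhiX j.
have cF : cmeas (fun x : d.-tuple R => \sum_(m : loc d w j) v m * Phi m x).
  by apply: cmeas_sum => m; apply: cmeasM; [exact: cmeas_cst|exact: (cmeas_Phi w_CDV)].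
apply: (@le_trans _ _ (Ex P (fun o => B ^+ 2 * (\sum_(m : loc d w j) v m * Phi m (Xc o)) ^+ 2))).
  apply: le_Ex; [by bm|by bm|move=> o].
  rewrite (_ : \sum_m _ = c o * \sum_(m : loc d w j) v m * Phi m (Xc o)); last first.
    by rewrite mulr_sumr; apply: eq_bigr => m _; ring.
  by rewrite exprMn ler_wpM2r ?sqr_ge0// sqB.
rewrite ExZl; last by bm.
rewrite ler_wpM2l ?sqr_ge0// (Ex_law_retract lawX (g := fun x => (\sum_(m : loc d w j) v m * Phi m x) ^+ 2)); last exact: cmeasX.
rewrite le_eqVlt; apply/orP; left; apply/eqP.
transitivity (ip (fun x => \sum_(m : loc d w j) v m * Phi m x) (fun x => \sum_(m : loc d w j) v m * Phi m x)).
  by apply: eq_Ec => x _; rewrite expr2.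
rewrite ip_suml//; last by move=> m; exact: (cmeas_Phi w_CDV).
apply: eq_bigr => m _; rewrite expr2; congr (_ * _).
rewrite ipC ip_suml; [|by move=> m'; exact: (cmeas_Phi w_CDV)|exact: (cmeas_Phi w_CDV)].
rewrite (bigD1 m)//= (ip_Phi w_CDV)// eqxx mulr1 big1 ?addr0// => m' mm'.
by rewrite (ip_Phi w_CDV)// (negbTE mm') mulr0.
Qed.

Let near_le1 j (y x : d.-tuple R) : near_ind L j y x <= 1.
Proof. by rewrite near_indP lern1 leq_b1. Qed.

(** The sum is c^2 times the kernel on the diagonal. *)
Let score_sq (c : datum R d -> R) j o : (forall o, `|c o| <= B) -> (J0 <= j)%N ->
  \sum_(m : loc d w j) (c o * Phi m (Xc o)) ^+ 2 <= B ^+ 2 * (Kc * 2 ^+ (j * d)).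
Proof.
move=> hc J0j.
rewrite (_ : \sum_m _ = c o ^+ 2 * proj_kernel w j (Xc o) (Xc o)); last first.
  by rewrite mulr_sumr; apply: eq_bigr => m _; rewrite exprMn -[Phi _ _ * _]expr2.
have k0 : 0 <= Kc * 2 ^+ (j * d) by rewrite mulr_ge0 ?exprn_ge0.
apply: (@le_trans _ _ (c o ^+ 2 * (Kc * 2 ^+ (j * d)))).
  rewrite ler_wpM2l ?sqr_ge0//; apply: le_trans (ler_norm _) _.
  by apply: le_trans (hK _ _ J0j) _; rewrite -[leRHS]mulr1 ler_wpM2l.
by rewrite ler_wpM2r// sqB.
Qed.

Let k : R := 2 ^+ (jm * d).
Let K : R := 2 ^+ (maxn j1 j2 * d).
Let u : R := n%:R^-1.
Let u0 : 0 < u. Proof. by rewrite invr_gt0 ltr0n. Qed.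
Let u0w : 0 <= u. Proof. exact: ltW. Qed.
Let k1 : 1 <= k. Proof. by rewrite exprn_ege1// ler1n. Qed.
Let kK : k <= K.
Proof.
rewrite ler_weXn2l ?ler1n// leq_mul2r; apply/orP; right.
by rewrite (leq_trans (geq_minl _ _))// leq_maxl.
Qed.

Let k0' : 0 <= k. Proof. exact: le_trans ler01 k1. Qed.
Let K0' : 0 <= K. Proof. exact: le_trans k0' kK. Qed.

Definition cT : R := 8 * B ^+ 4 + 6 * B ^+ 4 * Kc + 96 * B ^+ 4 * Kc ^+ 2.

Let B40 : 0 <= B ^+ 4. Proof. by rewrite exprn_ge0. Qed.
Let cT0 : 0 <= cT.
Proof. by rewrite !addr_ge0 ?mulr_ge0 ?exprn_ge0. Qed.

Lemma Var_pluginc : Var mu pluginc <= cT * (u + k * u ^+ 2 + k ^+ 2 * u ^+ 3).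
Proof.
have bd : bmeas (@dot _ _ R _ n (@fA jm) (@fY jm)).
  by apply: bmeas_dot; [exact: bmeas_fA|exact: bmeas_fY].
have V := @Var_dot _ _ R P _ (@fA jm) (@fY jm) (B ^+ 2) (B ^+ 2 * (Kc * k)) n
  (@bmeas_fA jm) (@bmeas_fY jm) (sqr_ge0 B) (bessel_score bA hA J0m)
  (bessel_score bY hY J0m) (fun o => score_sq o hA J0m) (fun o => score_sq o hY J0m).
rewrite /pluginc VarZ//; have u4 : 0 <= (u ^+ 2) ^+ 2 by rewrite sqr_ge0.
apply: le_trans (ler_wpM2l u4 V) _.
have -> : (n%:R : R) = u^-1 by rewrite invrK.
rewrite [leLHS](_ : _ = 8 * B ^+ 4 * u + 6 * B ^+ 4 * Kc * (k * u ^+ 2) +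
    96 * B ^+ 4 * Kc ^+ 2 * (k ^+ 2 * u ^+ 3)); last by field; rewrite gt_eqF.
have x1 : 0 <= u by exact: ltW.
have x2 : 0 <= k * u ^+ 2 by rewrite mulr_ge0 ?exprn_ge0// (le_trans ler01).
have x3 : 0 <= k ^+ 2 * u ^+ 3 by rewrite mulr_ge0 ?exprn_ge0// (le_trans ler01).
have c1 : 0 <= 8 * B ^+ 4 by rewrite mulr_ge0.
have c2 : 0 <= 6 * B ^+ 4 * Kc by rewrite !mulr_ge0.
have c3 : 0 <= 96 * B ^+ 4 * Kc ^+ 2 by rewrite !mulr_ge0 ?exprn_ge0.
rewrite /cT; set a1 := 8 * _ in c1 *; set a2 := _ * Kc in c2 *; set a3 := _ * Kc ^+ 2 in c3 *.
move: (u) (k * u ^+ 2) (k ^+ 2 * u ^+ 3) x1 x2 x3 => y1 y2 y3 x1 x2 x3; nra.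
Qed.

Let Var_U : Var mu U <= B ^+ 4 * u.
Proof.
rewrite VarZ; last by apply: bmeas_Sum; bm.
rewrite Var_Sum; last by bm.
rewrite mulrA (_ : n%:R^-1 ^+ 2 * n%:R = u); last by rewrite /u; field; exact: n0.
rewrite mulrC ler_wpM2r //; apply: le_trans (Var_le_sqr _ _) _; first by bm.
apply: Ex_le_cst; first by bm.
move=> o; have -> : B ^+ 4 = B ^+ 2 * B ^+ 2 by ring.
by rewrite exprMn ler_pM ?sqr_ge0 ?sqB.
Qed.

Lemma Var_INT : Var law (@psi_INT R d w n j1 j2 \o clampS) <=
  (2 * B ^+ 4 + 2 * cT) * (u + k * u ^+ 2 + k ^+ 2 * u ^+ 3).
Proof.
have E : @psi_INT R d w n j1 j2 \o clampS = fun s => U s.1.2 - pluginc s.1.1.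
  by apply/funext => s; exact: INT_clamp.
have b1 : bmeas (fun s : samples R d n => U s.1.2).
  by apply: (bmeas_12 (G := fun z => U z.2)); exact: bmeas_snd.
have b2 : bmeas (fun s : samples R d n => pluginc s.1.1).
  by apply: (bmeas_12 (G := fun z => pluginc z.1)); apply: bmeas_fst; exact: bmeas_pluginc.
rewrite E; apply: le_trans (VarB_le _ b1 b2) _.
rewrite (Var_2 _ bU) (Var_1 _ bmeas_pluginc).
have V1 := Var_U; have V2 := Var_pluginc.
set X := u + _ + _ in V2 *.
have uX : u <= X by rewrite /X -addrA lerDl addr_ge0// !mulr_ge0 ?exprn_ge0.
have V3 := ler_wpM2l B40 uX.
rewrite [leRHS](_ : _ = 2 * (B ^+ 4 * X) + 2 * (cT * X)); last by ring.
by apply: lerD; rewrite ler_pM2l//; exact: le_trans V1 V3.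
Qed.

Let c : R := (2 * L) ^+ d.
Let c0 : 0 <= c. Proof. by rewrite exprn_ge0// mulr_ge0. Qed.
Let nr j (x : d.-tuple R) (o : datum R d) : R := near_ind L j x (Xc o).

Let bnr j x : bmeas (nr j x).
Proof.
by apply: (bmeas_comp _ (bmeas_near_ind L j x));
  apply: (measurableT_comp (@measurable_retract R d)); exact: measurable_obsX.
Qed.

Let Ex_nr j x : Ex P (nr j x) <= c / 2 ^+ (j * d).
Proof.
rewrite (Ex_law_retract lawX (g := near_ind L j x)); last exact: (cmeas_bmeas (bmeas_near_ind L j x)).
apply: le_trans (Ex_near_ind j x L0); rewrite le_eqVlt; apply/orP; left; apply/eqP.
rewrite /Ec; apply: (eq_full_Ex (@measurable_cube R d) (@unif_cube_full R d)).
- by move=> y cy /=; rewrite retract_id.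
- exact: bmeas_meas (cmeas_bmeas (bmeas_near_ind L j x)).
- exact: bmeas_meas (bmeas_near_ind L j x).
Qed.

(** The kernel at level j is localised near x: an estimate at x is bounded by
   the number of observations near x. *)
Let hat_le (cc : datum R d -> R) j x (D : smp) : (forall o, `|cc o| <= B) -> (J0 <= j)%N ->
  (n%:R^-1 * \sum_(i < n) cc (tnth D i) * proj_kernel w j (Xc (tnth D i)) x) ^+ 2 <=
  (B * Kc) ^+ 2 * (u ^+ 2 * (2 ^+ (j * d)) ^+ 2) * Sum (nr j x) D ^+ 2.
Proof.
move=> hc J0j.
have nr0 o : 0 <= nr j x o by rewrite /nr near_indP.
have -> : (B * Kc) ^+ 2 * (u ^+ 2 * (2 ^+ (j * d)) ^+ 2) * Sum (nr j x) D ^+ 2 =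
  (u * \sum_(i < n) B * (Kc * 2 ^+ (j * d) * nr j x (tnth D i))) ^+ 2.
  by rewrite -mulr_sumr -mulr_sumr -/(Sum _ _); ring.
rewrite -(real_normK (num_real (_ * _))) lerXn2r ?nnegrE//.
  by rewrite mulr_ge0 // sumr_ge0// => i _; rewrite !mulr_ge0 ?exprn_ge0.
rewrite normrM ger0_norm ?ler_wpM2l//.
apply: le_trans (ler_norm_sum _ _ _) _; apply: ler_sum => i _.
by rewrite normrM ler_pM// hK.
Qed.

Definition c2 : R := (B * Kc) ^+ 2 * (c + c ^+ 2).

Lemma Ex_hat_sq (cc : datum R d -> R) j x : (forall o, `|cc o| <= B) -> bmeas cc ->
  (J0 <= j)%N -> 2 ^+ (j * d) <= K ->
  Ex mu (fun D : smp => (n%:R^-1 * \sum_(i < n) cc (tnth D i) * proj_kernel w j (Xc (tnth D i)) x) ^+ 2)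
  <= c2 * (1 + K * u).
Proof.
move=> hc b_c J0j jK; set q : R := 2 ^+ (j * d) in jK *.
have q0 : 0 < q by rewrite exprn_gt0.
have bKx : bmeas (fun o => proj_kernel w j (Xc o) x).
  by apply: bmeas_sum => m; apply: bmeasM; [exact: bmeas_PhiX|exact: bmeas_cst].
have bS : bmeas (@Sum _ _ _ n (nr j x)) by exact: bmeas_Sum.
apply: (@le_trans _ _ (Ex mu (fun D => (B * Kc) ^+ 2 * (u ^+ 2 * q ^+ 2) * Sum (nr j x) D ^+ 2))).
  apply: le_Ex; [|by bm|by move=> D; exact: hat_le].
  apply: bmeasX; apply: bmeasM; first exact: bmeas_cst.
  by apply: bmeas_sum => i; apply: (bmeas_tnth (f := fun o => cc o * proj_kernel w j (Xc o) x)); bm.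
rewrite ExZl; last by bm.
have H := @Ex_sqr_count _ _ R P (nr j x) (c / q) (bnr j x) (fun o => near_ind01 L j x (Xc o)) (Ex_nr j x) n.
have z0 : 0 <= (B * Kc) ^+ 2 * (u ^+ 2 * q ^+ 2).
  by apply: mulr_ge0; [exact: sqr_ge0|apply: mulr_ge0; exact: sqr_ge0].
apply: le_trans (ler_wpM2l z0 H) _.
have -> : (n%:R : R) = u^-1 by rewrite invrK.
rewrite [leLHS](_ : _ = (B * Kc) ^+ 2 * (c * (q * u) + c ^+ 2)); last first.
  by field; rewrite !gt_eqF.
rewrite /c2 -mulrA ler_wpM2l ?sqr_ge0//.
have quK : q * u <= K * u by rewrite ler_wpM2r //.
have Ku0 : 0 <= K * u by rewrite mulr_ge0 // (lt_le_trans q0).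
have cc0 : 0 <= c ^+ 2 by rewrite sqr_ge0.
by have := c0; nra.
Qed.

Definition c4 : R := (B * Kc) ^+ 4 * (2 * c + 10 * c ^+ 2 + 4 * c ^+ 3 + 2 * c ^+ 4).

(** The neighbourhoods of x at the two levels are nested, with probabilities
   of order 1/k and 1/K: the moment of nested counts is expanded and each term
   compared with one of the four on the right. *)
Lemma Ex_hat4 x : Ex mu (fun D => (pc j1 D x) ^+ 2 * (bc j2 D x) ^+ 2) <=
  c4 * (1 + K * u + k * K * u ^+ 2 + k ^+ 2 * K * u ^+ 3).
Proof.
have k0 : 0 < k by exact: lt_le_trans ltr01 k1.
have K0 : 0 < K by exact: lt_le_trans k0 kK.
have bS j : bmeas (@Sum _ _ _ n (nr j x)) by exact: bmeas_Sum.
pose jM := maxn j1 j2.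
have E D : Sum (nr j1 x) D ^+ 2 * Sum (nr j2 x) D ^+ 2 = Sum (nr jm x) D ^+ 2 * Sum (nr jM x) D ^+ 2.
  by rewrite /jM; case: (leqP j1 j2) => // _; rewrite mulrC.
have E' : (2 ^+ (j1 * d)) ^+ 2 * (2 ^+ (j2 * d)) ^+ 2 = k ^+ 2 * K ^+ 2.
  by rewrite /k /K; case: (leqP j1 j2) => // _; rewrite mulrC.
have bp : bmeas (fun D => pc j1 D x).
  under eq_fun do rewrite pcE; apply: bmeasM; first exact: bmeas_cst.
  by apply: bmeas_sum => m; apply: bmeasM; [apply: bmeas_Sum; exact: bmeas_fA|exact: bmeas_cst].
have bb : bmeas (fun D => bc j2 D x).
  under eq_fun do rewrite bcE; apply: bmeasM; first exact: bmeas_cst.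
  by apply: bmeas_sum => m; apply: bmeasM; [apply: bmeas_Sum; exact: bmeas_fY|exact: bmeas_cst].
have bS1 := bS jm; have bS2 := bS jM.
pose z := (B * Kc) ^+ 4 * (u ^+ 4 * (k ^+ 2 * K ^+ 2)).
apply: (@le_trans _ _ (Ex mu (fun D => z * (Sum (nr jm x) D ^+ 2 * Sum (nr jM x) D ^+ 2)))).
  apply: le_Ex; [by bm|by bm|move=> D].
  rewrite -E; apply: (@le_trans _ _ (((B * Kc) ^+ 2 * (u ^+ 2 * (2 ^+ (j1 * d)) ^+ 2) * Sum (nr j1 x) D ^+ 2) *
     ((B * Kc) ^+ 2 * (u ^+ 2 * (2 ^+ (j2 * d)) ^+ 2) * Sum (nr j2 x) D ^+ 2))).
    apply: ler_pM; rewrite ?sqr_ge0//.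
    - have := hat_le x D hA J01; congr (_ ^+ 2 <= _); rewrite /pc /p_hat /sample_mean.
      by congr (_ * _); apply: eq_bigr => i _; rewrite tnth_map.
    - have := hat_le x D hY J02; congr (_ ^+ 2 <= _); rewrite /bc /b_hat /sample_mean.
      by congr (_ * _); apply: eq_bigr => i _; rewrite tnth_map.
  by rewrite le_eqVlt; apply/orP; left; apply/eqP; rewrite /z -E'; ring.
rewrite ExZl; last by bm.
have jmM : (jm <= jM)%N by rewrite (leq_trans (geq_minl _ _))// leq_maxl.
have H := @Ex_count4 _ _ R P (nr jm x) (nr jM x) (c / k) (c / K) (bnr _ x) (bnr _ x)
  (fun o => near_ind01 L jm x (Xc o)) (fun o => near_ind_mono x (Xc o) L0 jmM)
  (Ex_nr jm x) (Ex_nr jM x) n.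
have z0 : 0 <= z by rewrite !mulr_ge0 ?exprn_ge0 ?mulr_ge0//.
apply: le_trans (ler_wpM2l z0 H) _.
have -> : (n%:R : R) = u^-1 by rewrite invrK.
rewrite [leLHS](_ : _ = (B * Kc) ^+ 4 * (2 * c * (k ^+ 2 * K * u ^+ 3) + 2 * c ^+ 2 * (k * K * u ^+ 2)
   + 2 * c ^+ 3 * (K * u) + 8 * c ^+ 2 * (k ^+ 2 * u ^+ 2) + 2 * c ^+ 3 * (k * u) + 2 * c ^+ 4)); last first.
  by rewrite /z; field; rewrite !gt_eqF.
rewrite /c4 -[leRHS]mulrA ler_wpM2l ?exprn_ge0 ?mulr_ge0//.
have p1 : 0 <= k ^+ 2 * K * u ^+ 3 by rewrite !mulr_ge0 ?exprn_ge0 //.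
have p2 : 0 <= k * K * u ^+ 2 by rewrite !mulr_ge0 ?exprn_ge0 //.
have p3 : 0 <= K * u by rewrite mulr_ge0 //.
have p4 : k * u <= K * u by rewrite ler_wpM2r //.
have p5 : k ^+ 2 * u ^+ 2 <= k * K * u ^+ 2.
  by rewrite ler_wpM2r ?sqr_ge0// expr2 ler_wpM2l.
have d1 : 0 <= c by []. have d2 : 0 <= c ^+ 2 by rewrite exprn_ge0.
have d3 : 0 <= c ^+ 3 by rewrite exprn_ge0. have d4 : 0 <= c ^+ 4 by rewrite exprn_ge0.
move: (c) (c ^+ 2) (c ^+ 3) (c ^+ 4) (k ^+ 2 * K * u ^+ 3) (k * K * u ^+ 2) (K * u)
  (k * u) (k ^+ 2 * u ^+ 2) d1 d2 d3 d4 p1 p2 p3 p4 p5 => e1 e2 e3 e4 x1 x2 x3 x4 x5 *.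
pose X := 1 + x3 + x2 + x1; rewrite -/X.
have [X1 X2 X3] : [/\ x1 <= X, x2 <= X & x3 <= X] by rewrite /X; split; lra.
have [X4 X5 X6] : [/\ x4 <= X, x5 <= X & 1 <= X] by rewrite /X; split; lra.
rewrite [leRHS](_ : _ = 2 * e1 * X + 2 * e2 * X + 2 * e3 * X + 8 * e2 * X + 2 * e3 * X + 2 * e4 * X); last by ring.
by rewrite -[X in _ + X <= _]mulr1 !lerD// ler_wpM2l// mulr_ge0.
Qed.

Let rate4 : R := u + K * u ^+ 2 + k * K * u ^+ 3 + k ^+ 2 * K * u ^+ 4.

Let Var_pluginc4 : Var mu pluginc <= cT * rate4.
Proof.
apply: le_trans Var_pluginc _; rewrite ler_wpM2l//.
have p1 : k * u ^+ 2 <= K * u ^+ 2 by rewrite ler_wpM2r ?sqr_ge0.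
have p2 : k ^+ 2 * u ^+ 3 <= k * K * u ^+ 3.
  by rewrite ler_wpM2r ?exprn_ge0 // expr2 ler_wpM2l.
have p3 : 0 <= k ^+ 2 * K * u ^+ 4 by rewrite !mulr_ge0 ?exprn_ge0//.
by rewrite /rate4; lra.
Qed.

Let c20 : 0 <= c2.
Proof. by apply: mulr_ge0; [exact: sqr_ge0|rewrite addr_ge0// exprn_ge0]. Qed.

Let u_le_rate4 : u <= rate4.
Proof.
by rewrite /rate4 -!addrA lerDl !addr_ge0 ?mulr_ge0 ?exprn_ge0//.
Qed.

Let Ex_gMC_sq : Ex mu (fun D => Ex P (fun o => gMC (D, o) ^+ 2)) <=
  c4 * (1 + K * u + k * K * u ^+ 2 + k ^+ 2 * K * u ^+ 3).
Proof.
have bg2 : bmeas (fun z => gMC z ^+ 2) by bm.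
rewrite (Ex_swap mu P bg2); apply: Ex_le_cst; first exact: (bmeas_Ex1 mu P bg2).
move=> o; apply: le_trans (Ex_hat4 (Xc o)); rewrite le_eqVlt; apply/orP; left; apply/eqP.
by apply: eq_Ex => D; rewrite exprMn.
Qed.

Let rate4E : u * (1 + K * u + k * K * u ^+ 2 + k ^+ 2 * K * u ^+ 3) = rate4.
Proof. by rewrite /rate4; ring. Qed.

Lemma Var_MC : Var law (@psi_MC R d w n j1 j2 \o clampS) <=
  (2 * B ^+ 4 + 2 * c4 + 2 * cT) * rate4.
Proof.
have E : @psi_MC R d w n j1 j2 \o clampS = fun s => U s.1.2 - cmean gMC (s.1.1, s.2).
  by apply/funext => s; exact: MC_clamp.
have b1 : bmeas (fun s : samples R d n => U s.1.2).
  by apply: (bmeas_12 (G := fun z => U z.2)); exact: bmeas_snd.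
have bcm := bmeas_cmean n bgMC.
rewrite E; apply: le_trans (VarB_le _ b1 (bmeas_13 bcm)) _.
rewrite (Var_2 _ bU) (Var_13 _ bcm).
have V := Var_cmean mu P n_gt0 bgMC.
rewrite (_ : (fun x => Ex P (fun o => gMC (x, o))) = pluginc) in V; last first.
  by apply/funext => D; exact: Ex_gMC.
have V1 := ler_wpM2l (ltW u0) Ex_gMC_sq; rewrite mulrCA rate4E in V1.
have V2 := Var_pluginc4; have V3 := Var_U.
have V4 := ler_wpM2l B40 u_le_rate4.
rewrite [leRHS](_ : _ = 2 * (B ^+ 4 * rate4) + 2 * (c4 * rate4 + cT * rate4)); last by ring.
apply: lerD; rewrite ler_pM2l//; first exact: le_trans V3 V4.
exact: le_trans V (lerD V1 V2).
Qed.

(** A sum of independent terms with square summable coefficients E[f m], by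
   duality. *)
Let Var_lin j (f g : loc d w j -> datum R d -> R) :
  (forall m, bmeas (f m)) -> (forall m, bmeas (g m)) ->
  bessel P (B ^+ 2) f -> bessel P (B ^+ 2) g ->
  Var mu (fun D => n%:R^-1 * Sum (fun o => \sum_m Ex P (f m) * g m o) D) <= B ^+ 4 * u.
Proof.
move=> bf bg Bf Bg.
rewrite VarZ; last by apply: bmeas_Sum; bm.
rewrite Var_Sum; last by bm.
rewrite mulrA (_ : n%:R^-1 ^+ 2 * n%:R = u); last by rewrite /u; field; exact: n0.
rewrite mulrC ler_wpM2r //; apply: le_trans (Var_le_sqr _ _) _; first by bm.
apply: le_trans (Bg _) _; rewrite (_ : B ^+ 4 = B ^+ 2 * B ^+ 2); last by ring.
by rewrite ler_wpM2l ?sqr_ge0//; apply: Ex_bessel => //; exact: sqr_ge0.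
Qed.

Let Ex_gIF_sq : Ex mu (fun D => Ex P (fun o => gIF (D, o) ^+ 2)) <=
  4 * B ^+ 4 + 8 * B ^+ 2 * c2 * (1 + K * u) +
  4 * (c4 * (1 + K * u + k * K * u ^+ 2 + k ^+ 2 * K * u ^+ 3)).
Proof.
have bg2 : bmeas (fun z => gIF z ^+ 2) by bm.
rewrite (Ex_swap mu P bg2); apply: Ex_le_cst; first exact: (bmeas_Ex1 mu P bg2).
move=> o.
have bp : bmeas (fun D => pc j1 D (Xc o)) by exact: (bmeas_pair2 o (bmeas_pcX j1)).
have bb : bmeas (fun D => bc j2 D (Xc o)) by exact: (bmeas_pair2 o (bmeas_bcX j2)).
apply: (@le_trans _ _ (Ex mu (fun D => 4 * B ^+ 4 + 4 * B ^+ 2 * pc j1 D (Xc o) ^+ 2 +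
   4 * B ^+ 2 * bc j2 D (Xc o) ^+ 2 + 4 * (pc j1 D (Xc o) ^+ 2 * bc j2 D (Xc o) ^+ 2)))).
  apply: le_Ex; [exact: (bmeas_pair2 o bg2)|by bm|move=> D].
  rewrite /gIF /= exprMn.
  apply: (@le_trans _ _ ((2 * B ^+ 2 + 2 * pc j1 D (Xc o) ^+ 2) * (2 * B ^+ 2 + 2 * bc j2 D (Xc o) ^+ 2))).
    apply: ler_pM; rewrite ?sqr_ge0//.
    - apply: le_trans (sqrrD_le _ _) _; rewrite sqrrN lerD2r ler_pM2l//; exact: sqB.
    - apply: le_trans (sqrrD_le _ _) _; rewrite sqrrN lerD2r ler_pM2l//; exact: sqB.
  by rewrite le_eqVlt; apply/orP; left; apply/eqP; ring.
rewrite !ExD ?ExZl ?Ex_cst//; [|by bm..].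
have h4 := Ex_hat4 (Xc o).
have q1 : 2 ^+ (j1 * d) <= K by rewrite ler_weXn2l ?ler1n// leq_mul2r leq_maxl orbT.
have q2 : 2 ^+ (j2 * d) <= K by rewrite ler_weXn2l ?ler1n// leq_mul2r leq_maxr orbT.
have hp : Ex mu (fun D => pc j1 D (Xc o) ^+ 2) <= c2 * (1 + K * u).
  apply: le_trans (Ex_hat_sq (Xc o) hA bA J01 q1); rewrite le_eqVlt; apply/orP; left; apply/eqP.
  apply: eq_Ex => D; congr (_ ^+ 2); rewrite /pc /p_hat /sample_mean.
  by congr (_ * _); apply: eq_bigr => i _; rewrite tnth_map.
have hb : Ex mu (fun D => bc j2 D (Xc o) ^+ 2) <= c2 * (1 + K * u).
  apply: le_trans (Ex_hat_sq (Xc o) hY bY J02 q2); rewrite le_eqVlt; apply/orP; left; apply/eqP.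
  apply: eq_Ex => D; congr (_ ^+ 2); rewrite /bc /b_hat /sample_mean.
  by congr (_ * _); apply: eq_bigr => i _; rewrite tnth_map.
have B20 := sqr_ge0 B.
have hp' := ler_wpM2l B20 hp; have hb' := ler_wpM2l B20 hb.
by lra.
Qed.

(** Given the first subsample, the mean of the estimator is the plug-in
   statistic corrected by two linear statistics, of variance O(1/n). *)
Lemma Var_IF : Var law (@psi_IF R d w n j1 j2 \o clampS) <=
  (12 * B ^+ 4 + 8 * B ^+ 2 * c2 + 4 * c4 + 2 * cT) * rate4.
Proof.
have E : @psi_IF R d w n j1 j2 \o clampS = fun s => cmean gIF s.1.
  by apply/funext => s; exact: IF_clamp.
have bcm := bmeas_cmean n bgIF.
rewrite E (Var_12 _ bcm).
have V := Var_cmean mu P n_gt0 bgIF; rewrite -/u in V.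
have bp := bmeas_pluginc.
have Vh : Var mu (fun D => Ex P (fun o => gIF (D, o))) <= 2 * (cT * rate4) + 8 * (B ^+ 4 * u).
  rewrite (_ : (fun D => _) = fun D => (pluginc D - (linY D + linA D)) + Ex P (fun o => Ac o * Yc o)); last first.
    by apply/funext => D; rewrite Ex_gIF; ring.
  rewrite VarDc; last by bm.
  apply: le_trans (VarB_le _ _ _) _; [by bm|by bm|].
  have VD := VarD_le mu b_linY b_linA.
  have VY : Var mu linY <= B ^+ 4 * u.
    apply: Var_lin; [exact: bmeas_fA|exact: bmeas_fY|exact: (bessel_score bA hA J02)|exact: (bessel_score bY hY J02)].
  have VA : Var mu linA <= B ^+ 4 * u.
    apply: Var_lin; [exact: bmeas_fY|exact: bmeas_fA|exact: (bessel_score bY hY J01)|exact: (bessel_score bA hA J01)].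
  rewrite [leRHS](_ : _ = 2 * (cT * rate4) + 2 * (2 * (B ^+ 4 * u) + 2 * (B ^+ 4 * u)));
    last by ring.
  apply: lerD; rewrite ler_pM2l//; apply: le_trans VD _.
  exact: lerD (ler_wpM2l (ler0n R 2) VY) (ler_wpM2l (ler0n R 2) VA).
have V1 := ler_wpM2l (ltW u0) Ex_gIF_sq.
have V4 := ler_wpM2l B40 u_le_rate4.
have Ku : u * (1 + K * u) <= rate4.
  rewrite (_ : u * _ = u + K * u ^+ 2); last by ring.
  by rewrite /rate4 -!addrA lerD2l lerDl addr_ge0// !mulr_ge0 ?exprn_ge0//.
have B2c20 : 0 <= B ^+ 2 * c2 by rewrite mulr_ge0 ?sqr_ge0.
have V5 := ler_wpM2l B2c20 Ku.
have V6 : u * (c4 * (1 + K * u + k * K * u ^+ 2 + k ^+ 2 * K * u ^+ 3)) = c4 * rate4.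
  by rewrite mulrCA rate4E.
apply: le_trans V _.
rewrite !mulrDr in V1.
apply: (@le_trans _ _ (4 * (B ^+ 4 * u) + 8 * (B ^+ 2 * c2 * (u * (1 + K * u))) + 4 * (c4 * rate4)
   + (2 * (cT * rate4) + 8 * (B ^+ 4 * u)))); last by lra.
apply: lerD; last exact: Vh.
apply: le_trans (ler_wpM2l (ltW u0) Ex_gIF_sq) _.
by rewrite -V6 le_eqVlt; apply/orP; left; apply/eqP; ring.
Qed.

Lemma kappa_le : `|kappa| <= B ^+ 2 * (Kc * k).
Proof.
have bF := @bmeas_fA jm; have bG := @bmeas_fY jm.
apply: normr_Ex_le; first by bm.
by move=> o; apply: normr_sumM_le; exact: score_sq.
Qed.

Lemma dotc_le : `|dotc jm| <= B ^+ 2.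
Proof.
have B2 := sqr_ge0 B.
apply: normr_sumM_le; apply: Ex_bessel => //.
- exact: bmeas_fA.
- exact: (bessel_score bA hA J0m).
- exact: bmeas_fY.
- exact: (bessel_score bY hY J0m).
Qed.

End clamped_estimators.

(** * Laws with prescribed regression functions and conditional covariance *)

Section sign_law.
Context (R : realType) (d : nat).
Variables (p b c : d.-tuple R -> R) (del : R).
Hypotheses (bp : bmeas p) (bb : bmeas b) (bc : bmeas c).

(** A fair sign, driven by a uniform variable. *)
Definition fair_sign (u : R) : R := 2 * \1_[set u : R | u <= 2^-1] u - 1.

Lemma bmeas_fair_sign : bmeas fair_sign.
Proof.
have m : measurable [set u : R | u <= 2^-1].
  by rewrite -[X in measurable X]set_itvNyc; exact: measurable_itv.
by apply: bmeasB; [apply: bmeasM; [exact: bmeas_cst|exact: bmeas_indic]|exact: bmeas_cst].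
Qed.

Lemma fair_sign_sqr u : fair_sign u ^+ 2 = 1.
Proof. by rewrite /fair_sign indicE; case: (_ \in _) => /=; ring. Qed.

Lemma fair_sign_norm u : `|fair_sign u| = 1.
Proof.
rewrite /fair_sign indicE; case: (_ \in _) => /=.
  by rewrite mulr1 ger0_norm; lra.
by rewrite mulr0 sub0r normrN1.
Qed.

Lemma Ex_fair_sign : Ex (@unif01 R) fair_sign = 0.
Proof.
have m : measurable [set u : R | u <= 2^-1].
  by rewrite -[X in measurable X]set_itvNyc; exact: measurable_itv.
have bi := bmeas_indic R m.
rewrite ExB ?Ex_cst; [|by apply: bmeasM => //; exact: bmeas_cst|exact: bmeas_cst].
rewrite ExZl// (_ : Ex _ _ = 2^-1); last first.
  by rewrite -[RHS](unif01_le (t := 2^-1))//; lra.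
by rewrite divff ?subrr.
Qed.

(** A and Y share the sign, which makes their conditional covariance equal to
   del c. *)
Definition signed_datum (z : d.-tuple R * R) : datum R d :=
  (z.1, p z.1 + del * fair_sign z.2, b z.1 + c z.1 * fair_sign z.2).

Let Q : probability (d.-tuple R * R)%type R := prod_prob (unif_cube R d) (@unif01 R).

Let bs2 : bmeas (fun z : d.-tuple R * R => fair_sign z.2).
Proof. by apply: bmeas_snd; exact: bmeas_fair_sign. Qed.
Let bp1 : bmeas (fun z : d.-tuple R * R => p z.1). Proof. exact: bmeas_fst. Qed.
Let bb1 : bmeas (fun z : d.-tuple R * R => b z.1). Proof. exact: bmeas_fst. Qed.
Let bc1 : bmeas (fun z : d.-tuple R * R => c z.1). Proof. exact: bmeas_fst. Qed.

Lemma measurable_signed_datum : measurable_fun setT signed_datum.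
Proof.
apply: measurable_fun_pair; last by apply: bmeas_meas; bm.
apply: measurable_fun_pair; first exact: measurable_fst.
by apply: bmeas_meas; bm.
Qed.

Let X : {RV Q >-> datum R d} := MeasurableFun.Pack (MeasurableFun.Class
  (isMeasurableFun.Build _ _ _ _ _ measurable_signed_datum)).

Definition sign_law : probability (datum R d) R := distribution Q X.

Lemma sign_law_surely (G : set (datum R d)) : (forall z, G (signed_datum z)) ->
  sign_law G = 1%E.
Proof.
move=> h; rewrite /sign_law /= /distribution /pushforward.
rewrite (_ : _ @^-1` _ = setT) ?probability_setT//.
by apply/seteqP; split=> // z _; exact: h.
Qed.

Lemma sign_law_X B : measurable B -> sign_law (@obsX R d @^-1` B) = unif_cube R d B.
Proof.
move=> mB; rewrite /sign_law /= /distribution /pushforward.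
rewrite (_ : _ @^-1` _ = B `*` setT); last first.
  by apply/seteqP; split=> z /=; [move=> ?; split|case].
rewrite /Q /= /prod_prob product_measure1E//.
by rewrite -[RHS]mule1; congr (_ * _)%E; exact: probability_setT.
Qed.

(** The sign is centred and independent of X. *)
Lemma Ex_sign (g h : d.-tuple R -> R) : bmeas g -> bmeas h ->
  Ex Q (fun z => g z.1 + h z.1 * fair_sign z.2) = Ex (unif_cube R d) g.
Proof.
move=> bg bh; have bg1 : bmeas (fun z : d.-tuple R * R => g z.1) by exact: bmeas_fst.
have bh1 : bmeas (fun z : d.-tuple R * R => h z.1) by exact: bmeas_fst.
rewrite Ex_prod; last by bm.
apply: eq_Ex => x /=; have bs := bmeas_fair_sign.
by rewrite ExD ?Ex_cst ?ExZl ?Ex_fair_sign ?mulr0 ?addr0//; bm.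
Qed.

Lemma Ex_sign_law (f : datum R d -> R) : measurable_fun setT f -> bmeas (f \o signed_datum) ->
  (\int[sign_law]_o (f o)%:E)%E = (Ex Q (f \o signed_datum))%:E.
Proof.
move=> mf bf; rewrite [LHS]integral_distribution//.
- by rewrite ExE.
- exact/measurable_EFinP.
- exact: (bmeas_integrable Q bf).
Qed.

Lemma sign_law_cond_exp (f : datum R d -> R) (g h : d.-tuple R -> R) :
  measurable_fun setT f -> bmeas g -> bmeas h ->
  (forall z, f (signed_datum z) = g z.1 + h z.1 * fair_sign z.2) ->
  is_cond_exp sign_law f g.
Proof.
move=> mf bg bh fE.
have bg1 : bmeas (fun z : d.-tuple R * R => g z.1) by exact: bmeas_fst.
have bh1 : bmeas (fun z : d.-tuple R * R => h z.1) by exact: bmeas_fst.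
have bgX : bmeas (fun o : datum R d => g (obsX o)).
  by apply: bmeas_comp bg; exact: measurable_obsX.
split; [exact: bmeas_meas|exact: bmeas_integrable bgX|].
move=> B mB; have b1 : bmeas (fun x : d.-tuple R => \1_B x : R) by exact: bmeas_indic.
have b11 : bmeas (fun z : d.-tuple R * R => \1_B z.1 : R) by exact: bmeas_fst.
have b1X : bmeas (fun o : datum R d => \1_B (obsX o) : R).
  by apply: bmeas_comp b1; exact: measurable_obsX.
have m1X := bmeas_meas b1X.
have E2 : (fun o => f o * \1_B (obsX o)) \o signed_datum =
    fun z => g z.1 * \1_B z.1 + (h z.1 * \1_B z.1) * fair_sign z.2.
  by apply/funext => z /=; rewrite fE /obsX/=; ring.
rewrite !integral_preX (Ex_sign_law (f := fun o => g (obsX o) * \1_B (obsX o))); last first.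
- by rewrite (_ : _ \o _ = fun z => g z.1 * \1_B z.1)//; bm.
- by apply: bmeas_meas; bm.
rewrite (Ex_sign_law (f := fun o => f o * \1_B (obsX o))); last first.
- by rewrite E2; bm.
- exact: measurable_funM.
congr EFin; rewrite E2 (Ex_sign (g := fun x => g x * \1_B x) (h := fun x => h x * \1_B x)); [|by bm|by bm].
by rewrite -(Ex_fst (unif_cube R d) (@unif01 R) (g := fun x => g x * \1_B x)); last by bm.
Qed.

End sign_law.

Section model_laws.
Context (R : realType) (d : nat) (w : wavelets R) (S J0 : nat).
Hypotheses (d_gt0 : (0 < d)%N) (w_CDV : is_CDV_basis d w S J0).
Context (alpha beta M C1 C2 : R).

Lemma holder_ball_retract gam (h : d.-tuple R -> R) : holder_ball w J0 gam M h ->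
  holder_ball w J0 gam M (h \o @retract R d).
Proof.
move=> [uch hM]; split.
  move=> e /uch[r r0 H]; exists r => // x y cx cy xy.
  by rewrite /= !retract_id//; exact: H.
have E (g : d.-tuple R -> R) : inner (h \o @retract R d) g = inner h g.
  apply: eq_Rintegral => x; rewrite inE => cx /=; by rewrite retract_id.
move: hM; rewrite /holder_norm.
under eq_bigr do rewrite -E.
rewrite (_ : [set u | exists l (o : orient d) (m : loc d w l), [/\ (J0 <= l)%N, o != orient0 d &
    u = (2 `^ (l%:R * (gam + d%:R / 2)) * `|inner h (Psi o m)|)%:E]] =
  [set u | exists l (o : orient d) (m : loc d w l), [/\ (J0 <= l)%N, o != orient0 d &
    u = (2 `^ (l%:R * (gam + d%:R / 2)) * `|inner (h \o @retract R d) (Psi o m)|)%:E]])//.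
by apply/seteqP; split=> u [l [v [m [h1 h2 ->]]]]; exists l, v, m; split=> //; rewrite E.
Qed.

(** Perturbing A and Y by multiples of the same fair sign keeps the regression
    functions and adds del c to the conditional covariance. *)
Lemma model_law (p b c : d.-tuple R -> R) (del : R) :
  holder_ball w J0 alpha M p -> holder_ball w J0 beta M b -> cmeas c ->
  (forall x, cube x -> [/\ C1 <= p x - `|del|, p x + `|del| <= C2,
     C1 <= b x - `|c x| & b x + `|c x| <= C2]) ->
  exists2 P, model w J0 alpha beta M C1 C2 P &
    [/\ is_cond_exp P (@obsA R d) (p \o @retract R d),
      is_cond_exp P (@obsY R d) (b \o @retract R d) &
      forall j1 j2, kappa w C1 C2 P j1 j2 =
        Ec (fun x => (p x * b x + del * c x) * proj_kernel w (minn j1 j2) x x)].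
Proof.
move=> hp hb cc bds.
have cp := unif_continuous_cmeas hp.1; have cb := unif_continuous_cmeas hb.1.
pose P := sign_law (p := p \o @retract R d) (b := b \o @retract R d)
  (c := c \o @retract R d) del cp cb cc.
have sgn_bd (a e u : R) : a - `|e| <= a + e * fair_sign u <= a + `|e|.
  have : `|e * fair_sign u| <= `|e| by rewrite normrM fair_sign_norm mulr1.
  by rewrite ler_norml => /andP[h1 h2]; apply/andP; split; lra.
have bd z : C1 <= obsA (signed_datum (p \o @retract R d) (b \o @retract R d) (c \o @retract R d) del z) <= C2 /\
    C1 <= obsY (signed_datum (p \o @retract R d) (b \o @retract R d) (c \o @retract R d) del z) <= C2.
  have [h1 h2 h3 h4] := bds _ (retract_cube z.1).
  have /andP[g1 g2] := sgn_bd (p (retract z.1)) del z.2.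
  have /andP[g3 g4] := sgn_bd (b (retract z.1)) (c (retract z.1)) z.2.
  split; rewrite /obsA /obsY /=; apply/andP; split; lra.
have hA : is_cond_exp P (@obsA R d) (p \o @retract R d).
  apply: (sign_law_cond_exp (del := del) cp cb cc (h := fun=> del)) => //.
  - exact: measurable_obsA.
  - exact: bmeas_cst.
have hY : is_cond_exp P (@obsY R d) (b \o @retract R d).
  apply: (sign_law_cond_exp (del := del) cp cb cc (h := c \o @retract R d)) => //.
  exact: measurable_obsY.
have lawX := sign_law_X del cp cb cc.
exists P; first split.
- exact: lawX.
- apply: (full_ae (G := [set o | C1 <= obsA o <= C2] `&` [set o | C1 <= obsY o <= C2])) => //.
  + by apply: measurableI; apply: measurable_between; [exact: measurable_obsA|exact: measurable_obsY].
  + by apply: sign_law_surely => z; exact: bd.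
- by exists (p \o @retract R d) => //; exact: holder_ball_retract.
- by exists (b \o @retract R d) => //; exact: holder_ball_retract.
split => // j1 j2; set j := minn j1 j2.
have C12 : C1 <= C2.
  have [/andP[h1 h2] _] := bd ([tuple 0 | i < d], 0); exact: le_trans h1 h2.
have bF (m : loc d w j) := bmeas_fA w_CDV C12 m.
have bG (m : loc d w j) := bmeas_fY w_CDV C12 m.
have bk : bmeas (fun o => \sum_(m : loc d w j) fA C1 C2 m o * fY C1 C2 m o) by bm.
have bK : bmeas (fun x : d.-tuple R => proj_kernel w j (retract x) (retract x)).
  apply: bmeas_sum => m; apply: bmeasM; exact: (cmeas_Phi w_CDV).
pose g x := (p (retract x) * b (retract x) + del * c (retract x)) *
  proj_kernel w j (retract x) (retract x).
pose h x := (p (retract x) * c (retract x) + del * b (retract x)) *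
  proj_kernel w j (retract x) (retract x).
have cp' : bmeas (fun x => p (retract x)) by exact: cp.
have cb' : bmeas (fun x => b (retract x)) by exact: cb.
have cc' : bmeas (fun x => c (retract x)) by exact: cc.
have bg : bmeas g by rewrite /g; bm.
have bh : bmeas h by rewrite /h; bm.
rewrite /kappa [LHS]Ex_distribution//.
rewrite -[RHS](Ex_sign bg bh); apply: eq_Ex => z.
have [bd1 bd2] := bd z.
rewrite /fA /fY /obsAc /obsYc /= !clamp_id// /g /h /proj_kernel.
rewrite /obsA /obsY /obsXc /obsX /=; set s := fair_sign _.
rewrite !mulr_sumr mulr_suml -big_split/=; apply: eq_bigr => m _.
have s2 : s * s = 1 by rewrite -expr2 fair_sign_sqr.
transitivity ((p (retract z.1) * b (retract z.1) + del * c (retract z.1) * (s * s) +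
  (p (retract z.1) * c (retract z.1) + del * b (retract z.1)) * s) *
  (Phi m (retract z.1) * Phi m (retract z.1))); first by ring.
by rewrite s2; ring.
Qed.

End model_laws.

(** * Bias: the three estimators have the same shape *)

Section bias.
Context (R : realType) (d : nat) (w : wavelets R) (S J0 : nat).
Hypotheses (d_gt0 : (0 < d)%N) (w_CDV : is_CDV_basis d w S J0).
Context (alpha beta M C1 C2 : R).
Hypotheses (alpha_gt0 : 0 < alpha) (beta_gt0 : 0 < beta) (M_gt0 : 0 < M).
Hypothesis feasible : strictly_feasible d w J0 alpha beta M C1 C2.
Notation model_ := (model w J0 alpha beta M C1 C2).
Notation q := (2 `^ (- (alpha + beta)) : R).
Implicit Types (p b : d.-tuple R -> R).

(** The common shape of the three biases: the truncation error at level J and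
   the diagonal term at level j, with weight u = 1/n or u = -1/n. *)
Definition gap p b (kap : R) (J j : nat) (u : R) : R :=
  ip p b - dotp w J p b + u * (dotp w j p b - kap).

Lemma feasible_C12 : C1 <= C2.
Proof.
have [e e0 [p [b [_ _ bd]]]] := feasible.
have c0 : cube ([tuple 0 | i < d] : d.-tuple R) by move=> i; rewrite tnth_mktuple lexx ler01.
by have [/andP[h1 h2] _] := bd _ c0; lra.
Qed.
Let C12 := feasible_C12.

Definition regression P p b := [/\ model_ P, cmeas p, cmeas b,
  is_cond_exp P (@obsA R d) p & is_cond_exp P (@obsY R d) b].

Lemma model_regression P : model_ P -> exists p b,
  [/\ regression P p b, holder_ball w J0 alpha M p & holder_ball w J0 beta M b].
Proof.
move=> mP; case: (mP) => _ _ [p hp ep] [b hb eb]; exists p, b; split=> //.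
by split=> //; [exact: unif_continuous_cmeas hp.1|exact: unif_continuous_cmeas hb.1].
Qed.

(** The coefficient of p on Phi m is the expectation of A Phi m(X). *)
Lemma dotcE P p b j : regression P p b -> dotc w C1 C2 P j = dotp w j p b.
Proof.
move=> [mP cp cb ep eb]; case: (mP) => lawX _ _ _.
apply: eq_bigr => m _; congr (_ * _).
- exact: (Ex_cond_exp lawX (@measurable_obsA R d) (bmeas_obsAc d C12) (ae_obsAc mP) ep cp
    (cmeas_Phi w_CDV m)).
- exact: (Ex_cond_exp lawX (@measurable_obsY R d) (bmeas_obsYc d C12) (ae_obsYc mP) eb cb
    (cmeas_Phi w_CDV m)).
Qed.

Section bias_formulas.
Context (P : probability (datum R d) R) (p b : d.-tuple R -> R) (n j1 j2 : nat).
Hypotheses (reg : regression P p b) (n_gt0 : (0 < n)%N).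
Hypotheses (J01 : (J0 <= j1)%N) (J02 : (J0 <= j2)%N).
Let mP : model_ P. Proof. by case: reg. Qed.
Let lawX : forall B, measurable B -> P (@obsX R d @^-1` B) = unif_cube R d B.
Proof. by case: mP. Qed.
Let admP : P (admissible (d := d) C1 C2) = 1%E. Proof. exact: admissible_full mP. Qed.
Let psiP : psi P = Ex P (fun o => obsAc C1 C2 o * obsYc C1 C2 o) - ip p b.
Proof. by case: reg => _ cp cb ep eb; exact: (psiE C12 mP cp cb ep eb). Qed.

Lemma bias_INT : 'E_(samples_law P n)[(fun s => psi_INT w j1 j2 s - psi P)%R]%E =
  (gap p b (kappa w C1 C2 P j1 j2) (minn j1 j2) (minn j1 j2) n%:R^-1)%:E.
Proof.
have [bE EE] := Ex_INT w_CDV P C12 n_gt0 J01 J02.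
rewrite (E_clamp admP _ (@measurable_psi_INT R d w S J0 w_CDV n j1 j2) bE) EE psiP !(dotcE _ reg).
by congr EFin; rewrite /gap; ring.
Qed.

Lemma bias_MC : 'E_(samples_law P n)[(fun s => psi_MC w j1 j2 s - psi P)%R]%E =
  (gap p b (kappa w C1 C2 P j1 j2) (minn j1 j2) (minn j1 j2) n%:R^-1)%:E.
Proof.
have [bE EE] := Ex_MC w_CDV C12 lawX n_gt0 J01 J02.
rewrite (E_clamp admP _ (@measurable_psi_MC R d w S J0 w_CDV n j1 j2) bE) EE psiP !(dotcE _ reg).
by congr EFin; rewrite /gap; ring.
Qed.

Lemma bias_IF : 'E_(samples_law P n)[(fun s => psi_IF w j1 j2 s - psi P)%R]%E =
  (gap p b (kappa w C1 C2 P j1 j2) (maxn j1 j2) (minn j1 j2) (- n%:R^-1))%:E.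
Proof.
have [bE EE] := Ex_IF w_CDV C12 lawX n_gt0 J01 J02.
rewrite (E_clamp admP _ (@measurable_psi_IF R d w S J0 w_CDV n j1 j2) bE) EE psiP !(dotcE _ reg).
by congr EFin; rewrite /gap; ring.
Qed.

End bias_formulas.

Let B : R := `|C1| + `|C2|.
Let B0 : 0 <= B. Proof. by rewrite addr_ge0. Qed.
Let clamp_le t : `|clamp C1 C2 t| <= B.
Proof. exact: normr_clamp. Qed.

(** The wavelet decay bounds the truncation error; the diagonal term is
   bounded by the size of the kernel. *)
Lemma gap_upper : exists2 C : R, 0 < C & forall P p b j1 j2 J u, model_ P ->
  regression P p b -> holder_ball w J0 alpha M p -> holder_ball w J0 beta M b ->
  (J0 <= j1)%N -> (J0 <= j2)%N -> (J0 <= J)%N ->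
  `|gap p b (kappa w C1 C2 P j1 j2) J (minn j1 j2) u| <=
  C * Num.max (q ^+ J) (2 ^+ (minn j1 j2 * d) * `|u|).
Proof.
have ab0 : 0 < alpha + beta by rewrite addr_gt0.
have [Ca Ca0 hCa] := approximation_error w_CDV ab0 (ltW M_gt0).
have [Kc Kc0 [L L0 hK]] := proj_kernel_le d_gt0 w_CDV.
exists (Ca + (B ^+ 2 + B ^+ 2 * Kc)).
  by rewrite ltr_pwDl// addr_ge0 ?mulr_ge0 ?sqr_ge0// ltW.
move=> P p b j1 j2 J u mP reg hp hb J01 J02 J0J.
case: (mP) => lawX _ _ _; set j := minn j1 j2; set X := Num.max _ _.
have J0j : (J0 <= j)%N by rewrite leq_min J01.
have k1 : 1 <= 2 ^+ (j * d) :> R by rewrite exprn_ege1// ler1n.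
have hAc o : `|@obsAc R d C1 C2 o| <= B by exact: clamp_le.
have hYc o : `|@obsYc R d C1 C2 o| <= B by exact: clamp_le.
have h1 := kappa_le w_CDV P C12 J01 J02 B0 (ltW Kc0) hAc hYc hK.
have h2 := dotc_le w_CDV C12 lawX J01 J02 B0 hAc hYc.
rewrite (dotcE _ reg) -/j in h1 h2.
apply: le_trans (ler_normD _ _) _; rewrite mulrDl; apply: lerD.
  apply: le_trans (hCa _ _ hp hb _ J0J) _; rewrite ler_pM2l//.
  by rewrite /X le_max lexx.
rewrite normrM; apply: (@le_trans _ _ (`|u| * ((B ^+ 2 + B ^+ 2 * Kc) * 2 ^+ (j * d)))).
  rewrite ler_wpM2l//; apply: le_trans (ler_normB _ _) _.
  rewrite mulrDl -[B ^+ 2 * Kc * _]mulrA lerD//; apply: le_trans h2 _.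
  by rewrite -[leLHS]mulr1 ler_wpM2l// sqr_ge0.
rewrite mulrCA [`|u| * _]mulrC ler_wpM2l//; last by rewrite /X le_max lexx orbT.
by rewrite addr_ge0 ?mulr_ge0 ?sqr_ge0// ltW.
Qed.

Let holder_mono gam (M1 M2 : R) (h : d.-tuple R -> R) : M1 <= M2 -> holder_ball w J0 gam M1 h ->
  holder_ball w J0 gam M2 h.
Proof.
move=> M12 [uch hM]; split=> //; apply: le_trans hM _; by rewrite lee_fin.
Qed.

Let Kd j (x : d.-tuple R) : R := proj_kernel w j x x.
Let cKd j : cmeas (Kd j).
Proof.
by apply: cmeas_sum => m; apply: cmeasM; exact: (cmeas_Phi w_CDV).
Qed.

Let Ec_Kd j : (J0 <= j)%N -> Ec (Kd j) = #|loc d w j|%:R.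
Proof.
move=> J0j; rewrite Ec_sum; last by move=> m; apply: cmeasM; exact: (cmeas_Phi w_CDV).
rewrite (eq_bigr (fun=> 1)) ?sumr_const// => m _.
by rewrite -[LHS]/(ip (Phi m) (Phi m)) (ip_Phi w_CDV)// eqxx.
Qed.

Let gap_retract p b kap J j u : gap (p \o @retract R d) (b \o @retract R d) kap J j u = gap p b kap J j u.
Proof.
have E (f g : d.-tuple R -> R) : ip (f \o @retract R d) g = ip f g.
  by apply: eq_ipl => x cx /=; rewrite retract_id.
rewrite /gap /dotp E ipC E (ipC b p).
by congr (_ - _ + _ * (_ - _)); apply: eq_bigr => m _; rewrite !E.
Qed.

(** Laws of the model realising a given pair of regression functions and a given
    conditional covariance. *)
Let realise p b c del : holder_ball w J0 alpha M p -> holder_ball w J0 beta M b -> cmeas c ->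
  (forall x, cube x -> [/\ C1 <= p x - `|del|, p x + `|del| <= C2,
     C1 <= b x - `|c x| & b x + `|c x| <= C2]) ->
  exists P p' b', regression P p' b' /\ forall j1 j2 J u,
    gap p' b' (kappa w C1 C2 P j1 j2) J (minn j1 j2) u =
    gap p b (Ec (fun x => (p x * b x + del * c x) * Kd (minn j1 j2) x)) J (minn j1 j2) u.
Proof.
move=> hp hb cc bds.
have [P mP [ep eb kE]] := model_law w_CDV hp hb cc bds.
exists P, (p \o @retract R d), (b \o @retract R d); split.
  by split=> //; [exact: unif_continuous_cmeas (holder_ball_retract hp).1|
                  exact: unif_continuous_cmeas (holder_ball_retract hb).1].
by move=> j1 j2 J u; rewrite gap_retract kE.
Qed.

(** Two laws with the same regression functions and the conditional
   covariances e^2 and - e^2 only differ in their diagonal terms, the gap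
   between which is 2 |u| e^2 |Z_j|: one of the two biases is at least half of
   it. *)
Lemma gap_lower_diag : exists2 C : R, 0 < C & forall j1 j2 J u,
  (J0 <= j1)%N -> (J0 <= j2)%N -> (J0 <= J)%N ->
  exists P p b, regression P p b /\
  C * (2 ^+ (minn j1 j2 * d) * `|u|) <= `|gap p b (kappa w C1 C2 P j1 j2) J (minn j1 j2) u|.
Proof.
have [e e0 [p [b [hp hb bd]]]] := feasible.
have [c c0 [Cc Cc0 hcard]] := CDV_card w_CDV.
exists (e ^+ 2 * c); first by rewrite mulr_gt0// exprn_gt0.
move=> j1 j2 J u J01 J02 J0J; set j := minn j1 j2.
have J0j : (J0 <= j)%N by rewrite leq_min J01.
have Me : M - e <= M by lra.
have hp' := holder_mono Me hp; have hb' := holder_mono Me hb.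
have cp := unif_continuous_cmeas hp.1; have cb := unif_continuous_cmeas hb.1.
have bds (s : R) : `|s| = e -> forall x, cube x -> [/\ C1 <= p x - `|e|, p x + `|e| <= C2,
     C1 <= b x - `|s| & b x + `|s| <= C2].
  by move=> -> x /bd[/andP[h1 h2] /andP[h3 h4]]; rewrite gtr0_norm//; split; lra.
have [P1 [p1 [b1 [reg1 g1]]]] := realise hp' hb' (cmeas_cst d e) (bds e (gtr0_norm e0)).
have ne : `|- e| = e by rewrite normrN gtr0_norm.
have [P2 [p2 [b2 [reg2 g2]]]] := realise hp' hb' (cmeas_cst d (- e)) (bds (- e) ne).
have {}g1 := g1 j1 j2 J u; have {}g2 := g2 j1 j2 J u; rewrite -/j in g1 g2.
have cpbK : cmeas (fun x => p x * b x * Kd j x) by apply: cmeasM => //; exact: cmeasM.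
have EK (s : R) : Ec (fun x => (p x * b x + e * s) * Kd j x) =
    Ec (fun x => p x * b x * Kd j x) + e * s * #|loc d w j|%:R.
  rewrite -Ec_Kd// -EcZl// -EcD//; last by apply: cmeasM => //; exact: cmeas_cst.
  by apply: eq_Ec => x _; ring.
rewrite !EK in g1 g2.
have D : gap p1 b1 (kappa w C1 C2 P1 j1 j2) J j u - gap p2 b2 (kappa w C1 C2 P2 j1 j2) J j u =
    - (2 * (u * e ^+ 2 * #|loc d w j|%:R)).
  by rewrite g1 g2 /gap; ring.
have V : e ^+ 2 * c * (2 ^+ (j * d) * `|u|) <= `|u * e ^+ 2 * #|loc d w j|%:R|.
  have /andP[hc _] := hcard _ J0j.
  rewrite normrM normr_nat normrM (ger0_norm (sqr_ge0 e)).
  rewrite [leLHS](_ : _ = `|u| * e ^+ 2 * (c * 2 ^+ (j * d))); last by ring.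
  by rewrite ler_wpM2l// mulr_ge0// sqr_ge0.
have [G1|G1] := leP (e ^+ 2 * c * (2 ^+ (j * d) * `|u|)) `|gap p1 b1 (kappa w C1 C2 P1 j1 j2) J j u|.
  by exists P1, p1, b1.
exists P2, p2, b2; split=> //.
move: V D G1; set x := u * e ^+ 2 * _; set y := gap p1 _ _ _ _ _; set z := gap p2 _ _ _ _ _.
set v := e ^+ 2 * c * _ => V D G1.
have N : `|2 * x| <= `|y| + `|z|.
  by rewrite -normrN -D; exact: ler_normB.
rewrite normrM ger0_norm// in N; lra.
Qed.

(** This sum of wavelets is orthogonal to V_J and has coefficients 0 or 1, so
   that its inner product with itself counts the locations at level J. *)
Let bump J (x : d.-tuple R) : R := \sum_(m : loc d w J) Psi (orient1 d) m x.
Let cbump J : cmeas (bump J).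
Proof. by apply: cmeas_sum => m; exact: (cmeas_Psi w_CDV). Qed.
Let o1 : orient1 d != orient0 d. Proof. exact: orient1_neq0. Qed.

Let ip_bumpE J (g : d.-tuple R -> R) : cmeas g -> ip (bump J) g = \sum_(m : loc d w J) ip (Psi (orient1 d) m) g.
Proof.
move=> cg; transitivity (ip (fun x => \sum_(m : loc d w J) 1 * Psi (orient1 d) m x) g).
  by apply: eq_ipl => x _; apply: eq_bigr => m _; rewrite mul1r.
rewrite ip_suml//; last by move=> m; exact: (cmeas_Psi w_CDV).
by apply: eq_bigr => m _; rewrite mul1r.
Qed.

Let ip_bump_Phi J j (m : loc d w j) : (J0 <= j)%N -> (j <= J)%N -> ip (bump J) (Phi m) = 0.
Proof.
move=> J0j jJ; rewrite ip_bumpE; last exact: (cmeas_Phi w_CDV).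
by rewrite big1// => m' _; rewrite ipC (ip_Phi_Psi w_CDV).
Qed.

Let ip_bump_Psi J l o (m : loc d w l) : (J0 <= J)%N -> (J0 <= l)%N -> o != orient0 d ->
  `|ip (bump J) (Psi o m)| <= (l == J)%:R.
Proof.
move=> J0J J0l o0; rewrite ip_bumpE; last exact: (cmeas_Psi w_CDV).
case: eqP => [lJ|/eqP lJ]; last first.
  by rewrite big1 ?normr0// => m' _; rewrite (ip_Psi_levels w_CDV)// eq_sym.
subst l; rewrite (eq_bigr (fun m' => (orient1 d == o)%:R * (m' == m)%:R)); last first.
  by move=> m' _; rewrite (ip_Psi w_CDV)// -mulnb natrM.
rewrite (bigD1 m)//= eqxx mulr1 big1 ?addr0; last by move=> m' /negbTE ->; rewrite mulr0.
by case: (_ == _); rewrite ?normr1 ?normr0.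
Qed.

Let ip_bump_bump J : (J0 <= J)%N -> ip (bump J) (bump J) = #|loc d w J|%:R.
Proof.
move=> J0J; rewrite ip_bumpE// (eq_bigr (fun=> 1)) ?sumr_const// => m _.
rewrite ipC ip_bumpE; last exact: (cmeas_Psi w_CDV).
rewrite (bigD1 m)//= (ip_Psi w_CDV)// !eqxx big1 ?addr0// => m' mm'.
by rewrite (ip_Psi w_CDV)// eqxx (negbTE mm').
Qed.

(** Only coefficients at level J change, by at most |t|: the perturbation
   uses up at most e of the radius M. *)
Let holder_bump gam e J t p : (J0 <= J)%N -> holder_ball w J0 gam (M - e) p ->
  2 `^ (J%:R * (gam + d%:R / 2)) * `|t| <= e ->
  holder_ball w J0 gam M (fun x => p x + t * bump J x).
Proof.
move=> J0J [ucp hp] te; have cp := unif_continuous_cmeas ucp.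
have cth : cmeas (fun x => t * bump J x) by apply: cmeasM => //; exact: cmeas_cst.
have e0 : 0 <= e by apply: le_trans te; rewrite mulr_ge0 ?powR_ge0.
have innE (g : d.-tuple R -> R) : cmeas g ->
    inner (fun x => p x + t * bump J x) g = inner p g + t * ip (bump J) g.
  move=> cg; rewrite !inner_Ec//; last exact: cmeasD.
  by rewrite -[LHS]/(ip _ g) ipDl// ipZl.
split.
  move=> eps eps0; have e2 : 0 < eps / 2 by rewrite divr_gt0.
  have [r1 r10 H1] := ucp _ e2.
  have t1 : 0 < `|t| + 1 by rewrite ltr_wpDl.
  have [r2 r20 H2] := Psi_sum_unif_continuous w_CDV J (divr_gt0 e2 t1).
  exists (Num.min r1 r2); first by rewrite lt_min r10.
  move=> x y cx cy xy.
  have h1 : `|p x - p y| < eps / 2.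
    by apply: H1 => // i; apply: lt_le_trans (xy i) _; rewrite ge_min lexx.
  have h2 : `|bump J x - bump J y| < eps / 2 / (`|t| + 1).
    by apply: H2 => // i; apply: lt_le_trans (xy i) _; rewrite ge_min lexx orbT.
  rewrite (_ : _ - _ = (p x - p y) + t * (bump J x - bump J y)); last by ring.
  apply: le_lt_trans (ler_normD _ _) _; rewrite [ltRHS]splitr; apply: ltr_leD => //.
  rewrite normrM; apply: (@le_trans _ _ ((`|t| + 1) * (eps / 2 / (`|t| + 1)))).
    by apply: ler_pM => //; [rewrite lerDl|exact: ltW].
  by rewrite mulrC divfK// gt_eqF.
rewrite /holder_norm.
have -> : \big[Num.max/0]_(m : loc d w J0) `|inner (fun x => p x + t * bump J x) (Phi m)| =
    \big[Num.max/0]_(m : loc d w J0) `|inner p (Phi m)|.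
  apply: eq_bigr => m _; rewrite innE ?ip_bump_Phi ?mulr0 ?addr0//.
  exact: (cmeas_Phi w_CDV).
have -> : M%:E = ((M - e)%:E + e%:E)%E by rewrite -EFinD subrK.
apply: le_trans (leeD2r _ hp); rewrite /holder_norm -addeA leeD2l//.
apply: ge_ereal_sup => _ [l [v [m [J0l v0 ->]]]].
have cPsi : cmeas (Psi v m) by exact: (cmeas_Psi w_CDV).
rewrite innE//.
apply: (@le_trans _ _ ((2 `^ (l%:R * (gam + d%:R / 2)) * `|inner p (Psi v m)|)%:E + e%:E)%E); last first.
  by rewrite leeD2r//; apply: ereal_sup_ubound; exists l, v, m.
rewrite -EFinD lee_fin.
apply: (@le_trans _ _ (2 `^ (l%:R * (gam + d%:R / 2)) * (`|inner p (Psi v m)| + `|t| * (l == J)%:R))).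
  rewrite ler_wpM2l ?powR_ge0//; apply: le_trans (ler_normD _ _) _.
  by rewrite lerD2l normrM ler_wpM2l//; exact: ip_bump_Psi.
rewrite mulrDr lerD2l; case: eqP => [->|_]; first by rewrite mulr1.
by rewrite !mulr0.
Qed.

Let four_max (g1 g2 g3 g4 v : R) : g1 - g2 - g3 + g4 = 4 * v ->
  [\/ v <= `|g1|, v <= `|g2|, v <= `|g3| | v <= `|g4|].
Proof.
move=> E; have [h1|h1] := leP v `|g1|; first by constructor 1.
have [h2|h2] := leP v `|g2|; first by constructor 2.
have [h3|h3] := leP v `|g3|; first by constructor 3.
have [h4|h4] := leP v `|g4|; first by constructor 4.
exfalso; have a1 := ler_norm g1; have a4 := ler_norm g4.
have a2 := ler_norm (- g2); have a3 := ler_norm (- g3); rewrite !normrN in a2 a3.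
by lra.
Qed.

(** Perturbing p and b by multiples s and t of the bump and compensating with the
    conditional covariance, so that E[AY | X] does not move, leaves everything
    unchanged but the inner product of p and b: the product st is isolated by
    alternating the signs of the perturbations. *)
Lemma gap_lower_trunc : exists2 C : R, 0 < C & forall j1 j2 J u,
  (J0 <= j1)%N -> (J0 <= j2)%N -> (minn j1 j2 <= J)%N ->
  exists P p b, regression P p b /\
  C * q ^+ J <= `|gap p b (kappa w C1 C2 P j1 j2) J (minn j1 j2) u|.
Proof.
have [e e0 [p [b [hp hb bd]]]] := feasible.
have [c c0 [Cc Cc0 hcard]] := CDV_card w_CDV.
have [Cp Cp0 hCp] := Psi_sum_le d_gt0 w_CDV.
(* The bound th on the perturbations in sup norm keeps p and b at distance e/2
   from C1 and C2; as 2 (B + 1) th <= (e / 2)^2, the compensation c_ has absolute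
   value at most e/2. *)
pose th := Num.min (e / 2) (e ^+ 2 / (8 * (B + 1))).
have B1 : 0 < B + 1 by rewrite ltr_wpDl.
have th0 : 0 < th by rewrite lt_min !divr_gt0 ?exprn_gt0 ?mulr_gt0.
(* The bound tau on the perturbations in Hölder norm. *)
pose tau := Num.min e (th / Cp).
have tau0 : 0 < tau by rewrite lt_min e0 divr_gt0.
have tau_e : tau <= e by rewrite ge_min lexx.
have tau_th : tau * Cp <= th by rewrite -ler_pdivlMr// ge_min lexx orbT.
have th_e : th <= e / 2 by rewrite ge_min lexx.
have th_e2 : 8 * (B + 1) * th <= e ^+ 2.
  by rewrite mulrC -ler_pdivlMr ?mulr_gt0// ge_min lexx orbT.
exists (tau ^+ 2 * c); first by rewrite mulr_gt0// exprn_gt0.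
move=> j1 j2 J u J01 J02 jJ; set j := minn j1 j2.
have J0j : (J0 <= j)%N by rewrite leq_min J01.
have J0J : (J0 <= J)%N by exact: leq_trans J0j jJ.
have cp := unif_continuous_cmeas hp.1; have cb := unif_continuous_cmeas hb.1.
pose pw gam : R := 2 `^ (J%:R * (gam + d%:R / 2)).
have pw0 gam : 0 < pw gam by rewrite powR_gt0.
pose ta := tau / pw alpha; pose tb := tau / pw beta.
have ta0 : 0 < ta by rewrite divr_gt0. have tb0 : 0 < tb by rewrite divr_gt0.
have bump_le gam (x : d.-tuple R) : 0 < gam -> tau / pw gam * `|bump J x| <= th.
  move=> gam0; apply: le_trans tau_th; rewrite -mulrA ler_pM2l//.
  rewrite mulrC ler_pdivrMr//; apply: le_trans (hCp _ _ J0J) _; rewrite ler_pM2l//.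
  have -> : Num.sqrt (2 ^+ J) ^+ d = 2 `^ (J%:R * (d%:R / 2)) :> R.
    rewrite (_ : 2 ^+ J = 2 `^ J%:R); last by rewrite powR_mulrn.
    rewrite -powR12_sqrt ?powR_ge0// -powRrM -powR_mulrn ?powR_ge0// -powRrM.
    by congr (_ `^ _); rewrite -mulrA [_^-1 * _]mulrC.
  by apply: ler_powR; rewrite ?ler1n// ler_wpM2l// lerDr ltW.
pose ps (s : R) x := p x + s * bump J x.
pose bs (t : R) x := b x + t * bump J x.
(* Chosen so that ps s * bs t + (e / 2) * c_ s t = p * b. *)
pose c_ s t x := (e / 2)^-1 * (p x * b x - ps s x * bs t x).
have hps s : `|s| = ta -> holder_ball w J0 alpha M (ps s).
  move=> hs; apply: (holder_bump J0J hp); rewrite hs /ta mulrC divfK//.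
  by rewrite gt_eqF// pw0.
have hbs t : `|t| = tb -> holder_ball w J0 beta M (bs t).
  move=> ht; apply: (holder_bump J0J hb); rewrite ht /tb mulrC divfK//.
  by rewrite gt_eqF// pw0.
have cps s : cmeas (ps s) by apply: cmeasD => //; apply: cmeasM => //; exact: cmeas_cst.
have cbs t : cmeas (bs t) by apply: cmeasD => //; apply: cmeasM => //; exact: cmeas_cst.
have cc s t : cmeas (c_ s t).
  by apply: cmeasM; [exact: cmeas_cst|apply: cmeasB; exact: cmeasM].
have in_le y : C1 <= y <= C2 -> `|y| <= B.
  by move=> hy; rewrite -(clamp_id hy).
have bds s t : `|s| = ta -> `|t| = tb -> forall x, cube x ->
    [/\ C1 <= ps s x - `|e / 2|, ps s x + `|e / 2| <= C2,
     C1 <= bs t x - `|c_ s t x| & bs t x + `|c_ s t x| <= C2].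
  move=> hs ht x cx; have [/andP[h1 h2] /andP[h3 h4]] := bd x cx.
  have e2 : 0 < e / 2 by rewrite divr_gt0.
  rewrite (gtr0_norm e2).
  have k1 : `|s * bump J x| <= th by rewrite normrM hs; exact: bump_le.
  have k2 : `|t * bump J x| <= th by rewrite normrM ht; exact: bump_le.
  have := k1; have := k2; rewrite !ler_norml => /andP[l3 l4] /andP[l1 l2].
  have pB : `|p x| <= B by apply: in_le; apply/andP; split; lra.
  have bB : `|bs t x| <= B by apply: in_le; rewrite /bs; apply/andP; split; lra.
  have cle : `|c_ s t x| <= e / 2.
    rewrite /c_ normrM gtr0_norm ?invr_gt0// mulrC ler_pdivrMr//.
    rewrite (_ : _ - _ = - (p x * (t * bump J x) + bs t x * (s * bump J x))); last first.
      by rewrite /ps /bs; ring.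
    rewrite normrN; apply: le_trans (ler_normD _ _) _.
    apply: (@le_trans _ _ (B * th + B * th)).
      by rewrite ![`|_ * (_ * bump J x)|]normrM; apply: lerD; apply: ler_pM.
    apply: (@le_trans _ _ (2 * (B + 1) * th)); first by nra.
    by move: th_e2; nra.
  by rewrite /ps /bs in bB *; split; lra.
have dotE i s t : (J0 <= i)%N -> (i <= J)%N -> dotp w i (ps s) (bs t) = dotp w i p b.
  move=> J0i iJ; apply: eq_bigr => m _; have cPhi := cmeas_Phi w_CDV m.
  have cth (s' : R) : cmeas (fun x => s' * bump J x) by apply: cmeasM => //; exact: cmeas_cst.
  by rewrite /ps /bs !ipDl// !ipZl// ip_bump_Phi// !mulr0 !addr0.
pose k0 := Ec (fun x => p x * b x * Kd j x).
have kE s t : Ec (fun x => (ps s x * bs t x + e / 2 * c_ s t x) * Kd j x) = k0.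
  by apply: eq_Ec => x _; congr (_ * _); rewrite /c_; field; rewrite gt_eqF.
have gE s t : gap (ps s) (bs t) k0 J j u = s * t * ip (bump J) (bump J) +
    s * ip (bump J) b + t * ip (bump J) p + gap p b k0 J j u.
  rewrite /gap !dotE//.
  have cth (s' : R) : cmeas (fun x => s' * bump J x) by apply: cmeasM => //; exact: cmeas_cst.
  have -> : ip (ps s) (bs t) = ip p b + t * ip (bump J) p + s * (ip (bump J) b + t * ip (bump J) (bump J)).
    rewrite /ps ipDl// ipZl// ipC (ipC (bump J) (bs t)) /bs !ipDl// !ipZl//.
    by rewrite (ipC b p) (ipC b (bump J)).
  by ring.
have R_ s t (hs : `|s| = ta) (ht : `|t| = tb) :
    exists P p b, regression P p b /\ gap p b (kappa w C1 C2 P j1 j2) J j u =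
      gap (ps s) (bs t) k0 J j u.
  have [P [p' [b' [reg g]]]] := realise (hps _ hs) (hbs _ ht) (cc s t) (bds _ _ hs ht).
  by exists P, p', b'; split=> //; rewrite g kE.
have n1 : `|ta| = ta by exact: gtr0_norm.
have n2 : `|- ta| = ta by rewrite normrN.
have n3 : `|tb| = tb by exact: gtr0_norm.
have n4 : `|- tb| = tb by rewrite normrN.
have V : tau ^+ 2 * c * q ^+ J <= ta * tb * ip (bump J) (bump J).
  rewrite ip_bump_bump//; have /andP[hc _] := hcard _ J0J.
  apply: (@le_trans _ _ (ta * tb * (c * 2 ^+ (J * d)))); last by rewrite ler_pM2l// mulr_gt0.
  have -> : ta * tb = tau ^+ 2 * (q ^+ J / 2 ^+ (J * d)).
    rewrite /ta /tb mulrACA -expr2; congr (_ * _).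
    have -> : q ^+ J = 2 `^ (- (alpha + beta) * J%:R) by rewrite powRrM powR_mulrn// powR_ge0.
    have -> : 2 ^+ (J * d) = 2 `^ (J * d)%:R :> R by rewrite powR_mulrn.
    have nz : (2 : R) != 0 by rewrite pnatr_eq0.
    rewrite -!powRN -!powRD ?nz ?implybT//.
    by congr (_ `^ _); rewrite natrM; lra.
  rewrite le_eqVlt; apply/orP; left; apply/eqP; field.
  by rewrite expf_neq0// pnatr_eq0.
have E : gap (ps ta) (bs tb) k0 J j u - gap (ps ta) (bs (- tb)) k0 J j u -
    gap (ps (- ta)) (bs tb) k0 J j u + gap (ps (- ta)) (bs (- tb)) k0 J j u =
    4 * (ta * tb * ip (bump J) (bump J)).
  by rewrite !gE; ring.
case: (four_max E) => H.
- by have [P [p' [b' [reg g]]]] := R_ _ _ n1 n3; exists P, p', b'; split=> //; rewrite g (le_trans V).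
- by have [P [p' [b' [reg g]]]] := R_ _ _ n1 n4; exists P, p', b'; split=> //; rewrite g (le_trans V).
- by have [P [p' [b' [reg g]]]] := R_ _ _ n2 n3; exists P, p', b'; split=> //; rewrite g (le_trans V).
- by have [P [p' [b' [reg g]]]] := R_ _ _ n2 n4; exists P, p', b'; split=> //; rewrite g (le_trans V).
Qed.

End bias.

(** * Suprema over the model *)

Section suprema.
Context (R : realType) (d : nat) (w : wavelets R) (S J0 : nat).
Hypotheses (d_gt0 : (0 < d)%N) (w_CDV : is_CDV_basis d w S J0).
Context (alpha beta M C1 C2 : R).
Hypotheses (alpha_gt0 : 0 < alpha) (beta_gt0 : 0 < beta) (M_gt0 : 0 < M).
Hypothesis feasible : strictly_feasible d w J0 alpha beta M C1 C2.
Notation Ps := (model w J0 alpha beta M C1 C2).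
Notation q := (2 `^ (- (alpha + beta)) : R).

Lemma resolution_mono (i j : nat) : (i <= j)%N -> resolution R d i <= resolution R d j.
Proof. by move=> ij; rewrite ler_weXn2l ?ler1n// leq_mul2r ij orbT. Qed.

Lemma kminE j1 j2 : kmin R d j1 j2 = 2 ^+ (minn j1 j2 * d).
Proof.
rewrite /kmin; case: (leqP j1 j2) => [|/ltnW] /resolution_mono h.
  by rewrite (min_idPl h).
by rewrite (min_idPr h).
Qed.

Lemma kmaxE j1 j2 : kmax R d j1 j2 = 2 ^+ (maxn j1 j2 * d).
Proof.
rewrite /kmax; case: (leqP j1 j2) => [|/ltnW] /resolution_mono h.
  by rewrite (max_idPr h).
by rewrite (max_idPl h).
Qed.

Lemma resolution_rate j : (2 ^+ (j * d)) `^ (- ((alpha + beta) / d%:R)) = q ^+ j.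
Proof.
have dn0 : d%:R != 0 :> R by rewrite pnatr_eq0 -lt0n.
have -> : 2 ^+ (j * d) = 2 `^ (j * d)%:R :> R by rewrite powR_mulrn.
rewrite -powRrM -powR_mulrn ?powR_ge0// -powRrM; congr (_ `^ _).
by rewrite natrM; field.
Qed.

(** For the lower bound it is enough that the supremum dominates each of the
   two rates, possibly through different laws. *)
Lemma bias_asymp (est : estimator R d) (Jf : nat -> nat -> nat) (sg : R) :
  `|sg| = 1 -> (forall j1 j2, (minn j1 j2 <= Jf j1 j2)%N) ->
  (forall P p b n j1 j2, regression w J0 alpha beta M C1 C2 P p b -> (0 < n)%N ->
    (J0 <= j1)%N -> (J0 <= j2)%N ->
    'E_(samples_law P n)[(fun s => est n j1 j2 s - psi P)%R]%E =
    (gap w p b (kappa w C1 C2 P j1 j2) (Jf j1 j2) (minn j1 j2) (sg * n%:R^-1))%:E) ->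
  asymp J0 (sup_bias Ps est) (fun n j1 j2 =>
    (Num.max (q ^+ Jf j1 j2) (2 ^+ (minn j1 j2 * d) / n%:R))%:E).
Proof.
move=> sg1 hJ biasE.
have JfJ0 j1 j2 : (J0 <= j1)%N -> (J0 <= j2)%N -> (J0 <= Jf j1 j2)%N.
  by move=> h1 h2; apply: leq_trans (hJ j1 j2); rewrite leq_min h1.
have nsg n : `|sg * n%:R^-1| = n%:R^-1 :> R.
  by rewrite normrM sg1 mul1r ger0_norm// invr_ge0.
split.
  have [C C0 hC] := gap_upper d_gt0 w_CDV alpha_gt0 beta_gt0 M_gt0 feasible.
  exists C => //; exists 1%N => n j1 j2 n0 J01 J02.
  apply: ge_ereal_sup => _ [P mP <-].
  have [p [b [reg hp hb]]] := model_regression mP.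
  rewrite (biasE P p b)// abse_EFin -EFinM lee_fin.
  have := hC P p b j1 j2 (Jf j1 j2) (sg * n%:R^-1) mP reg hp hb J01 J02 (JfJ0 _ _ J01 J02).
  by rewrite nsg.
have [c1 c10 h1] := gap_lower_diag w_CDV feasible.
have [c2 c20 h2] := gap_lower_trunc d_gt0 w_CDV alpha_gt0 beta_gt0 feasible.
exists (c1^-1 + c2^-1); first by rewrite addr_gt0 ?invr_gt0.
exists 1%N => n j1 j2 n0 J01 J02.
set s := sup_bias _ _ _ _ _.
have lower (c x : R) P (p b : d.-tuple R -> R) : 0 < c -> 0 <= x -> c^-1 <= c1^-1 + c2^-1 ->
    regression w J0 alpha beta M C1 C2 P p b ->
    c * x <= `|gap w p b (kappa w C1 C2 P j1 j2) (Jf j1 j2) (minn j1 j2) (sg * (n%:R : R)^-1)| ->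
    (x%:E <= (c1^-1 + c2^-1)%:E * s)%E.
  move=> c0 x0 cc reg hx; have mP : Ps P by case: reg.
  have xs : ((c * x)%:E <= s)%E.
    rewrite -lee_fin in hx; apply: le_trans hx _; apply: ereal_sup_ubound.
    by exists P => //; rewrite (biasE P p b n j1 j2 reg n0 J01 J02) abse_EFin.
  rewrite (_ : x%:E = (c^-1)%:E * (c * x)%:E)%E; last first.
    by rewrite -EFinM mulKf// gt_eqF.
  by apply: lee_pmul; rewrite ?lee_fin ?invr_ge0 ?mulr_ge0// ltW.
have q0 : 0 <= q ^+ Jf j1 j2 by rewrite exprn_ge0// powR_ge0.
have k0 : 0 <= 2 ^+ (minn j1 j2 * d) / n%:R :> R by rewrite divr_ge0 ?exprn_ge0.
rewrite /Num.max; case: ifP => _.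
  have [P [p [b [reg H]]]] := h1 j1 j2 (Jf j1 j2) (sg * n%:R^-1) J01 J02 (JfJ0 _ _ J01 J02).
  rewrite nsg in H; apply: (lower c1 _ P p b) => //.
  by rewrite lerDl invr_ge0 ltW.
have [P [p [b [reg H]]]] := h2 j1 j2 (Jf j1 j2) (sg * n%:R^-1) J01 J02 (hJ j1 j2).
apply: (lower c2 _ P p b) => //.
by rewrite lerDr invr_ge0 ltW.
Qed.

(** The constants depend neither on the law nor on the sample size nor on the
   levels, which makes the variance bounds uniform. *)
Lemma model_constants : exists B Kc L : R, [/\ 0 <= B, 0 <= Kc, 0 <= L,
  (forall o : datum R d, `|obsAc C1 C2 o| <= B) /\ (forall o : datum R d, `|obsYc C1 C2 o| <= B) &
  forall j (x y : d.-tuple R), (J0 <= j)%N ->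
    `|proj_kernel w j x y| <= Kc * 2 ^+ (j * d) * near_ind L j y x].
Proof.
have [Kc Kc0 [L L0 hK]] := proj_kernel_le d_gt0 w_CDV.
have C12 := feasible_C12 feasible.
exists (`|C1| + `|C2|), Kc, L; split => //; [exact: ltW|exact: ltW|].
by split=> o; exact: normr_clamp.
Qed.

Lemma var_lesssim (est : estimator R d) (rate : nat -> nat -> nat -> R) (C : R) :
  0 <= C -> (forall n j1 j2, (0 < n)%N -> 0 <= rate n j1 j2) ->
  (forall n j1 j2, measurable_fun setT (est n j1 j2)) ->
  (forall P n j1 j2, Ps P -> (0 < n)%N -> (J0 <= j1)%N -> (J0 <= j2)%N ->
    bmeas (est n j1 j2 \o @clampS R d C1 C2 n) /\
    Var (samples_law P n) (est n j1 j2 \o @clampS R d C1 C2 n) <= C * rate n j1 j2) ->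
  lesssim J0 (sup_var Ps est) (fun n j1 j2 => (rate n j1 j2)%:E).
Proof.
move=> C0 r0 mest H; exists (C + 1); first by rewrite ltr_wpDl.
exists 1%N => n j1 j2 n0 J01 J02; apply: ge_ereal_sup => _ [P mP <-].
have [b V] := H P n j1 j2 mP n0 J01 J02.
rewrite (V_clamp (admissible_full mP) (mest n j1 j2) b) -EFinM lee_fin.
apply: le_trans V _; rewrite ler_wpM2r ?r0//; by rewrite lerDl.
Qed.

End suprema.

Theorem theorem2 (R : realType) (d S J0 : nat) (w : wavelets R)
    (alpha beta M C1 C2 : R)
    (d_gt0 : (0 < d)%N) (S_ge1 : (1 <= S)%N)
    (alpha_gt0 : 0 < alpha) (beta_gt0 : 0 < beta) (M_gt0 : 0 < M)
    (S_gt : Num.max alpha beta < S%:R) (J0_ge : (S <= 2 ^ J0)%N)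
    (w_CDV : is_CDV_basis d w S J0)
    (feasible : strictly_feasible d w J0 alpha beta M C1 C2) :
  let Ps : set (probability (datum R d) R) := model w J0 alpha beta M C1 C2 in
  let k := @kmin R d in
  let K := @kmax R d in
  let rate := - ((alpha + beta) / d%:R) in
  [/\ asymp J0 (sup_bias Ps (@psi_INT R d w))
        (fun n j1 j2 =>
           (Num.max (k j1 j2 `^ rate) (k j1 j2 / n%:R))%:E)
      /\ lesssim J0 (sup_var Ps (@psi_INT R d w))
        (fun n j1 j2 =>
           (n%:R^-1 + k j1 j2 / n%:R ^+ 2 + k j1 j2 ^+ 2 / n%:R ^+ 3)%:E),
      asymp J0 (sup_bias Ps (@psi_MC R d w))
        (fun n j1 j2 =>
           (Num.max (k j1 j2 `^ rate) (k j1 j2 / n%:R))%:E)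
      /\ lesssim J0 (sup_var Ps (@psi_MC R d w))
        (fun n j1 j2 =>
           (n%:R^-1 + K j1 j2 / n%:R ^+ 2 + k j1 j2 * K j1 j2 / n%:R ^+ 3
            + k j1 j2 ^+ 2 * K j1 j2 / n%:R ^+ 4)%:E)
    & asymp J0 (sup_bias Ps (@psi_IF R d w))
        (fun n j1 j2 =>
           (Num.max (K j1 j2 `^ rate) (k j1 j2 / n%:R))%:E)
      /\ lesssim J0 (sup_var Ps (@psi_IF R d w))
        (fun n j1 j2 =>
           (n%:R^-1 + K j1 j2 / n%:R ^+ 2 + k j1 j2 * K j1 j2 / n%:R ^+ 3
            + k j1 j2 ^+ 2 * K j1 j2 / n%:R ^+ 4)%:E)].
Proof.
move=> Ps k K rate.
have C12 := feasible_C12 feasible.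
have [B [Kc [L [B0 Kc0 L0 [hA hY] hK]]]] := model_constants d_gt0 w_CDV feasible.
have k0 j1 j2 : 0 <= k j1 j2 by rewrite /k kminE exprn_ge0.
have K0 j1 j2 : 0 <= K j1 j2 by rewrite /K kmaxE exprn_ge0.
have kE : (fun (n j1 j2 : nat) => (Num.max (k j1 j2 `^ rate) (k j1 j2 / n%:R))%:E) =
    fun n j1 j2 => (Num.max (2 `^ (- (alpha + beta)) ^+ minn j1 j2)
      (2 ^+ (minn j1 j2 * d) / n%:R))%:E.
  by apply/funext => n; apply/funext => j1; apply/funext => j2;
    rewrite /k kminE resolution_rate.
have KE : (fun (n j1 j2 : nat) => (Num.max (K j1 j2 `^ rate) (k j1 j2 / n%:R))%:E) =
    fun n j1 j2 => (Num.max (2 `^ (- (alpha + beta)) ^+ maxn j1 j2)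
      (2 ^+ (minn j1 j2 * d) / n%:R))%:E.
  by apply/funext => n; apply/funext => j1; apply/funext => j2;
    rewrite /k /K kminE kmaxE resolution_rate.
have mM j1 j2 : (minn j1 j2 <= maxn j1 j2)%N.
  by rewrite (leq_trans (geq_minl _ _))// leq_maxl.
have rate3_ge0 n j1 j2 : (0 < n)%N ->
    0 <= n%:R^-1 + k j1 j2 / n%:R ^+ 2 + k j1 j2 ^+ 2 / n%:R ^+ 3.
  by move=> _; rewrite !addr_ge0 ?divr_ge0 ?invr_ge0 ?exprn_ge0.
have rate4_ge0 n j1 j2 : (0 < n)%N -> 0 <= n%:R^-1 + K j1 j2 / n%:R ^+ 2 +
    k j1 j2 * K j1 j2 / n%:R ^+ 3 + k j1 j2 ^+ 2 * K j1 j2 / n%:R ^+ 4.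
  by move=> _; rewrite !addr_ge0 ?divr_ge0 ?mulr_ge0 ?invr_ge0 ?exprn_ge0.
have B4 : 0 <= B ^+ 4 by rewrite exprn_ge0.
have cT_ge0 : 0 <= cT B Kc by rewrite !addr_ge0 ?mulr_ge0 ?exprn_ge0.
have c_ge0 m : 0 <= ((2 * L) ^+ d) ^+ m by rewrite !exprn_ge0// mulr_ge0.
have c2_ge0 : 0 <= c2 d B Kc L.
  by apply: mulr_ge0; [exact: sqr_ge0|rewrite addr_ge0// (c_ge0 1%N)].
have c4_ge0 : 0 <= c4 d B Kc L.
  apply: mulr_ge0; first by rewrite exprn_ge0// mulr_ge0.
  by have := c_ge0 1%N; have := c_ge0 2; have := c_ge0 3; have := c_ge0 4; lra.
split; split.
- rewrite kE; apply: (bias_asymp d_gt0 w_CDV alpha_gt0 beta_gt0 M_gt0 feasible (sg := 1) (Jf := minn)) => //; first exact: normr1.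
  move=> P p b n j1 j2 reg n0 J01 J02; rewrite mul1r.
  exact: (bias_INT w_CDV feasible reg n0 J01 J02).
- apply: (var_lesssim (C := 2 * B ^+ 4 + 2 * cT B Kc)) => //.
  + by rewrite addr_ge0 ?mulr_ge0.
  + by move=> n j1 j2; exact: (measurable_psi_INT w_CDV).
  move=> P n j1 j2 mP n0 J01 J02; have [lawX _ _ _] := mP.
  have [b _] := Ex_INT w_CDV P C12 n0 J01 J02; split=> //.
  have := Var_INT w_CDV C12 lawX n0 J01 J02 B0 Kc0 hA hY hK.
  by rewrite /k kminE !exprVn.
- rewrite kE; apply: (bias_asymp d_gt0 w_CDV alpha_gt0 beta_gt0 M_gt0 feasible (sg := 1) (Jf := minn)) => //; first exact: normr1.
  move=> P p b n j1 j2 reg n0 J01 J02; rewrite mul1r.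
  exact: (bias_MC w_CDV feasible reg n0 J01 J02).
- apply: (var_lesssim (C := 2 * B ^+ 4 + 2 * c4 d B Kc L + 2 * cT B Kc)) => //.
  + by move: B4 c4_ge0 cT_ge0; lra.
  + by move=> n j1 j2; exact: (measurable_psi_MC w_CDV).
  move=> P n j1 j2 mP n0 J01 J02; have [lawX _ _ _] := mP.
  have [b _] := Ex_MC w_CDV C12 lawX n0 J01 J02; split=> //.
  have := Var_MC w_CDV C12 lawX n0 J01 J02 B0 Kc0 L0 hA hY hK.
  by rewrite /k /K kminE kmaxE !exprVn.
(* The diagonal term enters with the opposite sign, since the plug-in term is
   added and not subtracted. *)
- rewrite KE; apply: (bias_asymp d_gt0 w_CDV alpha_gt0 beta_gt0 M_gt0 feasible (sg := -1) (Jf := maxn)) => //; first by rewrite normrN1.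
  move=> P p b n j1 j2 reg n0 J01 J02; rewrite mulN1r.
  exact: (bias_IF w_CDV feasible reg n0 J01 J02).
- apply: (var_lesssim (C := 12 * B ^+ 4 + 8 * B ^+ 2 * c2 d B Kc L + 4 * c4 d B Kc L + 2 * cT B Kc)) => //.
  + have B2c2 : 0 <= B ^+ 2 * c2 d B Kc L by apply: mulr_ge0 => //; exact: sqr_ge0.
    by move: B4 c4_ge0 cT_ge0 B2c2; lra.
  + by move=> n j1 j2; exact: (measurable_psi_IF w_CDV).
  move=> P n j1 j2 mP n0 J01 J02; have [lawX _ _ _] := mP.
  have [b _] := Ex_IF w_CDV C12 lawX n0 J01 J02; split=> //.
  have := Var_IF w_CDV C12 lawX n0 J01 J02 B0 Kc0 L0 hA hY hK.
  by rewrite /k /K kminE kmaxE !exprVn.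
Qed.
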